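(* Let $\mathbb{P}^{N_d}:=\mathbb{P}H^0(\mathbb{P}^n,\mathcal{O}_{\mathbb{P}^n}(d))$ and let $\mathcal{X}\subset\mathbb{P}^n\times\mathbb{P}^{N_d}$ be the universal hypersurface of degree $d$ in $\mathbb{P}^n$. The twisted logarithmic tangent bundle $$T_{\mathbb{P}^n\times\mathbb{P}^{N_d}}(-\log\mathcal{X})(1,0):=T_{\mathbb{P}^n\times\mathbb{P}^{N_d}}(-\log\mathcal{X})\otimes p^*\mathcal{O}_{\mathbb{P}^n}(1)$$ is generated by its global sections, where $p:\mathbb{P}^n\times\mathbb{P}^{N_d}\to\mathbb{P}^n$ is the first projection.
   Context: We work over $\mathbb{C}$, with $n,d\ge 1$. $\mathbb{P}^{N_d}$ is the parameter space of degree $d$ hypersurfaces in $\mathbb{P}^n$, with homogeneous coordinates $[a]=[a_\alpha]_{|\alpha|=d}$, $\alpha\in\mathbb{N}^{n+1}$, and $\mathcal{X}$ is the smooth hypersurface of bidegree $(d,1)$ given by $\sum_{|\alpha|=d}a_\alpha Z^\alpha=0$, where $[Z]=[Z_0:\dots:Z_n]\in\mathbb{P}^n$ and $Z^\alpha=\prod_j Z_j^{\alpha_j}$. For a complex manifold $\overline{V}$ with a normal crossing divisor $D$, the logarithmic tangent sheaf $T_{\overline{V}}(-\log D)$ is the locally free subsheaf of $T_{\overline{V}}$ which equals $T_{\overline{V}}$ outside $D$ and which, at a point $x\in D$ with local coordinates $z_1,\dots,z_m$ such that $D=\{z_1\cdots z_l=0\}$, is $\sum_{i=1}^{l}\mathcal{O}_{\overline{V},x}\,z_i\frac{\partial}{\partial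 z_i}+\sum_{j=l+1}^{m}\mathcal{O}_{\overline{V},x}\frac{\partial}{\partial z_j}$. *)

(* Defs.v *)
From HB Require Import structures.
From mathcomp Require Import all_boot all_order all_algebra.
From mathcomp Require Import all_classical all_reals all_analysis.
From mathcomp Require Import complex.

(* The definitions below are stated over an arbitrary numFieldType K, of which
   only the case K = R[i], R a realType, i.e. the field of complex numbers, is
   meant. *)

Set Implicit Arguments.
Unset Strict Implicit.
Unset Printing Implicit Defensive.

Import Order.TTheory GRing.Theory Num.Theory.
Import numFieldNormedType.Exports.

Local Open Scope classical_set_scope.
Local Open Scope ring_scope.

Section Holomorphic.
Context {K : numFieldType}.

(* f is continuously complex differentiable at the points of S; this is meant
   for open S, and openness is required separately. *)
Definition holo m (S : set 'rV[K]_m) (f : 'rV[K]_m -> K) :=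
  forall x, S x -> differentiable f x /\
    forall v, {for x, continuous (fun y => 'd f y v)}.

Definition holo_map m p (S : set 'rV[K]_m) (F : 'rV[K]_m -> 'rV[K]_p) :=
  forall k, holo S (fun y => F y 0 k).

Lemma holo_cst m (S : set 'rV[K]_m) (c : K) : holo S (fun=> c).
Proof.
move=> x _; split=> [|v]; first exact: differentiable_cst.
have -> : (fun y => 'd (fun=> c : K) y v) = fun=> 0.
  by apply/funext => y; rewrite (_ : (fun=> c) = cst c)// diff_cst.
exact: cst_continuous.
Qed.

Lemma holo_coord m (S : set 'rV[K]_m) k : holo S (fun y => y 0 k).
Proof.
move=> x _; split=> [|v]; first exact: differentiable_coord.
have lin : linear (fun y : 'rV[K]_m => y 0 k : K).
  by move=> a u w; rewrite !mxE.
pose L : {linear 'rV[K]_m -> K} := HB.pack (fun y : 'rV[K]_m => y 0 k : K)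
  (GRing.isLinear.Build _ _ _ _ _ lin).
have -> : (fun y => 'd (fun z : 'rV[K]_m => z 0 k : K) y v) = fun=> v 0 k.
  apply/funext => y; rewrite (_ : (fun z : 'rV[K]_m => z 0 k : K) = L)//.
  by rewrite diff_lin// => z; exact: coord_continuous.
exact: cst_continuous.
Qed.

Lemma holo_div m (S : set 'rV[K]_m) (f g : 'rV[K]_m -> K) : open S ->
  holo S f -> holo S g -> (forall x, S x -> g x != 0) ->
  holo S (fun x => f x / g x).
Proof.
move=> oS hf hg g0 x Sx.
have dV y : S y -> differentiable (fun z => (g z)^-1) y.
  by move=> Sy; apply: differentiableV; [exact: (hg y Sy).1|exact: g0].
have dM y : S y -> differentiable (fun z => f z / g z) y.
  by move=> Sy; apply: differentiableM; [exact: (hf y Sy).1|exact: dV].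
split=> [|v]; first exact: dM.
have dE y : S y -> 'd (fun z => f z / g z) y v =
    f y * (- (g y) ^- 2 * 'd g y v) + (g y)^-1 * 'd f y v.
  move=> Sy; rewrite (_ : (fun z => f z / g z) = f * (fun z => (g z)^-1))//.
  rewrite diffM; [|exact: (hf y Sy).1|exact: dV].
  by rewrite fctE (diffV (hg y Sy).1 (g0 y Sy)).
have Sn : \forall y \near x, S y by exact: open_nbhs_nbhs.
rewrite /prop_for /continuous_at dE//.
apply: (cvg_trans (near_eq_cvg (filterS (fun y Sy => esym (dE y Sy)) Sn))).
have cf : f @ x --> f x.
  by apply: differentiable_continuous; exact: (hf x Sx).1.
have cg : g @ x --> g x.
  by apply: differentiable_continuous; exact: (hg x Sx).1.
have cV : (fun y => (g y)^-1) @ x --> (g x)^-1 by exact: (cvgV (g0 x Sx) cg).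
have cW : (fun y => (g y)^-2) @ x --> (g x)^-2.
  rewrite expr2 invfM; under eq_fun do rewrite expr2 invfM.
  exact: (cvgM cV cV).
have cd := (hf x Sx).2 v; have cd' := (hg x Sx).2 v.
exact: (cvgD (cvgM cf (cvgM (cvgN cW) cd')) (cvgM cV cd)).
Qed.

Lemma holo_lin m p (S : set 'rV[K]_p) (f : 'rV[K]_p -> K)
    (L : {linear 'rV[K]_m -> 'rV[K]_p}) :
  open S -> continuous L -> holo S f -> holo (L @^-1` S) (f \o L).
Proof.
move=> oS cL hf x Sx.
have dL y : differentiable L y by exact: linear_differentiable.
have dE y v : S (L y) -> 'd (f \o L) y v = 'd f (L y) (L v).
  move=> Sy; rewrite diff_comp//; last exact: (hf _ Sy).1.
  by rewrite /= [X in 'd f (L y) (X v)]diff_lin.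
split=> [|v].
  by apply: differentiable_comp => //; exact: (hf _ Sx).1.
have Sn : \forall y \near x, S (L y).
  by apply: (cL x); exact: open_nbhs_nbhs.
rewrite /prop_for /continuous_at dE//.
apply: (cvg_trans (near_eq_cvg (filterS (fun y => esym \o dE y v) Sn))).
apply: (@continuous_comp _ _ _ L (fun z => 'd f z (L v))); first exact: cL.
exact: (hf _ Sx).2.
Qed.

Lemma subholo m (S T : set 'rV[K]_m) (f : 'rV[K]_m -> K) :
  S `<=` T -> holo T f -> holo S f.
Proof. by move=> ST hf x /ST /hf. Qed.

End Holomorphic.

(* An m-dimensional holomorphic atlas on the set point: the chart i maps dom i
   bijectively onto an open subset of K^m, with inverse par i.  The topology is
   the one induced by the charts; that it is Hausdorff and second countable is
   not part of the structure. *)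
Record cmanifold (K : numFieldType) (m : nat) := CManifold {
  point :> Type;
  chart : Type;
  dom : chart -> set point;
  crd : chart -> point -> 'rV[K]_m;
  par : chart -> 'rV[K]_m -> point;
  dom_cover : forall x, exists i, dom i x;
  crdK : forall i x, dom i x -> par i (crd i x) = x;
  crd_open : forall i j, open (crd i @` (dom i `&` dom j));
  crd_holo : forall i j,
    holo_map (crd i @` (dom i `&` dom j)) (crd j \o par i) }.

Arguments crd_open {K m} c i j.
Arguments crd_holo {K m} c i j k.

Section Manifold.
Context {K : numFieldType} {m : nat} (M : cmanifold K m).
Implicit Types (U V D : set M).

Definition mopen U := forall i, open (crd i @` (U `&` dom i)).

Definition mholo U (f : M -> K) :=
  forall i, holo (crd i @` (U `&` dom i)) (f \o par i).

Lemma mopenI U V : mopen U -> mopen V -> mopen (U `&` V).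
Proof.
move=> oU oV i; rewrite (_ : _ @` _ =
    (crd i @` (U `&` dom i)) `&` (crd i @` (V `&` dom i))).
  exact: openI.
apply/seteqP; split=> [_ [x [[Ux Vx] ix] <-]|w [[x [Ux ix] <-] [y [Vy iy] yx]]].
  by split; exists x.
exists x => //; split=> //; split=> //.
by rewrite -(crdK ix) -yx crdK.
Qed.

(* Line bundles, as cocycles: the sections are the families (s_a)_a with
   s_a = ltr a b * s_b. *)
Record line_bundle := LineBundle {
  triv : Type;
  ldom : triv -> set M;
  ltr : triv -> triv -> M -> K;
  ldom_open : forall a, mopen (ldom a);
  ldom_cover : forall x, exists a, ldom a x;
  ltr_holo : forall a b, mholo (ldom a `&` ldom b) (ltr a b);
  ltr_id : forall a x, ldom a x -> ltr a a x = 1;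
  ltr_comp : forall a b c x, ldom a x -> ldom b x -> ldom c x ->
    ltr a b x * ltr b c x = ltr a c x }.

(* A vector field v is given by its components v i x in the charts i at the
   points x of dom i; the values v i x with x outside dom i are irrelevant. *)
Definition vfield := chart M -> M -> 'rV[K]_m.

(* v is a section over U of the tangent sheaf of M. *)
Definition tangent U (v : vfield) :=
  (forall i, holo_map (crd i @` (U `&` dom i)) (v i \o par i)) /\
  (forall i j x, U x -> dom i x -> dom j x ->
     v j x = 'd (crd j \o par i) (crd i x) (v i x)).

(* z = (z_1, ..., z_m) are local coordinates of M on V, centred at x: z is
   biholomorphic from V onto an open subset of K^m. *)
Definition local_coords (x : M) V (z : M -> 'rV[K]_m) :=
  [/\ mopen V, V x, z x = 0, forall k, mholo V (fun y => z y 0 k) &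
      exists2 p : 'rV[K]_m -> M, forall y, V y -> p (z y) = y &
        forall i, open (z @` (V `&` dom i)) /\
                  holo_map (z @` (V `&` dom i)) (crd i \o p)].

(* v is a section over U of the logarithmic tangent sheaf T_M(-log D), where D is
   a normal crossing divisor.  The component of v y along d/dz_k is the k-th
   entry of the differential of z applied to v y, and D = {z_1 ... z_l = 0} on
   V (so that l > 0 when V meets D).  Which such coordinates z are used at x
   does not matter. *)
Definition log_tangent D U (v : vfield) :=
  tangent U v /\
  forall x, U x -> D x -> exists V z l,
    [/\ local_coords x V z, V `<=` U, (l <= m)%N,
        forall y, V y -> (D y <-> \prod_(k < m | (k < l)%N) z y 0 k = 0) &
        exists2 f : 'I_m -> M -> K, forall k, mholo V (f k) &
          forall i y, V y -> dom i y ->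
            'd (z \o par i) (crd i y) (v i y) =
            \row_k (if (k < l)%N then f k y * z y 0 k else f k y)].

Variable L : line_bundle.

Definition twisted_vfield := triv L -> vfield.

(* s is a section over U of T_M(-log D) \otimes L. *)
Definition twisted_log_tangent D U (s : twisted_vfield) :=
  (forall a, log_tangent D (U `&` ldom a) (s a)) /\
  (forall a b i x, U x -> ldom a x -> ldom b x -> dom i x ->
     s a i x = ltr a b x *: s b i x).

(* Global generation of an O_M-module F of twisted vector fields: F V s means
   that s restricts to a section of F over V.  Every germ of section of F is a
   linear combination of germs of global sections, with coefficients germs of
   holomorphic functions. *)
Definition globally_generated (F : set M -> twisted_vfield -> Prop) :=
  forall x U s, mopen U -> U x -> F U s ->
    exists N (g : 'I_N -> twisted_vfield) (f : 'I_N -> M -> K) V,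
      [/\ mopen V, V x, V `<=` U,
          forall k, F setT (g k) /\ mholo V (f k) &
          forall a i y, V y -> ldom a y -> dom i y ->
            s a i y = \sum_k f k y *: g k a i y].

End Manifold.

Section Product.
Context {K : numFieldType} {m1 m2 : nat}.
Variables (M1 : cmanifold K m1) (M2 : cmanifold K m2).

Let T : Type := (M1 * M2)%type.
Let I : Type := (chart M1 * chart M2)%type.
Let pdom (i : I) : set T := [set x | dom i.1 x.1 /\ dom i.2 x.2].
Let pcrd (i : I) (x : T) : 'rV[K]_(m1 + m2) :=
  row_mx (crd i.1 x.1) (crd i.2 x.2).
Let ppar (i : I) (w : 'rV[K]_(m1 + m2)) : T :=
  (par i.1 (lsubmx w), par i.2 (rsubmx w)).

Let lsub_cont : continuous (@lsubmx K 1 m1 m2).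
Proof. by move=> w; apply/differentiable_continuous/differentiable_lsubmx. Qed.

Let rsub_cont : continuous (@rsubmx K 1 m1 m2).
Proof. by move=> w; apply/differentiable_continuous/differentiable_rsubmx. Qed.

Let pcrd_image (i : I) (A : set M1) (B : set M2) :
  pcrd i @` [set x | A x.1 /\ B x.2] =
  (lsubmx @^-1` (crd i.1 @` A)) `&` (rsubmx @^-1` (crd i.2 @` B)).
Proof.
apply/seteqP; split=> [_ [x [Ax Bx] <-]|w [/= [x Ax xw] [y By yw]]].
  by rewrite /pcrd; split; rewrite /= ?row_mxKl ?row_mxKr;
    [exists x.1|exists x.2].
by exists (x, y) => //; rewrite /pcrd /= xw yw hsubmxK.
Qed.

Let pdom_cover x : exists i, pdom i x.
Proof.
have [[i xi] [j xj]] := (dom_cover x.1, dom_cover x.2).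
by exists (i, j).
Qed.

Let pcrdK i x : pdom i x -> ppar i (pcrd i x) = x.
Proof.
case: x => x y [/= dx dy].
by rewrite /ppar /pcrd row_mxKl row_mxKr !crdK.
Qed.

Let pdomI i j : pdom i `&` pdom j =
  [set x | (dom i.1 `&` dom j.1) x.1 /\ (dom i.2 `&` dom j.2) x.2].
Proof. by apply/seteqP; split=> [x [[? ?] [? ?]]|x [[? ?] [? ?]]]. Qed.

Let pcrd_open i j : open (pcrd i @` (pdom i `&` pdom j)).
Proof.
rewrite pdomI pcrd_image; apply: openI; apply: open_comp => //;
  by [move=> w _; exact: lsub_cont|move=> w _; exact: rsub_cont|exact: crd_open].
Qed.

Let pcrd_holo i j :
  holo_map (pcrd i @` (pdom i `&` pdom j)) (pcrd j \o ppar i).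
Proof.
rewrite pdomI pcrd_image => k.
have -> : (fun w => (pcrd j \o ppar i) w 0 k) = fun w =>
    match fintype.split k with
    | inl a => (crd j.1 \o par i.1) (lsubmx w) 0 a
    | inr b => (crd j.2 \o par i.2) (rsubmx w) 0 b
    end.
  by apply/funext => w; rewrite /= [LHS]mxE.
case: (fintype.split k) => a.
- apply: (@subholo _ _ _ (lsubmx @^-1` (crd i.1 @` (dom i.1 `&` dom j.1)))).
    by move=> w [].
  have h := crd_holo M1 i.1 j.1 a.
  exact: (holo_lin (crd_open _ i.1 j.1) lsub_cont h).
- apply: (@subholo _ _ _ (rsubmx @^-1` (crd i.2 @` (dom i.2 `&` dom j.2)))).
    by move=> w [].
  have h := crd_holo M2 i.2 j.2 a.
  exact: (holo_lin (crd_open _ i.2 j.2) rsub_cont h).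
Qed.

Definition prod_cmanifold : cmanifold K (m1 + m2) :=
  CManifold pdom_cover pcrdK pcrd_open pcrd_holo.

Let fst_image (i : I) (U : set M1) :
  pcrd i @` ([set x | U x.1] `&` pdom i) =
  (lsubmx @^-1` (crd i.1 @` (U `&` dom i.1))) `&`
  (rsubmx @^-1` (crd i.2 @` (dom i.2 `&` dom i.2))).
Proof.
rewrite -pcrd_image; congr (_ @` _).
by apply/seteqP; split=> [x [? [? ?]]|x [[? ?] [? ?]]].
Qed.

Lemma mopen_fst (U : set M1) :
  mopen U -> mopen ([set x | U x.1] : set prod_cmanifold).
Proof.
move=> oU i; rewrite fst_image; apply: openI; apply: open_comp => //;
  by [move=> w _; exact: lsub_cont|move=> w _; exact: rsub_cont|exact: crd_open].
Qed.

Lemma mholo_fst (U : set M1) (f : M1 -> K) : mopen U -> mholo U f ->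
  mholo ([set x | U x.1] : set prod_cmanifold) (f \o fst).
Proof.
move=> oU hf i; rewrite fst_image.
apply: (@subholo _ _ _ (lsubmx @^-1` (crd i.1 @` (U `&` dom i.1)))).
  by move=> w [].
exact: (holo_lin (oU _) lsub_cont (hf i.1)).
Qed.

Variable L : line_bundle M1.

Let fldom (a : triv L) : set prod_cmanifold := [set x | ldom a x.1].

Let fldom_open a : mopen (fldom a).
Proof. exact/mopen_fst/ldom_open. Qed.

Let fldom_cover x : exists a, fldom a x.
Proof. exact: ldom_cover. Qed.

Let fltr_holo a b :
  mholo (fldom a `&` fldom b) ((ltr a b \o fst) : prod_cmanifold -> K).
Proof.
apply: (@mholo_fst (ldom a `&` ldom b)); last exact: ltr_holo.
by apply: mopenI; exact: ldom_open.
Qed.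

(* The pullback of L under the first projection. *)
Definition pullback_fst : line_bundle prod_cmanifold :=
  @LineBundle _ _ _ (triv L) fldom (fun a b => ltr a b \o fst) fldom_open
    fldom_cover fltr_holo
    (fun a x => @ltr_id _ _ _ L a x.1)
    (fun a b c x => @ltr_comp _ _ _ L a b c x.1).

End Product.

Section ProjectiveSpace.
Context (K : numFieldType) (m : nat).

(* P^(m-1), as the set of lines of K^m. *)
Definition pspace := {l : {vspace 'rV[K]_m} | \dim l == 1%N}.

(* Homogeneous coordinates of l: some nonzero vector of l. *)
Definition homog (l : pspace) : 'rV[K]_m := vpick (val l).

Definition affine (i : 'I_m) (w : 'rV[K]_m.-1) : 'rV[K]_m :=
  \row_k (if unlift i k is Some k' then w 0 k' else 1).

Lemma affine_dim i w : \dim <[affine i w]>%VS == 1%N.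
Proof.
rewrite dim_vline; apply/eqP; case: eqP => // /rowP/(_ i)/eqP.
by rewrite !mxE unlift_none oner_eq0.
Qed.

Definition pspace_par i w : pspace := Sub <[affine i w]>%VS (affine_dim i w).

Definition pspace_dom i : set pspace := [set l | homog l 0 i != 0].

Definition pspace_crd i (l : pspace) : 'rV[K]_m.-1 :=
  \row_k (homog l 0 (lift i k) / homog l 0 i).

Lemma homog_neq0 l : homog l != 0.
Proof. by rewrite /homog vpick0 -dimv_eq0 (eqP (valP l)). Qed.

Lemma homog_par i w : exists2 c, c != 0 &
  homog (pspace_par i w) = c *: affine i w.
Proof.
have := memv_pick (val (pspace_par i w)).
rewrite SubK => /vlineP[c e]; exists c; last by rewrite /homog SubK.
apply: contraNneq (homog_neq0 (pspace_par i w)) => c0.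
by rewrite /homog SubK e c0 scale0r.
Qed.

Lemma homog_parE i w j k :
  homog (pspace_par i w) 0 j / homog (pspace_par i w) 0 k =
  affine i w 0 j / affine i w 0 k.
Proof.
have [c c0 ->] := homog_par i w.
by rewrite ![(_ *: affine i w) _ _]mxE -mulf_div divff// mul1r.
Qed.

Lemma pspace_dom_cover l : exists i, pspace_dom i l.
Proof.
by have /rV0Pn [i li] := homog_neq0 l; exists i.
Qed.

Lemma pspace_crdK i l : pspace_dom i l -> pspace_par i (pspace_crd i l) = l.
Proof.
move=> li; apply/val_inj/eqP; rewrite SubK eqEdim (eqP (valP l)).
rewrite (eqP (affine_dim _ _)) leqnn andbT -memvE.
have -> : affine i (pspace_crd i l) = (homog l 0 i)^-1 *: homog l.
  apply/rowP => k; rewrite !mxE; case: unliftP => [j ->|->].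
    by rewrite mxE mulrC.
  by rewrite mulVf.
exact/memvZ/memv_pick.
Qed.

Lemma pspace_parK i w : pspace_crd i (pspace_par i w) = w.
Proof.
apply/rowP => k; rewrite mxE homog_parE !mxE liftK unlift_none.
by rewrite divr1.
Qed.

Lemma pspace_crd_image i j :
  pspace_crd i @` (pspace_dom i `&` pspace_dom j) =
  [set w | affine i w 0 j != 0].
Proof.
apply/seteqP; split=> [_ [l [li lj] <-]|w /= wj].
  have [c c0] := homog_par i (pspace_crd i l).
  rewrite pspace_crdK// => e; move: lj; rewrite /pspace_dom /= e mxE.
  by rewrite mulf_eq0 negb_or c0.
exists (pspace_par i w); last exact: pspace_parK.
have [c c0 e] := homog_par i w.
split; rewrite /pspace_dom /= e !mxE mulf_neq0//.
  by rewrite unlift_none oner_neq0.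
by move: wj; rewrite mxE.
Qed.

Lemma holo_affine (S : set 'rV[K]_m.-1) i j : holo S (fun w => affine i w 0 j).
Proof.
case: (unliftP i j) => [k ->|->].
  under eq_fun do rewrite mxE liftK.
  exact: holo_coord.
under eq_fun do rewrite mxE unlift_none.
exact: holo_cst.
Qed.

Lemma pspace_crd_open i j :
  open (pspace_crd i @` (pspace_dom i `&` pspace_dom j)).
Proof.
rewrite pspace_crd_image.
apply: (@open_comp _ _ (fun w => affine i w 0 j) [set x | x != 0]).
  move=> w _; apply: differentiable_continuous.
  exact: (@holo_affine setT i j w I).1.
rewrite (_ : [set x | _] = ~` [set (0 : K)]).
  exact/closed_openC/accessible_closed_set1/hausdorff_accessible/norm_hausdorff.
by apply/seteqP; split=> x /= /eqP.
Qed.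

Lemma holo_affine_div (S : set 'rV[K]_m.-1) i j k :
  S `<=` [set w | affine i w 0 k != 0] ->
  holo S (fun w => affine i w 0 j / affine i w 0 k).
Proof.
move=> Sk; apply: (subholo Sk); apply: holo_div => //.
- by rewrite -pspace_crd_image; exact: pspace_crd_open.
- exact: holo_affine.
- exact: holo_affine.
Qed.

Lemma pspace_crd_holo i j :
  holo_map (pspace_crd i @` (pspace_dom i `&` pspace_dom j))
           (pspace_crd j \o pspace_par i).
Proof.
move=> k; under eq_fun do rewrite /= mxE homog_parE.
by apply: holo_affine_div; rewrite pspace_crd_image.
Qed.

Definition Pspace : cmanifold K m.-1 :=
  CManifold pspace_dom_cover pspace_crdK pspace_crd_open pspace_crd_holo.

Lemma pspace_dom_open i : mopen (pspace_dom i : set Pspace).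
Proof. by move=> j; rewrite setIC; exact: pspace_crd_open. Qed.

Lemma O1_holo i j :
  @mholo _ _ Pspace (pspace_dom i `&` pspace_dom j)
    (fun l => homog l 0 j / homog l 0 i).
Proof.
move=> k; rewrite /comp; under eq_fun do rewrite homog_parE.
apply: holo_affine_div; rewrite -pspace_crd_image.
by move=> _ [l [[li lj] lk] <-]; exists l.
Qed.

Lemma O1_id i (l : Pspace) : pspace_dom i l -> homog l 0 i / homog l 0 i = 1.
Proof. exact: divff. Qed.

Lemma O1_comp i j k (l : Pspace) :
  pspace_dom i l -> pspace_dom j l -> pspace_dom k l ->
  (homog l 0 j / homog l 0 i) * (homog l 0 k / homog l 0 j) =
  homog l 0 k / homog l 0 i.
Proof. by move=> li lj lk; rewrite mulrC -mulrA mulKf. Qed.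

(* O(1), trivialized over Z_i != 0 by its section Z_i. *)
Definition O1 : line_bundle Pspace :=
  LineBundle pspace_dom_open pspace_dom_cover O1_holo O1_id O1_comp.

End ProjectiveSpace.

Arguments homog {K m} l.
Arguments affine {K m} i w.
Arguments pullback_fst {K m1 m2 M1} M2 L.

(* The exponents of the monomials of degree d in Z_0, ..., Z_n. *)
Definition monom n d :=
  {a : {ffun 'I_n.+1 -> 'I_d.+1} | (\sum_j a j)%N == d}.

Section UniversalHypersurface.
Context (K : numFieldType) (n d : nat).

(* P^n * P^(N_d), where N_d + 1 = #|monom n d|. *)
Definition PnPNd := prod_cmanifold (Pspace K n.+1) (Pspace K #|{: monom n d}|).

Definition universal_hypersurface : set PnPNd :=
  [set x | \sum_(a : monom n d) homog x.2 0 (enum_rank a) *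
             \prod_j homog x.1 0 j ^+ val a j = 0].

(* T_(P^n * P^(N_d))(-log X)(1,0). *)
Definition twisted_log_tangent_bundle :
    set PnPNd -> twisted_vfield (pullback_fst _ (O1 K n.+1)) -> Prop :=
  twisted_log_tangent universal_hypersurface.

End UniversalHypersurface.

Arguments PnPNd K n d : clear implicits.
Arguments universal_hypersurface K n d _ : clear implicits.
Arguments twisted_log_tangent_bundle K n d U s : clear implicits, rename.

(* Main.v *)
From HB Require Import structures.
Require Import Defs.
From mathcomp Require Import all_boot all_order all_algebra.
From mathcomp Require Import all_classical all_reals all_analysis.
From mathcomp Require Import complex.
From mathcomp Require Import perm ring zify.

Import Order.TTheory GRing.Theory Num.Theory.
Import numFieldNormedType.Exports.
Local Open Scope ring_scope.
Local Open Scope complex_scope.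
Local Open Scope classical_set_scope.

Set Implicit Arguments.
Unset Strict Implicit.
Unset Printing Implicit Defensive.

(** Let F = sum_al A_al Z^al be the universal equation, as a function on the
    product of the two cones, E = K^(n+1) x K^(N+1), and let X be the
    hypersurface. The proof compares sections of the logarithmic tangent sheaf
    with vector fields V on E that annihilate F and have polynomial entries. If
    V (s Z, t A) = s (s V_Z, t V_A), then V descends to a global section of the
    bundle twisted by O(1, 0) ([cone_field], [descend]); without the first
    factor s it would descend to a section of the bundle itself.

    From the cone to the sections ([descend_section]). A descended field
    multiplies each affine equation of X by a holomorphic function
    ([diff_Fc]). Near a point of X, some Z_i does not vanish, nor, because of
    the equation, some coefficient other than that of Z_i ^ d; so in a suitable
    chart the equation is the sum of the coefficient of Z_i ^ d and of terms
    that do not involve it ([universal_good_charts]). The equation may thus be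
    taken as a local coordinate, in which the field is visibly logarithmic
    ([log_coordinates]).

    From the sections to the cone. Let v be a logarithmic field near x and f the
    affine equation. The derivative v(f) vanishes on X: in the coordinates
    adapted to v, a coordinate function that vanishes at the point is constant
    along v ([log_field_kills_equation]). Since f may be taken as a coordinate,
    v(f) = h f with h holomorphic ([log_division]). This rests on the division
    of a holomorphic function g that vanishes on a coordinate hyperplane
    ([holo_division]). Holomorphic meaning continuously differentiable over K,
    the quotient is written as Cauchy's integral of g(z) / z over a circle, which
    depends holomorphically on the parameters, by differentiation under the
    integral sign ([cint_holo]). Cauchy's formula itself is obtained by
    shrinking the circle to the point ([cauchy_difference]).

    Now lift v to E in the direction of the affine coordinates and subtract h
    times the radial field of the coefficients. By Euler's relation
    ([diff_vertical]) the result B annihilates F exactly, and it still projects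
    to v ([dehomD_lift]). It remains to write B as a combination of polynomial
    fields of the right weight ([equation_spanned]). The fields
    Z_i (Z_i d/dZ_j - sum al_j A_al d/dA_(al - e_j + e_i)) ([derivation]) remove
    its components along the Z_j. What is left is a linear relation between the
    values of the monomials, and those are generated by the relations
    Z_i Z^al = Z_j Z^(al - e_j + e_i) ([exchange], [relation_spanned]): each of
    them involves the variables with degree 1, which is why one twist by O(1) is
    enough. The combination descends to the section one started from
    ([log_tangent_globally_generated]). *)

(** * Complex-valued integrals over the unit interval *)

(** What integration requires of the complex numbers. The norm of K takes its
    values in K, while the Lebesgue integral lives over R: the embedding of R
    and the two parts are the only passage between them, and the laws keep the
    construction of K out of the computations. *)
Record complex_field (R : realType) (K : numFieldType) := ComplexField {
  of_real : {rmorphism R -> K};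
  re_part : K -> R;
  im_part : K -> R;
  imag : K;
  rectE : forall z, z = of_real (re_part z) + imag * of_real (im_part z);
  re_rect : forall a b, re_part (of_real a + imag * of_real b) = a;
  im_rect : forall a b, im_part (of_real a + imag * of_real b) = b;
  imag2 : imag * imag = -1;
  norm_rect : forall a b,
    `|of_real a + imag * of_real b| ^+ 2 = of_real (a ^+ 2 + b ^+ 2);
  ler_of_real : forall a b, (of_real a <= of_real b) = (a <= b);
  pos_of_real : forall e : K, 0 < e -> exists2 r, 0 < r & e = of_real r }.

Lemma near_dist_le (K : numFieldType) (V : normedModType K) (x : V) (e : K) :
  0 < e -> \forall t \near x, `|x - t| <= e.
Proof. by move=> e0; have /cvgrPdist_le := @cvg_id _ (nbhs x); apply. Qed.

Section ComplexIntegral.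
Context {R : realType} {K : numFieldType} (X : complex_field R K).
Implicit Types (F G : R -> K) (f g : R -> R).

Local Notation rc := (of_real X).
Local Notation re := (re_part X).
Local Notation im := (im_part X).
Local Notation iu := (imag X).

Lemma ltr_of_real a b : (rc a < rc b) = (a < b).
Proof. by rewrite !lt_def ler_of_real (inj_eq (fmorph_inj _)). Qed.

Lemma norm_of_real a : `|rc a| = rc `|a|.
Proof.
apply/eqP; rewrite -(@eqrXn2 _ 2)//; last by rewrite -(rmorph0 rc) ler_of_real.
rewrite -[rc a](_ : rc a + iu * rc 0 = _) ?norm_rect.
  by rewrite expr0n addr0 -rmorphXn /= real_normK// num_real.
by rewrite rmorph0 mulr0 addr0.
Qed.

Lemma reD z w : re (z + w) = re z + re w.
Proof.
rewrite {1}(rectE X z) {1}(rectE X w) addrACA -mulrDr -!rmorphD.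
exact: re_rect.
Qed.

Lemma imD z w : im (z + w) = im z + im w.
Proof.
rewrite {1}(rectE X z) {1}(rectE X w) addrACA -mulrDr -!rmorphD.
exact: im_rect.
Qed.

Let mulE z w : z * w = rc (re z * re w - im z * im w) +
  iu * rc (re z * im w + im z * re w).
Proof.
rewrite {1}(rectE X z) {1}(rectE X w) !(rmorphD, rmorphN, rmorphM)/=.
by have := imag2 X; move: (rc (re z)) (rc (im z)) (rc (re w)) (rc (im w)) iu;
  move=> a b c d i i2; ring: i2.
Qed.

Lemma reM z w : re (z * w) = re z * re w - im z * im w.
Proof. by rewrite mulE re_rect. Qed.

Lemma imM z w : im (z * w) = re z * im w + im z * re w.
Proof. by rewrite mulE im_rect. Qed.

Lemma re_of_real a : re (rc a) = a.
Proof. by rewrite -[rc a]addr0 -(mulr0 iu) -(rmorph0 rc) re_rect. Qed.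

Lemma im_of_real a : im (rc a) = 0.
Proof. by rewrite -[rc a]addr0 -(mulr0 iu) -(rmorph0 rc) im_rect. Qed.

Lemma reB z w : re (z - w) = re z - re w.
Proof. by apply: (addIr (re w)); rewrite -reD !subrK. Qed.

Lemma imB z w : im (z - w) = im z - im w.
Proof. by apply: (addIr (im w)); rewrite -imD !subrK. Qed.

Lemma of_real_re z : 0 <= z -> z = rc (re z).
Proof.
rewrite le_eqVlt => /predU1P[<-|/(pos_of_real X)[r _ ->]].
  by rewrite -[X in re X](rmorph0 rc) re_of_real rmorph0.
by rewrite re_of_real.
Qed.

Let norm2E z : `|z| ^+ 2 = rc (re z ^+ 2 + im z ^+ 2).
Proof. by rewrite {1}(rectE X z) norm_rect. Qed.

Lemma re_le z : rc `|re z| <= `|z|.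
Proof.
rewrite -ler_sqr ?nnegrE//; last by rewrite -(rmorph0 rc) ler_of_real.
by rewrite norm2E -rmorphXn ler_of_real /= real_normK ?num_real// lerDl sqr_ge0.
Qed.

Lemma im_le z : rc `|im z| <= `|z|.
Proof.
rewrite -ler_sqr ?nnegrE//; last by rewrite -(rmorph0 rc) ler_of_real.
by rewrite norm2E -rmorphXn ler_of_real /= real_normK ?num_real// lerDr sqr_ge0.
Qed.

Lemma norm_imag : `|iu| = 1.
Proof.
apply/eqP; rewrite -(@eqrXn2 _ 2)// norm2E.
have -> : iu = rc 0 + iu * rc 1 by rewrite rmorph0 rmorph1 add0r mulr1.
by rewrite re_rect im_rect expr0n add0r !expr1n rmorph1.
Qed.

Lemma re_continuous : continuous re.
Proof.
move=> z; apply/(@cvgrPdist_le _ _ _ (nbhs z) (nbhs_filter z)) => e e0.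
have : \forall w \near z, `|z - w| <= rc e.
  by apply: near_dist_le; rewrite -(rmorph0 rc) ltr_of_real.
apply: filterS => w; rewrite -reB => h.
by rewrite -(ler_of_real X) (le_trans (re_le _)).
Qed.

Lemma im_continuous : continuous im.
Proof.
move=> z; apply/(@cvgrPdist_le _ _ _ (nbhs z) (nbhs_filter z)) => e e0.
have : \forall w \near z, `|z - w| <= rc e.
  by apply: near_dist_le; rewrite -(rmorph0 rc) ltr_of_real.
apply: filterS => w; rewrite -imB => h.
by rewrite -(ler_of_real X) (le_trans (im_le _)).
Qed.

(** Two-sided continuity, even at the ends of the interval: the curves of
    interest are defined for all real times, and no relative topology is then
    needed. *)
Definition cont01 (T : topologicalType) (F : R -> T) :=
  forall t : R, 0 <= t <= 1 -> {for t, continuous F}.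

Definition rint f := \int[lebesgue_measure]_(t in `[0, 1]) f t.

Lemma cont01_within f : cont01 f -> {within `[0, 1], continuous f}.
Proof.
move=> cf; apply: continuous_in_subspaceT => t.
by rewrite inE /= in_itv /= => /cf.
Qed.

Lemma cont01_integrable f : cont01 f ->
  lebesgue_measure.-integrable `[0, 1] (EFin \o f).
Proof.
move=> cf; apply: continuous_compact_integrable.
  exact: segment_compact.
exact: cont01_within.
Qed.

Lemma rintD f g : cont01 f -> cont01 g ->
  rint (fun t => f t + g t) = rint f + rint g.
Proof. by move=> cf cg; apply: RintegralD => //; exact: cont01_integrable. Qed.

Lemma rintZ r f : cont01 f -> rint (fun t => r * f t) = r * rint f.
Proof. by move=> cf; apply: RintegralZl => //; exact: cont01_integrable. Qed.

Lemma rint_le f (M : R) : cont01 f -> (forall t : R, 0 <= t <= 1 -> `|f t| <= M) ->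
  `|rint f| <= M.
Proof.
move=> cf fM.
apply: le_trans (le_normr_Rintegral _ (cont01_integrable cf)) _ => //.
have cn : cont01 (fun t => `|f t|).
  move=> t /cf ct; apply: (@continuous_comp _ _ _ f) => //.
  exact: norm_continuous.
apply: (@le_trans _ _ (\int[lebesgue_measure]_(t in `[0, 1]) M)).
  apply: le_Rintegral => //.
  - exact: cont01_integrable.
  - by apply: (@cont01_integrable (cst M)) => t _; exact: cst_continuous.
have -> : \int[lebesgue_measure]_(t in `[0, 1]) M =
    M * fine (lebesgue_measure (`[0, 1]%classic : set R)).
  by apply: Rintegral_cst; exact: measurable_itv.
rewrite lebesgue_measure_itv /= lte_fin ltr01.
by rewrite oppr0 adde0 mulr1.
Qed.

Lemma rint_FTC (F f : R -> R) : cont01 f ->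
  (forall t : R, 0 <= t <= 1 -> is_derive t 1 F (f t)) ->
  rint f = F 1 - F 0.
Proof.
move=> cf dF.
have cF (t : R) : 0 <= t <= 1 -> {for t, continuous F}.
  by move=> /dF [dF' _]; apply/differentiable_continuous/derivable1_diffP.
rewrite /rint /Rintegral (@continuous_FTC2 _ f F 0 1) //.
- exact: cont01_within.
- split.
  + move=> t; rewrite in_itv /= => /andP[t0 t1].
    by have [] := dF t; rewrite ?(ltW t0) ?(ltW t1).
  + by apply: cvg_at_right_filter; apply: cF; rewrite lexx ler01.
  + by apply: cvg_at_left_filter; apply: cF; rewrite lexx ler01.
- move=> t; rewrite in_itv /= => /andP[t0 t1].
  rewrite derive1E; apply: (@derive_val _ _ _ _ _ _ _ (dF _ _)).
  by rewrite (ltW t0) (ltW t1).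
Qed.

Definition cint F : K :=
  rc (rint (fun t => re (F t))) + iu * rc (rint (fun t => im (F t))).

Lemma cont01_re F : cont01 F -> cont01 (fun t => re (F t)).
Proof.
move=> cF t /cF ct; apply: (@continuous_comp _ _ _ F) => //.
exact: re_continuous.
Qed.

Lemma cont01_im F : cont01 F -> cont01 (fun t => im (F t)).
Proof.
move=> cF t /cF ct; apply: (@continuous_comp _ _ _ F) => //.
exact: im_continuous.
Qed.

Lemma cont01M F G : cont01 F -> cont01 G -> cont01 (fun t => F t * G t).
Proof. by move=> cF cG t h; apply: cvgM; [exact: cF|exact: cG]. Qed.

Lemma cont01D F G : cont01 F -> cont01 G -> cont01 (fun t => F t + G t).
Proof. by move=> cF cG t h; apply: cvgD; [exact: cF|exact: cG]. Qed.

Lemma cont01B F G : cont01 F -> cont01 G -> cont01 (fun t => F t - G t).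
Proof. by move=> cF cG t h; apply: cvgB; [exact: cF|exact: cG]. Qed.

Lemma cont01_cst (T : topologicalType) (c : T) : cont01 (fun=> c).
Proof. by move=> t h; exact: cst_continuous. Qed.

Lemma rint_ext f g : (forall t : R, 0 <= t <= 1 -> f t = g t) ->
  rint f = rint g.
Proof.
move=> fg; apply: eq_Rintegral => t; rewrite inE /= in_itv /=; exact: fg.
Qed.

Lemma cint_ext F G : (forall t : R, 0 <= t <= 1 -> F t = G t) ->
  cint F = cint G.
Proof.
by move=> FG; rewrite /cint; congr (rc _ + iu * rc _);
  apply: rint_ext => t /FG ->.
Qed.

Lemma cintD F G : cont01 F -> cont01 G ->
  cint (fun t => F t + G t) = cint F + cint G.
Proof.
move=> cF cG; have [cF1 cF2] := (cont01_re cF, cont01_im cF).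
have [cG1 cG2] := (cont01_re cG, cont01_im cG).
rewrite /cint addrACA -mulrDr -!rmorphD -!rintD//.
by congr (rc _ + iu * rc _); apply: rint_ext => t _; rewrite (reD, imD).
Qed.

Lemma cintZ c F : cont01 F -> cint (fun t => c * F t) = c * cint F.
Proof.
move=> cF; have [cF1 cF2] := (cont01_re cF, cont01_im cF).
rewrite [RHS]mulE /cint re_rect im_rect.
have cZ (r : R) (g : R -> R) : cont01 g -> cont01 (fun t => r * g t).
  by move=> cg t h; apply: cvgM; [exact: cvg_cst|exact: cg].
congr (rc _ + iu * rc _).
- rewrite -mulNr -(rintZ (re c))// -(rintZ (- im c))//.
  rewrite -rintD; [|exact: cZ..].
  by apply: rint_ext => t _; rewrite reM mulNr.
- rewrite -(rintZ (re c))// -(rintZ (im c))// -rintD; [|exact: cZ..].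
  by apply: rint_ext => t _; rewrite imM.
Qed.

Lemma cintB F G : cont01 F -> cont01 G ->
  cint (fun t => F t - G t) = cint F - cint G.
Proof.
move=> cF cG; rewrite -mulN1r -cintZ// -cintD//.
  by apply: cint_ext => t _; rewrite mulN1r.
by apply: cont01M => //; exact: cont01_cst.
Qed.

(** The real and the imaginary part are bounded separately, whence the factor
    2, which is harmless since the bound only serves to
    show that some integrals are small. *)
Lemma cint_le F (M : K) : cont01 F ->
  (forall t : R, 0 <= t <= 1 -> `|F t| <= M) -> `|cint F| <= 2 * M.
Proof.
move=> cF FM.
have M0 : 0 <= M.
  by apply: le_trans (FM 0 _) => //; rewrite lexx ler01.
rewrite (le_trans (ler_normD _ _))// normrM norm_imag mul1r !norm_of_real.
rewrite mulr_natl mulr2n (of_real_re M0) lerD// ler_of_real.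
- apply: rint_le; first exact: cont01_re.
  move=> t /FM h; rewrite -(ler_of_real X) -of_real_re//.
  exact: le_trans (re_le _) h.
- apply: rint_le; first exact: cont01_im.
  move=> t /FM h; rewrite -(ler_of_real X) -of_real_re//.
  exact: le_trans (im_le _) h.
Qed.

(** Differentiability of a curve c, with values in a space over K, at the
    points of the unit interval: the parameter is real, while the spaces at
    hand are normed over K only. *)
Definition has_velocity (V : normedModType K) (c c' : R -> V) :=
  forall t : R, 0 <= t <= 1 -> forall e : K, 0 < e -> \forall s \near t,
    `|c s - c t - rc (s - t) *: c' t| <= e * rc `|s - t|.

Lemma is_derive_eps (f : R -> R) (t d : R) :
  (forall e : R, 0 < e -> \forall s \near t,
    `|f s - f t - (s - t) * d| <= e * `|s - t|) -> is_derive t 1 f d.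
Proof.
move=> h.
have L : h0^-1 *: (f (h0 *: 1 + t) - f t) @[h0 --> 0^'] --> d.
  apply/cvgrPdist_le => e e0.
  have /nbhs_ballP[r r0 hr] := h e e0; near=> k.
  have k0 : k != 0 by near: k; exact: nbhs_dnbhs_neq.
  have : `|f (k + t) - f t - (k + t - t) * d| <= e * `|k + t - t|.
    apply: hr; rewrite /ball /= opprD addrCA subrr addr0 normrN.
    by near: k; exact: dnbhs0_lt.
  rewrite addrK => hk; rewrite distrC.
  rewrite (_ : _ - d = k^-1 * (f (k + t) - f t - k * d)).
    by rewrite normrM normfV mulrC ler_pdivrMr ?normr_gt0.
  by rewrite /GRing.scale /= mulr1 [RHS]mulrBr mulKf.
apply: DeriveDef; first by apply/cvg_ex; exists d.
exact: cvg_lim.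
Unshelve. all: by end_near. Qed.

Lemma cint_FTC F (f : R -> K) : cont01 f -> @has_velocity K^o F f ->
  cint f = F 1 - F 0.
Proof.
move=> cf vF; rewrite [RHS](rectE X) reB imB /cint.
congr (rc _ + iu * rc _).
- apply: (@rint_FTC (fun t => re (F t))); first exact: cont01_re.
  move=> t t01; apply: is_derive_eps => e e0.
  have /(vF t t01) : 0 < rc e by rewrite -(rmorph0 rc) ltr_of_real.
  apply: filterS => s; rewrite -rmorphM => h.
  rewrite -(ler_of_real X) (le_trans _ h)// (le_trans _ (re_le _))//.
  by rewrite !reB /GRing.scale /= reM re_of_real im_of_real mul0r subr0.
- apply: (@rint_FTC (fun t => im (F t))); first exact: cont01_im.
  move=> t t01; apply: is_derive_eps => e e0.
  have /(vF t t01) : 0 < rc e by rewrite -(rmorph0 rc) ltr_of_real.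
  apply: filterS => s; rewrite -rmorphM => h.
  rewrite -(ler_of_real X) (le_trans _ h)// (le_trans _ (im_le _))//.
  by rewrite !imB /GRing.scale /= imM re_of_real im_of_real mul0r addr0.
Qed.

End ComplexIntegral.

(** * Calculus of holomorphic functions of several variables *)

Section Differentials.
Context {K : numFieldType}.

Lemma diff_eps (V W : normedModType K) (f : V -> W) (x : V) :
  differentiable f x -> forall e : K, 0 < e -> \forall y \near x,
    `|f y - f x - 'd f x (y - x)| <= e * `|y - x|.
Proof.
move=> /diff_locally /eqaddoP h e e0.
rewrite (near_shift 0) subr0; move: (h _ e0); apply: filterS => k /=.
by rewrite opprD addrA addrK.
Qed.

Lemma diff_of_eps (V W : normedModType K) (f : V -> W) (x : V)
    (L : {linear V -> W}) :
  continuous L -> (forall e : K, 0 < e -> \forall y \near x,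
    `|f y - f x - L (y - x)| <= e * `|y - x|) ->
  differentiable f x /\ 'd f x = L :> (V -> W).
Proof.
move=> cL h.
have H : f \o shift x = cst (f x) + L +o_ 0 id.
  apply/eqaddoP => e e0; move: (h _ e0); rewrite (near_shift 0) subr0.
  by apply: filterS => k /=; rewrite opprD addrA addrK.
have dE := diff_unique cL H.
by split=> //; apply/diff_locallyP; rewrite dE.
Qed.

Lemma near_eq_diff (V W : normedModType K) (f g : V -> W) (x : V) :
  (\forall y \near x, f y = g y) -> differentiable f x ->
  differentiable g x /\ 'd g x = 'd f x :> (V -> W).
Proof.
move=> fg df; apply: diff_of_eps => [|e e0]; first exact: diff_continuous.
have gx := nbhs_singleton fg.
apply: filterS2 fg (diff_eps df e0) => y fy.
by rewrite -gx -fy.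
Qed.

Lemma rv_norm_le m (v : 'rV[K]_m) (M : K) : 0 <= M ->
  (forall k, `|v 0 k| <= M) -> `|v| <= M.
Proof.
move=> M0 vM; have [->//|v0] := eqVneq `|v| 0.
have [[i k] /= vE] := mx_norm_neq0 v0.
by rewrite [leLHS]vE ord1.
Qed.

Lemma coord_norm_le m (v : 'rV[K]_m) k : `|v 0 k| <= `|v|.
Proof.
rewrite [leRHS]/Num.norm /= mx_normE -[leLHS]nngE num_le.
exact: (le_bigmax _ (fun ij : 'I_1 * 'I_m => `|v ij.1 ij.2|%:nng) (0, k)).
Qed.

Lemma continuous_at_sum (T : topologicalType) (x : T) (I : Type)
    (r : seq I) (P : pred I) (f : I -> T -> K) :
  (forall i, {for x, continuous (f i)}) ->
  {for x, continuous (fun y => \sum_(i <- r | P i) f i y)}.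
Proof.
by move=> h; apply: cvg_big => [|i _]; [exact: add_continuous|exact: h].
Qed.

Definition evec m (k : 'I_m) : 'rV[K]_m := delta_mx 0 k.

Lemma diff_sum_coord m (f : 'rV[K]_m -> K) (x v : 'rV[K]_m) :
  'd f x v = \sum_k v 0 k * 'd f x (evec k).
Proof.
rewrite {1}(row_sum_delta v) linear_sum; apply: eq_bigr => k _.
by rewrite linearZ.
Qed.

Lemma differentiable_row m p (f : 'rV[K]_m -> 'rV[K]_p) (x : 'rV[K]_m) :
  (forall k, differentiable (fun y => f y 0 k) x) ->
  differentiable f x /\
  forall v, 'd f x v = \row_k 'd (fun y => f y 0 k) x v.
Proof.
move=> df.
pose L0 := fun v => \row_k 'd (fun y => f y 0 k) x v : 'rV[K]_p.
have lin : linear L0.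
  by move=> a u w; apply/rowP => k; rewrite !mxE linearP.
pose L : {linear 'rV[K]_m -> 'rV[K]_p} :=
  HB.pack L0 (GRing.isLinear.Build _ _ _ _ _ lin).
have cL : continuous L.
  have -> : (L : 'rV[K]_m -> 'rV[K]_p) =
      \sum_k (fun v => 'd (fun y => f y 0 k) x v *: evec k).
    apply/funext => v; rewrite fct_sumE [LHS]row_sum_delta.
    by apply: eq_bigr => k _; rewrite mxE.
  move=> v; apply: differentiable_continuous.
  apply: differentiable_sum => k; apply: differentiableZl.
  by apply: linear_differentiable => w; exact: diff_continuous.
have [dF dE] : differentiable f x /\ 'd f x = L :> (_ -> _).
  apply: diff_of_eps => // e e0.
  have : \forall y \near x, forall k,
      `|f y 0 k - f x 0 k - 'd (fun y => f y 0 k) x (y - x)| <= e * `|y - x|.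
    by apply: (@filter_forall _ _ _ (nbhs x)) => k; exact: (diff_eps (df k)).
  apply: filterS => y h; apply: rv_norm_le; first by rewrite mulr_ge0// ltW.
  by move=> k; rewrite !mxE; exact: h.
by split=> // v; rewrite dE.
Qed.

End Differentials.

Lemma near_eq_continuous_at (T U : topologicalType) (f g : T -> U) (x : T) :
  (\forall y \near x, f y = g y) -> {for x, continuous f} ->
  {for x, continuous g}.
Proof.
move=> fg cf; rewrite /prop_for /continuous_at -(nbhs_singleton fg).
exact: cvg_trans (near_eq_cvg fg) cf.
Qed.

Section HoloCalculus.
Context {K : numFieldType}.

(** Holomorphy asks for the continuity of the differential itself; it is enough
    to know it for a formula that agrees with the differential on an open set,
    which is how each operation below is treated. *)
Lemma holo_of_diff m (S : set 'rV[K]_m) (f : 'rV[K]_m -> K)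
    (df : 'rV[K]_m -> 'rV[K]_m -> K) : open S ->
  (forall x, S x -> differentiable f x) ->
  (forall x v, S x -> 'd f x v = df x v) ->
  (forall x v, S x -> {for x, continuous (fun y => df y v)}) -> holo S f.
Proof.
move=> oS dF dE cdf x Sx; split=> [|v]; first exact: dF.
apply: (near_eq_continuous_at _ (cdf x v Sx)).
by apply: filterS (open_nbhs_nbhs (conj oS Sx)) => y Sy; rewrite dE.
Qed.

Lemma holo_continuous m (S : set 'rV[K]_m) f x : holo S f -> S x ->
  {for x, continuous f}.
Proof. by move=> hf Sx; apply: differentiable_continuous; exact: (hf x Sx).1. Qed.

Lemma holo_diff_continuous m (S : set 'rV[K]_m) f x v : holo S f -> S x ->
  {for x, continuous (fun y => 'd f y v)}.
Proof. by move=> hf Sx; exact: ((hf x Sx).2 v). Qed.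

Lemma holo_ext m (S : set 'rV[K]_m) (f g : 'rV[K]_m -> K) : open S ->
  (forall x, S x -> f x = g x) -> holo S f -> holo S g.
Proof.
move=> oS fg hf.
have Sn y : S y -> \forall z \near y, f z = g z.
  by move=> Sy; apply: filterS fg _; exact: open_nbhs_nbhs.
apply: (holo_of_diff (df := fun y v => 'd f y v) oS) => [x Sx|x v Sx|x v Sx].
- exact: (near_eq_diff (Sn x Sx) (hf x Sx).1).1.
- by rewrite (near_eq_diff (Sn x Sx) (hf x Sx).1).2.
- exact: holo_diff_continuous hf Sx.
Qed.

Lemma holoD m (S : set 'rV[K]_m) (f g : 'rV[K]_m -> K) : open S ->
  holo S f -> holo S g -> holo S (fun x => f x + g x).
Proof.
move=> oS hf hg.
apply: (holo_of_diff (df := fun y v => 'd f y v + 'd g y v) oS) =>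
  [x Sx|x v Sx|x v Sx].
- by apply: differentiableD; [exact: (hf x Sx).1|exact: (hg x Sx).1].
- by rewrite (diffD (hf x Sx).1 (hg x Sx).1).
- exact: (cvgD ((hf x Sx).2 v) ((hg x Sx).2 v)).
Qed.

Lemma holoM m (S : set 'rV[K]_m) (f g : 'rV[K]_m -> K) : open S ->
  holo S f -> holo S g -> holo S (fun x => f x * g x).
Proof.
move=> oS hf hg.
apply: (holo_of_diff (df := fun y v => f y * 'd g y v + g y * 'd f y v) oS) =>
  [x Sx|x v Sx|x v Sx].
- by apply: differentiableM; [exact: (hf x Sx).1|exact: (hg x Sx).1].
- by rewrite (diffM (hf x Sx).1 (hg x Sx).1).
- exact: (cvgD (cvgM (holo_continuous hf Sx) ((hg x Sx).2 v))
               (cvgM (holo_continuous hg Sx) ((hf x Sx).2 v))).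
Qed.

Lemma holoN m (S : set 'rV[K]_m) (f : 'rV[K]_m -> K) : open S ->
  holo S f -> holo S (fun x => - f x).
Proof.
move=> oS hf; under eq_fun do rewrite -mulN1r.
exact: (holoM oS (holo_cst _) hf).
Qed.

Lemma holoB m (S : set 'rV[K]_m) (f g : 'rV[K]_m -> K) : open S ->
  holo S f -> holo S g -> holo S (fun x => f x - g x).
Proof. by move=> oS hf hg; exact: (holoD oS hf (holoN oS hg)). Qed.

Lemma holo_sum m (S : set 'rV[K]_m) (I : Type) (r : seq I) (P : pred I)
    (f : I -> 'rV[K]_m -> K) : open S -> (forall i, holo S (f i)) ->
  holo S (fun x => \sum_(i <- r | P i) f i x).
Proof.
move=> oS hf; elim: r => [|i r IH].
  by under eq_fun do rewrite big_nil; exact: holo_cst.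
under eq_fun do rewrite big_cons; case: (P i); last exact: IH.
exact: (holoD oS (hf i) IH).
Qed.

Lemma holo_map_diff m p (S : set 'rV[K]_m) (G : 'rV[K]_m -> 'rV[K]_p) x :
  holo_map S G -> S x -> differentiable G x /\
  forall v, 'd G x v = \row_k 'd (fun y => G y 0 k) x v.
Proof. by move=> hG Sx; apply: differentiable_row => k; exact: (hG k x Sx).1. Qed.

Lemma holo_map_continuous m p (S : set 'rV[K]_m) (G : 'rV[K]_m -> 'rV[K]_p) x :
  holo_map S G -> S x -> {for x, continuous G}.
Proof.
move=> hG Sx; apply: differentiable_continuous.
exact: (holo_map_diff hG Sx).1.
Qed.

Lemma holo_comp m p (S : set 'rV[K]_m) (T : set 'rV[K]_p)
    (G : 'rV[K]_m -> 'rV[K]_p) (f : 'rV[K]_p -> K) :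
  open S -> (forall x, S x -> T (G x)) -> holo_map S G -> holo T f ->
  holo S (fun x => f (G x)).
Proof.
move=> oS ST hG hf.
have dG y (Sy : S y) : differentiable G y := (holo_map_diff hG Sy).1.
apply: (holo_of_diff (df := fun y v =>
    \sum_k 'd (fun z => G z 0 k) y v * 'd f (G y) (evec k)) oS) =>
  [x Sx|x v Sx|x v Sx].
- by apply: differentiable_comp; [exact: dG|exact: (hf _ (ST _ Sx)).1].
- rewrite (diff_comp (dG x Sx) (hf _ (ST _ Sx)).1) /= diff_sum_coord.
  by apply: eq_bigr => k _; rewrite (holo_map_diff hG Sx).2 mxE.
- apply: (@continuous_at_sum _ _ _ _ _ _ (fun k y =>
      'd (fun z => G z 0 k) y v * 'd f (G y) (evec k))) => k.
  apply: (cvgM ((hG k x Sx).2 v)).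
  apply: (@continuous_comp _ _ _ G (fun z => 'd f z (evec k))).
    exact: holo_map_continuous hG Sx.
  exact: ((hf _ (ST _ Sx)).2 (evec k)).
Qed.

Lemma open_preimage m p (S : set 'rV[K]_m) (T : set 'rV[K]_p)
    (G : 'rV[K]_m -> 'rV[K]_p) :
  open S -> open T -> {in S, continuous G} -> open (S `&` G @^-1` T).
Proof.
move=> oS oT cG; rewrite openE => x [Sx Tx].
have nS := open_nbhs_nbhs (conj oS Sx).
have nT := cG x (mem_set Sx) T (open_nbhs_nbhs (conj oT Tx)).
exact: (@filterI _ (nbhs x) _ _ _ nS nT).
Qed.

End HoloCalculus.

Section PolynomialFunctions.
Context {K : numFieldType}.

(** Polynomial functions are holomorphic everywhere and, unlike holomorphic
    ones, visibly closed under derivation: this gives the holomorphy of all the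
    derivatives that occur below without a second use of Cauchy's formula. *)
Inductive polyfun m : ('rV[K]_m -> K) -> Prop :=
| polyfun_cst c : polyfun (fun=> c)
| polyfun_coord k : polyfun (fun y => y 0 k)
| polyfunD f g : polyfun f -> polyfun g -> polyfun (fun y => f y + g y)
| polyfunM f g : polyfun f -> polyfun g -> polyfun (fun y => f y * g y).

Arguments polyfun_cst {m} c.
Arguments polyfun_coord {m} k.

Lemma polyfun_holo m (S : set 'rV[K]_m) f : open S -> polyfun f -> holo S f.
Proof.
move=> oS; elim=> [c|k|{}f g _ IHf _ IHg|{}f g _ IHf _ IHg].
- exact: holo_cst.
- exact: holo_coord.
- exact: (holoD oS IHf IHg).
- exact: (holoM oS IHf IHg).
Qed.

Lemma polyfun_differentiable m (f : 'rV[K]_m -> K) x :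
  polyfun f -> differentiable f x.
Proof. by move=> pf; exact: (polyfun_holo openT pf I).1. Qed.

Lemma polyfun_sum m (I : Type) (r : seq I) (P : pred I)
    (f : I -> 'rV[K]_m -> K) : (forall i, polyfun (f i)) ->
  polyfun (fun x => \sum_(i <- r | P i) f i x).
Proof.
move=> hf; elim: r => [|i r IH].
  by under eq_fun do rewrite big_nil; exact: polyfun_cst.
under eq_fun do rewrite big_cons; case: (P i); last exact: IH.
exact: (polyfunD (hf i) IH).
Qed.

Lemma polyfun_prod m (I : Type) (r : seq I) (P : pred I)
    (f : I -> 'rV[K]_m -> K) : (forall i, polyfun (f i)) ->
  polyfun (fun x => \prod_(i <- r | P i) f i x).
Proof.
move=> hf; elim: r => [|i r IH].
  by under eq_fun do rewrite big_nil; exact: polyfun_cst.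
under eq_fun do rewrite big_cons; case: (P i); last exact: IH.
exact: (polyfunM (hf i) IH).
Qed.

Lemma polyfunX m (f : 'rV[K]_m -> K) n :
  polyfun f -> polyfun (fun x => f x ^+ n).
Proof.
move=> hf; elim: n => [|n IH].
  by under eq_fun do rewrite expr0; exact: polyfun_cst.
under eq_fun do rewrite exprS; exact: (polyfunM hf IH).
Qed.

Lemma polyfunN m (f : 'rV[K]_m -> K) : polyfun f -> polyfun (fun x => - f x).
Proof.
move=> hf; under eq_fun do rewrite -mulN1r.
exact: (polyfunM (polyfun_cst (-1)) hf).
Qed.

Lemma polyfunB m (f g : 'rV[K]_m -> K) : polyfun f -> polyfun g ->
  polyfun (fun x => f x - g x).
Proof. by move=> hf hg; exact: (polyfunD hf (polyfunN hg)). Qed.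

Lemma diff_coord m k (x v : 'rV[K]_m) :
  'd (fun y : 'rV[K]_m => y 0 k : K) x v = v 0 k.
Proof.
have lin : linear (fun y : 'rV[K]_m => y 0 k : K).
  by move=> a u w; rewrite !mxE.
pose L : {linear 'rV[K]_m -> K} := HB.pack (fun y : 'rV[K]_m => y 0 k : K)
  (GRing.isLinear.Build _ _ _ _ _ lin).
rewrite (_ : (fun y : 'rV[K]_m => y 0 k : K) = L)//.
by rewrite diff_lin// => z; exact: coord_continuous.
Qed.

Lemma diff_fD m (f g : 'rV[K]_m -> K) x v :
  differentiable f x -> differentiable g x ->
  'd (fun y => f y + g y) x v = 'd f x v + 'd g x v.
Proof. by move=> df dg; rewrite (diffD df dg). Qed.

Lemma diff_fM m (f g : 'rV[K]_m -> K) x v :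
  differentiable f x -> differentiable g x ->
  'd (fun y => f y * g y) x v = f x * 'd g x v + g x * 'd f x v.
Proof. by move=> df dg; rewrite (diffM df dg). Qed.

Lemma diff_fcst m (c : K) (x v : 'rV[K]_m) : 'd (fun=> c) x v = 0.
Proof. by rewrite (_ : (fun=> c) = cst c)// diff_cst. Qed.

Lemma polyfun_diff m (f : 'rV[K]_m -> K) v :
  polyfun f -> polyfun (fun y => 'd f y v).
Proof.
elim=> [c|k|{}f g pf IHf pg IHg|{}f g pf IHf pg IHg].
- by under eq_fun do rewrite diff_fcst; exact: polyfun_cst.
- by under eq_fun do rewrite diff_coord; exact: polyfun_cst.
- under eq_fun => y do
    rewrite (diff_fD _ (polyfun_differentiable y pf) (polyfun_differentiable y pg)).
  exact: (polyfunD IHf IHg).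
- under eq_fun => y do
    rewrite (diff_fM _ (polyfun_differentiable y pf) (polyfun_differentiable y pg)).
  exact: (polyfunD (polyfunM pf IHg) (polyfunM pg IHf)).
Qed.

Lemma polyfun_comp m p (G : 'rV[K]_m -> 'rV[K]_p) f :
  (forall k, polyfun (fun y => G y 0 k)) -> polyfun f ->
  polyfun (fun y => f (G y)).
Proof.
move=> pG; elim=> [c|k|{}f g _ IHf _ IHg|{}f g _ IHf _ IHg].
- exact: polyfun_cst.
- exact: pG.
- exact: (polyfunD IHf IHg).
- exact: (polyfunM IHf IHg).
Qed.

Lemma holo_lie m (S : set 'rV[K]_m) (f : 'rV[K]_m -> K)
    (v : 'rV[K]_m -> 'rV[K]_m) : open S -> polyfun f -> holo_map S v ->
  holo S (fun y => 'd f y (v y)).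
Proof.
move=> oS pf hv; under eq_fun do rewrite diff_sum_coord.
apply: (holo_sum _ _ oS) => k.
exact: (holoM oS (hv k) (polyfun_holo oS (polyfun_diff _ pf))).
Qed.

End PolynomialFunctions.

(** * Integrals depending holomorphically on a parameter *)

Section PathIntegrals.
Context {R : realType} {K : numFieldType} (X : complex_field R K).

Local Notation rc := (of_real X).
Local Notation iu := (imag X).
Local Notation cint := (cint X).

Lemma ge0_of_real (r : R) : 0 <= r -> 0 <= rc r.
Proof. by move=> r0; rewrite -(rmorph0 rc) ler_of_real. Qed.

Lemma velocity_lipschitz (V : normedModType K) (c c' : R -> V) (t : R) :
  has_velocity X c c' -> 0 <= t <= 1 ->
  exists2 M : K, 0 < M & \forall s \near t, `|c s - c t| <= M * rc `|s - t|.
Proof.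
move=> vc t01; exists (1 + `|c' t|); first by rewrite ltr_wpDr.
apply: filterS (vc t t01 1 ltr01) => s h.
rewrite -[c s - c t](subrK (rc (s - t) *: c' t)) (le_trans (ler_normD _ _))//.
by rewrite mulrDl lerD// normrZ norm_of_real mulrC.
Qed.

Lemma velocity_continuous (V : normedModType K) (c c' : R -> V) (t : R) :
  has_velocity X c c' -> 0 <= t <= 1 -> {for t, continuous c}.
Proof.
move=> vc t01; have [M M0 hM] := velocity_lipschitz vc t01.
apply/cvgrPdist_le => e e0.
have [r r0 eM] := pos_of_real X (divr_gt0 e0 M0).
have hr : \forall s \near t, `|t - s| <= r by exact: near_dist_le.
apply: filterS2 hM hr => s h tr.
rewrite distrC (le_trans h)// mulrC -ler_pdivlMr// eM ler_of_real.
by rewrite distrC.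
Qed.

(** The chain rule. The error splits into that of g, controlled because c is
    Lipschitz at t, and that of c, controlled because the differential of g is
    Lipschitz; each is given half of e. *)
Lemma velocity_comp (V : normedModType K) (c c' : R -> V) (g : V -> K) :
  has_velocity X c c' ->
  (forall t : R, 0 <= t <= 1 -> differentiable g (c t)) ->
  @has_velocity _ _ X K^o (fun t => g (c t)) (fun t => 'd g (c t) (c' t)).
Proof.
move=> vc dg t t01 e e0.
have [M M0 hM] := velocity_lipschitz vc t01.
have [k k0 hk] := linear_lipschitz (diff_continuous (dg t t01)).
have e1 : 0 < e / 2 / M by rewrite !divr_gt0.
have e2 : 0 < e / 2 / k by rewrite !divr_gt0.
have h1 : \forall s \near t,
    `|g (c s) - g (c t) - 'd g (c t) (c s - c t)| <= e / 2 / M * `|c s - c t|.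
  exact: (velocity_continuous vc t01 (diff_eps (dg t t01) e1)).
near=> s.
rewrite (_ : _ - _ = (g (c s) - g (c t) - 'd g (c t) (c s - c t)) +
    'd g (c t) (c s - c t - rc (s - t) *: c' t)); last first.
  by rewrite [X in _ = _ + X]linearB [RHS]addrA subrK; congr (_ - _);
    rewrite [RHS]linearZ.
rewrite (le_trans (ler_normD _ _))// [leRHS](_ : _ =
  e / 2 / M * (M * rc `|s - t|) + k * (e / 2 / k * rc `|s - t|)); last first.
  by field; rewrite !gt_eqF.
apply: lerD.
  apply: (le_trans (near h1 s _)) => //.
  rewrite ler_wpM2l ?(ltW e1)//; near: s; exact: hM.
apply: (le_trans (hk _)); rewrite ler_wpM2l ?(ltW k0)//.
near: s; exact: vc.
Unshelve. all: by end_near. Qed.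

Lemma cint_path m (W : set 'rV[K]_m) (g : 'rV[K]_m -> K)
    (c c' : R -> 'rV[K]_m) :
  holo W g -> has_velocity X c c' -> cont01 c' ->
  (forall t : R, 0 <= t <= 1 -> W (c t)) ->
  cont01 (fun t => 'd g (c t) (c' t)) /\
  cint (fun t => 'd g (c t) (c' t)) = g (c 1) - g (c 0).
Proof.
move=> hg vc cc' cW.
have cd : cont01 (fun t => 'd g (c t) (c' t)).
  have -> : (fun t => 'd g (c t) (c' t)) =
      fun t => \sum_k c' t 0 k * 'd g (c t) (evec k).
    by apply/funext => t; rewrite diff_sum_coord.
  move=> t t01.
  apply: (@continuous_at_sum _ _ _ _ _ _ (fun k s =>
    c' s 0 k * 'd g (c s) (evec k))) => k; apply: cvgM.
    apply: (@continuous_comp _ _ _ c' (fun v : 'rV_m => v 0 k)).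
      exact: cc'.
    exact: coord_continuous.
  apply: (@continuous_comp _ _ _ c (fun z => 'd g z (evec k))).
    exact: velocity_continuous vc t01.
  exact: ((hg _ (cW t t01)).2 (evec k)).
split=> //; apply: (@cint_FTC _ _ X (fun t => g (c t))) => //.
by apply: velocity_comp => // t t01; exact: (hg _ (cW t t01)).1.
Qed.

Lemma segment_velocity (V : normedModType K) (x h : V) :
  has_velocity X (fun t => x + rc t *: h) (fun=> h).
Proof.
move=> t t01 e e0; apply: (@filterE _ (nbhs t)) => s.
rewrite opprD addrACA subrr add0r -scalerBl -rmorphB subrr normr0.
by rewrite mulr_ge0 ?(ltW e0)// ge0_of_real.
Qed.

Lemma cint_cst (a : K) : cint (fun=> a) = a.
Proof.
have v : @has_velocity _ _ X K^o (fun t => 0 + rc t *: (a : K^o)) (fun=> a).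
  exact: segment_velocity.
rewrite (@cint_FTC _ _ X (fun t => 0 + rc t *: (a : K^o)))//.
  by rewrite rmorph0 rmorph1 scale0r scale1r addr0 add0r subr0.
exact: cont01_cst.
Qed.

Lemma cint_sum (I : Type) (r : seq I) (F : I -> R -> K) :
  (forall i, cont01 (F i)) ->
  cint (fun t => \sum_(i <- r) F i t) = \sum_(i <- r) cint (F i).
Proof.
move=> cF; elim: r => [|i r IH].
  by under eq_fun do rewrite big_nil; rewrite big_nil cint_cst.
under eq_fun do rewrite big_cons; rewrite big_cons cintD ?IH//.
by move=> t t01; apply: continuous_at_sum => j; exact: cF.
Qed.

(** The unit interval being compact, continuity in a parameter is uniform in
    the variable of integration. *)
Lemma unif_continuous_param (V : topologicalType) (J : R -> V -> K) (y0 : V) :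
  (forall t : R, 0 <= t <= 1 ->
    {for (t, y0), continuous (fun p => J p.1 p.2)}) ->
  forall e : K, 0 < e -> \forall y \near y0, forall t : R, 0 <= t <= 1 ->
    `|J t y - J t y0| <= e.
Proof.
move=> cJ e e0.
have /compact_near_coveringP K01 := @segment_compact R 0 1.
have : \forall y \near y0, `[0, 1]%classic `<=`
    (fun t => `|J t y - J t y0| <= e).
  apply: (@K01 V (nbhs y0) (fun y t => `|J t y - J t y0| <= e) _) => t.
  rewrite /= in_itv /= => t01.
  have e2 : 0 < e / 2 by rewrite divr_gt0.
  have /cvgrPdist_le/(_ _ e2) := cJ t t01.
  case=> -[/= A B] [nA nB] AB; exists (A, B) => //= -[s y] /= [As By].
  have y0B := nbhs_singleton nB.
  rewrite -(subrKA (J t y0)) (le_trans (ler_normD _ _))// (splitr e) lerD//.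
    by rewrite distrC; exact: (AB (s, y)).
  exact: (AB (s, y0)).
by apply: filterS => y h t t01; apply: h; rewrite /= in_itv.
Qed.

Lemma cint_continuous_param (V : topologicalType) (S : set V)
    (J : R -> V -> K) (y0 : V) : open S -> S y0 ->
  (forall t y, 0 <= t <= 1 -> S y ->
    {for (t, y), continuous (fun p => J p.1 p.2)}) ->
  {for y0, continuous (fun y => cint (fun t => J t y))}.
Proof.
move=> oS Sy0 cJ.
have c1 y : S y -> cont01 (fun t => J t y).
  move=> Sy t t01; apply: (@continuous_comp _ _ _ (fun t => (t, y))
    (fun p => J p.1 p.2)); last exact: cJ.
  exact: (cvg_pair (@cvg_id _ (nbhs t)) (@cvg_cst _ y _ (nbhs t) _)).
apply/cvgrPdist_le => e e0.
have e2 : 0 < e / 2 by rewrite divr_gt0.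
have hu := unif_continuous_param (fun t t01 => cJ t y0 t01 Sy0) e2.
have hS : \forall y \near y0, S y by exact: (open_nbhs_nbhs (conj oS Sy0)).
apply: filterS2 hS hu => y Sy h.
rewrite distrC -cintB; [|exact: c1..].
rewrite [leRHS](_ : e = 2 * (e / 2)); last by rewrite mulrC divfK ?pnatr_eq0.
by apply: cint_le => //; apply: cont01B; exact: c1.
Qed.

End PathIntegrals.

Section HoloIntegral.
Context {R : realType} {K : numFieldType} (X : complex_field R K).

Local Notation rc := (of_real X).
Local Notation cint := (cint X).

Lemma polymap_continuous m p (F : 'rV[K]_m -> 'rV[K]_p) :
  (forall k, polyfun (fun y => F y 0 k)) -> continuous F.
Proof.
move=> pF x; apply: (@holo_map_continuous _ _ _ setT) => // k.
exact: (polyfun_holo openT (pF k)).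
Qed.

(** A point of the parameter space together with the variable of integration,
    as a point of one space of row vectors, so that joint holomorphy makes
    sense. *)
Definition join m (a : K) (y : 'rV[K]_m) : 'rV[K]_(1 + m) := row_mx a%:M y.

Lemma join0 m a (y : 'rV[K]_m) : join a y 0 (lshift m 0) = a.
Proof. by rewrite row_mxEl mxE eqxx. Qed.

Lemma joinS m a (y : 'rV[K]_m) k : join a y 0 (rshift 1 k) = y 0 k.
Proof. by rewrite row_mxEr. Qed.

Lemma joinD m a b (y z : 'rV[K]_m) : join (a + b) (y + z) = join a y + join b z.
Proof. by rewrite /join add_row_mx -raddfD. Qed.

Lemma joinZ m c a (y : 'rV[K]_m) : join (c * a) (c *: y) = c *: join a y.
Proof. by rewrite /join scale_row_mx scale_scalar_mx. Qed.

Lemma polyfun_join m a k : polyfun (fun y : 'rV[K]_m => join a y 0 k).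
Proof.
case: (split_ordP k) => j ->.
  under eq_fun do rewrite ord1 join0.
  exact: polyfun_cst.
under eq_fun do rewrite joinS.
exact: polyfun_coord.
Qed.

Lemma join_continuous m (c : R -> K) (t : R) (y : 'rV[K]_m) :
  {for t, continuous c} ->
  {for (t, y), continuous (fun p : R * 'rV[K]_m => join (c p.1) p.2)}.
Proof.
move=> ct.
have -> : (fun p : R * 'rV[K]_m => join (c p.1) p.2) =
    fun p => c p.1 *: join 1 (0 : 'rV[K]_m) + join 0 p.2.
  by apply/funext => p; rewrite -joinZ mulr1 scaler0 -joinD addr0 add0r.
apply: cvgD.
  have cp : {for (t, y), continuous (fun p : R * 'rV[K]_m => c p.1)}.
    by apply: (@continuous_comp _ _ _ fst c); [exact: cvg_fst|exact: ct].
  exact: (cvgZr_tmp cp).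
apply: (@continuous_comp _ _ _ snd (join 0)); first exact: cvg_snd.
by apply: polymap_continuous => k; exact: polyfun_join.
Qed.

Section ParamIntegral.
Context {m : nat}.
Variables (W : set 'rV[K]_(1 + m)) (G : 'rV[K]_(1 + m) -> K) (c : R -> K).
Hypotheses (oW : open W) (hG : holo W G) (cc : cont01 c).

(** The tube lemma: the interval is compact. *)
Lemma tube_open :
  open [set y : 'rV[K]_m | forall t : R, 0 <= t <= 1 -> W (join (c t) y)].
Proof.
rewrite openE => y0 /= Wy0.
have /compact_near_coveringP K01 := @segment_compact R 0 1.
have : \forall y \near y0, `[0, 1]%classic `<=` (fun t => W (join (c t) y)).
  apply: (@K01 _ (nbhs y0) (fun y t => W (join (c t) y)) _) => t.
  rewrite /= in_itv /= => t01.
  have [[A B] [nA nB] AB] :=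
    @join_continuous _ c t y0 (cc t01) _ (open_nbhs_nbhs (conj oW (Wy0 t t01))).
  by exists (A, B) => // -[s y] [As By]; exact: (AB (s, y)).
by apply: filterS => y h t t01; apply: h; rewrite /= in_itv.
Qed.

Variable S : set 'rV[K]_m.
Hypothesis oS : open S.
Hypothesis SW : forall (t : R) y, 0 <= t <= 1 -> S y -> W (join (c t) y).

Let J v (t : R) (y : 'rV[K]_m) := 'd G (join (c t) y) (join 0 v).

Let J_continuous v (t : R) y : 0 <= t <= 1 -> S y ->
  {for (t, y), continuous (fun p => J v p.1 p.2)}.
Proof.
move=> t01 Sy.
apply: (@continuous_comp _ _ _ (fun p : R * 'rV[K]_m => join (c p.1) p.2)
  (fun z => 'd G z (join 0 v))).
  exact: join_continuous (cc t01).
exact: ((hG (SW t01 Sy)).2 (join 0 v)).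
Qed.

Let cont01_slice (H : R -> 'rV[K]_m -> K) y :
  (forall t : R, 0 <= t <= 1 ->
    {for (t, y), continuous (fun p => H p.1 p.2)}) -> cont01 (fun t => H t y).
Proof.
move=> cH t t01; apply: (@continuous_comp _ _ _ (fun t => (t, y))
  (fun p => H p.1 p.2)); last exact: cH.
exact: (cvg_pair (@cvg_id _ (nbhs t)) (@cvg_cst _ y _ (nbhs t) _)).
Qed.

Let G_cont y : S y -> cont01 (fun t => G (join (c t) y)).
Proof.
move=> Sy; apply: (@cont01_slice (fun t y => G (join (c t) y))) => t t01.
apply: (@continuous_comp _ _ _ (fun p : R * 'rV[K]_m => join (c p.1) p.2) G).
  exact: join_continuous (cc t01).
exact: (holo_continuous hG (SW t01 Sy)).
Qed.

Let J_cont v y : S y -> cont01 (fun t => J v t y).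
Proof. by move=> Sy; apply: cont01_slice => t t01; exact: J_continuous. Qed.

Let J_sum v t y : J v t y = \sum_k v 0 k * J (evec k) t y.
Proof.
rewrite /J diff_sum_coord big_split_ord /= big_ord1 join0 mul0r add0r.
apply: eq_bigr => k _; rewrite joinS; congr (_ * 'd G _ _).
apply/rowP => j; case: (split_ordP j) => i ->.
  by rewrite ord1 join0 mxE eq_lrshift andbF.
by rewrite joinS !mxE (inj_eq (@rshift_inj _ _)).
Qed.

Let cintJ v y : S y ->
  cint (fun t => J v t y) = \sum_k v 0 k * cint (fun t => J (evec k) t y).
Proof.
move=> Sy; under [X in cint X]eq_fun do rewrite J_sum.
rewrite (@cint_sum _ _ _ _ _ (fun k t => v 0 k * J (evec k) t y)).
  by apply: eq_bigr => k _; rewrite cintZ//; exact: J_cont.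
by move=> k; apply: cont01M; [exact: cont01_cst|exact: J_cont].
Qed.

(* The increment of G is the integral of its derivative along the segment from y
   to y'; comparing the derivative with its value at y gives the bound, one
   factor 2 coming from the integral and m from the coordinates. *)
Let increment_le (y y' : 'rV[K]_m) (e : K) (t : R) :
  (forall s : R, 0 <= s <= 1 -> S (y + rc s *: (y' - y))) ->
  (forall s : R, 0 <= s <= 1 -> forall k,
    `|J (evec k) t (y + rc s *: (y' - y)) - J (evec k) t y| <= e) ->
  0 <= t <= 1 ->
  `|G (join (c t) y') - G (join (c t) y) - J (y' - y) t y| <=
    2 * (m%:R * (`|y' - y| * e)).
Proof.
move=> Sseg hseg t01; set h := y' - y.
have jE s : join (c t) y + rc s *: join 0 h = join (c t) (y + rc s *: h).
  by rewrite -joinZ mulr0 -joinD addr0.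
have WS s : 0 <= s <= 1 -> W (join (c t) y + rc s *: join 0 h).
  by move=> s01; rewrite jE; apply: SW => //; exact: Sseg.
have [cd] := cint_path hG (@segment_velocity _ _ X _ _ (join 0 h))
  (@cont01_cst _ _ _) WS.
have yh : y + h = y' by rewrite addrC subrK.
rewrite !jE rmorph1 rmorph0 scale1r scale0r addr0 yh => <-.
set A := (fun s => 'd G (join (c t) y + rc s *: join 0 h) (join 0 h)) in cd *.
rewrite -(cint_cst X (J h t y)) -(cintB X cd (@cont01_cst _ _ _)).
apply: cint_le => [|s s01]; first exact: (cont01B cd (@cont01_cst _ _ _)).
rewrite /A jE -[X in X - _]/(J h t (y + rc s *: h)) !(J_sum h) -sumrB.
rewrite (le_trans (ler_norm_sum _ _ _))//.
apply: (@le_trans _ _ (\sum_(k < m) `|h| * e)); last first.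
  by rewrite sumr_const card_ord mulr_natl.
apply: ler_sum => k _; rewrite -mulrBr normrM.
by apply: ler_pM => //; [exact: coord_norm_le|exact: hseg].
Qed.

(** Differentiation under the integral sign. The partial derivatives are
    uniformly continuous in the parameter along the interval, so that the
    increments of G are linear up to an error that is uniform in t
    ([increment_le]) and can be integrated. *)
Lemma cint_holo : holo S (fun y => cint (fun t => G (join (c t) y))) /\
  forall y v, S y -> 'd (fun y => cint (fun t => G (join (c t) y))) y v =
    cint (fun t => 'd G (join (c t) y) (join 0 v)).
Proof.
set F := fun y => cint (fun t => G (join (c t) y)).
pose D (y v : 'rV[K]_m) : K := \sum_k v 0 k * cint (fun t => J (evec k) t y).
have dF y : S y -> differentiable F y /\ forall v, 'd F y v = D y v.
  move=> Sy.
  have lin : linear (D y : 'rV[K]_m -> K^o).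
    move=> a u w; rewrite /D scaler_sumr -big_split; apply: eq_bigr => k _ /=.
    by rewrite !mxE mulrDl /GRing.scale /= mulrA.
  pose L : {linear 'rV[K]_m -> K^o} :=
    HB.pack (D y : 'rV[K]_m -> K^o) (GRing.isLinear.Build _ _ _ _ _ lin).
  have cL : continuous L.
    have pD : polyfun (D y).
      apply: (@polyfun_sum _ _ _ _ _ (fun k (v : 'rV[K]_m) =>
        v 0 k * cint (fun t => J (evec k) t y))) => k.
      apply: (@polyfunM K m (fun v => v 0 k)
        (fun=> cint (fun t => J (evec k) t y))).
        exact: polyfun_coord.
      exact: polyfun_cst.
    move=> v; apply: differentiable_continuous.
    exact: (polyfun_differentiable v pD).
  have [] := @diff_of_eps _ _ _ (F : 'rV[K]_m -> K^o) y L cL _; last first.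
    by move=> dFy dE; split=> // v; rewrite dE.
  move=> e e0.
  (* Two factors 2 come from the two integrals, and m.+1 dominates the number of
     coordinates while being nonzero. *)
  have e1 : 0 < e / (4 * m.+1%:R) by rewrite divr_gt0// mulr_gt0.
  have hu : \forall y' \near y, forall k (t : R), 0 <= t <= 1 ->
      `|J (evec k) t y' - J (evec k) t y| <= e / (4 * m.+1%:R).
    apply: (@filter_forall _ _ _ (nbhs y)) => k.
    exact: (unif_continuous_param
      (fun t t01 => @J_continuous (evec k) t y t01 Sy) e1).
  have hS : \forall y' \near y, S y' by exact: (open_nbhs_nbhs (conj oS Sy)).
  have hSu := @filterI _ (nbhs y) (nbhs_filter y) _ _ hS hu.
  have [r r0 hr] := iffLR (nbhs_ballP y _) hSu.
  have : \forall y' \near y, ball y r y' by exact: nbhsx_ballx.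
  apply: filterS => y' yy'.
  have seg s : 0 <= s <= 1 -> ball y r (y + rc s *: (y' - y)).
    move=> /andP[s0 s1].
    rewrite -ball_normE /= opprD addrA subrr add0r normrN normrZ norm_of_real.
    rewrite (ger0_norm s0) (le_lt_trans (ler_piMl _ _))//.
      by rewrite -(rmorph1 rc) ler_of_real.
    by rewrite distrC; move: yy'; rewrite -ball_normE.
  have Sy' := (hr _ yy').1.
  have cGG := cont01B (G_cont Sy') (G_cont Sy).
  have -> : F y' - F y - L (y' - y) =
      cint (fun t => G (join (c t) y') - G (join (c t) y) - J (y' - y) t y).
    by rewrite (cintB X cGG (@J_cont (y' - y) y Sy)) (cintB X (G_cont Sy') (G_cont Sy))
      (@cintJ (y' - y) y Sy).
  apply: (@le_trans _ _
    (2 * (2 * (m%:R * (`|y' - y| * (e / (4 * m.+1%:R))))))).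
    apply: cint_le => [|t t01]; first exact: (cont01B cGG (@J_cont (y' - y) y Sy)).
    apply: (increment_le _ _ (t01)) => [s s01|s s01 k].
      exact: (hr _ (seg s s01)).1.
    exact: ((hr _ (seg s s01)).2 k t t01).
  rewrite [leLHS](_ : _ = m%:R / m.+1%:R * (e * `|y' - y|)).
    rewrite ler_piMl// ?mulr_ge0// ?(ltW e0)// ler_pdivrMr// mul1r.
    by rewrite ler_nat.
  have : m.+1%:R != 0 :> K by rewrite pnatr_eq0.
  by move: (m.+1%:R) => M M0; field.
have hF : holo S F.
  apply: (holo_of_diff (df := D) oS) => [y Sy|y v Sy|y v Sy].
  - exact: (dF y Sy).1.
  - exact: (dF y Sy).2.
  - apply: (@continuous_at_sum _ _ _ _ _ _ (fun k z =>
      v 0 k * cint (fun t => J (evec k) t z))) => k.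
    have cD : {for y, continuous (fun z => cint (fun t => J (evec k) t z))}.
      exact: (@cint_continuous_param R K X _ S (J (evec k)) y oS Sy
        (fun t z t01 Sz => @J_continuous (evec k) t z t01 Sz)).
    exact: (cvgM (@cvg_cst _ (v 0 k) _ (nbhs y) _) cD).
by split=> // y v Sy; rewrite (dF y Sy).2 /D -cintJ.
Qed.

End ParamIntegral.
End HoloIntegral.

(** * Division of holomorphic functions by a coordinate *)

(** A differential in a given direction is a derivative along a line, so it only
    depends on the restriction to that line, which may also be read in another
    space. *)
Lemma diff_line (K : numFieldType) (V1 V2 : normedModType K)
    (f1 : V1 -> K) (f2 : V2 -> K) (a1 v1 : V1) (a2 v2 : V2) :
  differentiable f1 a1 -> differentiable f2 a2 ->
  (forall h : K, f1 (h *: v1 + a1) = f2 (h *: v2 + a2)) ->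
  'd f1 a1 v1 = 'd f2 a2 v2.
Proof.
move=> d1 d2 f12; rewrite -(deriveE v1 d1) -(deriveE v2 d2) /derive.
have e0 : f1 a1 = f2 a2 by have := f12 0; rewrite !scale0r !add0r.
by under eq_fun do rewrite /= f12 e0.
Qed.

Section Circle.
Context {R : realType} {K : numFieldType} (X : complex_field R K).

Local Notation rc := (of_real X).
Local Notation iu := (imag X).
Local Notation cint := (cint X).

Definition circle (t : R) : K :=
  rc (cos (2 * pi * t)) + iu * rc (sin (2 * pi * t)).

Definition circle_speed : K := rc (2 * pi) * iu.

Lemma circle_speed_neq0 : circle_speed != 0.
Proof.
rewrite mulf_neq0//.
  by rewrite fmorph_eq0 mulf_neq0 ?pnatr_eq0// gt_eqF// pi_gt0.
by rewrite -normr_eq0 norm_imag oner_eq0.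
Qed.

Lemma norm_circle t : `|circle t| = 1.
Proof.
by apply/eqP; rewrite -(@eqrXn2 _ 2)// norm_rect cos2Dsin2 expr1n rmorph1.
Qed.

Lemma circle_loop : circle 1 = circle 0.
Proof.
by rewrite /circle mulr1 mulr0 cos0 sin0 mulr_natl cos2pi sin2pi.
Qed.

Let real_eps (f : R -> R) (t d : R) : is_derive t 1 f d ->
  forall e : R, 0 < e -> \forall s \near t,
    `|f s - f t - (s - t) * d| <= e * `|s - t|.
Proof.
move=> [df dE] e e0; have df' : differentiable f t by exact/derivable1_diffP.
apply: filterS (diff_eps df' e0) => s.
by rewrite deriv1E// derive1E dE.
Qed.

(** The two trigonometric functions are differentiated over R, where their
    derivatives are known, and each contributes half of the error. *)
Lemma circle_velocity :
  @has_velocity _ _ X K^o circle (fun t => circle_speed * circle t).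
Proof.
move=> t t01 e /(pos_of_real X)[r r0 ->].
have r2 : 0 < r / 2 by rewrite divr_gt0.
have dc : is_derive t 1 (fun s => cos (2 * pi * s))
    (- (2 * pi * sin (2 * pi * t))).
  apply: is_derive_eq; rewrite /GRing.scale /= !mulr1; ring.
have ds : is_derive t 1 (fun s => sin (2 * pi * s))
    (2 * pi * cos (2 * pi * t)).
  apply: is_derive_eq; rewrite /GRing.scale /= !mulr1; ring.
apply: filterS2 (real_eps dc r2) (real_eps ds r2) => s hc hs.
rewrite (_ : _ - _ = rc (cos (2 * pi * s) - cos (2 * pi * t) -
    (s - t) * (- (2 * pi * sin (2 * pi * t)))) +
  iu * rc (sin (2 * pi * s) - sin (2 * pi * t) -
    (s - t) * (2 * pi * cos (2 * pi * t)))); last first.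
  rewrite /GRing.scale /= /circle /circle_speed.
  rewrite !(rmorphD, rmorphN, rmorphM) /=.
  by have := imag2 X; move: iu => i i2; ring: i2.
rewrite (le_trans (ler_normD _ _))// normrM norm_imag mul1r !norm_of_real.
rewrite -[X in X <= _]rmorphD -[X in _ <= X]rmorphM ler_of_real.
by rewrite [X in _ <= X * _]splitr [leRHS]mulrDl lerD.
Qed.

Lemma circle_cont : cont01 circle.
Proof. by move=> t t01; exact: (velocity_continuous circle_velocity t01). Qed.

Lemma line_velocity (V : normedModType K) (x v : V) (b c : K) :
  has_velocity X (fun t => x + (b * circle t - c) *: v)
    (fun t => (b * (circle_speed * circle t)) *: v).
Proof.
move=> t t01 e e0.
have M0 : 0 < `|b| * `|v| + 1 by rewrite ltr_wpDl// mulr_ge0.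
apply: filterS (circle_velocity t01 (divr_gt0 e0 M0)) => s h.
rewrite [X in `|X|](_ : _ = (b * (circle s - circle t -
    rc (s - t) * (circle_speed * circle t))) *: v); last first.
  rewrite opprD addrACA subrr add0r scalerA -!scalerBl; congr (_ *: _).
  by ring.
rewrite normrZ normrM mulrAC (le_trans (ler_wpM2l _ h)) ?mulr_ge0//.
rewrite mulrA ler_wpM2r//; first exact: ge0_of_real.
rewrite mulrCA ler_piMr ?(ltW e0)// ler_pdivrMr// mul1r.
by rewrite lerDl.
Qed.

End Circle.

Lemma diff_scale (K : numFieldType) (V : normedModType K) (f : V -> K) (x v : V)
  (a : K) : 'd f x (a *: v) = a * 'd f x v.
Proof. by rewrite linearZ. Qed.

Lemma diff_subM (K : numFieldType) m (g : 'rV[K]_m -> K) x v a q :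
  differentiable g x -> 'd (fun z => (g z - a) * q) x v = 'd g x v * q.
Proof.
move=> dg.
have dB : differentiable (fun z => g z - a) x.
  exact: (differentiableB dg (differentiable_cst a x)).
rewrite (diff_fM v dB (differentiable_cst q x)) diff_fcst mulr0 add0r mulrC.
rewrite (diff_fD v dg (differentiable_cst (- a) x)).
by rewrite diff_fcst addr0.
Qed.

Lemma open_neq0 (K : numFieldType) (T : topologicalType) (f : T -> K) :
  continuous f -> open [set x | f x != 0].
Proof.
move=> cf; apply: (@open_comp _ _ f [set z | z != 0]) => [z _|]; first exact: cf.
rewrite (_ : [set z | _] = ~` [set (0 : K)]).
  exact/closed_openC/accessible_closed_set1/hausdorff_accessible/norm_hausdorff.
by apply/seteqP; split=> z /= /eqP.
Qed.

Section Replace.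
Context {K : numFieldType} {m : nat} (k : 'I_m).

Definition replace (u : 'rV[K]_m) (z : K) : 'rV[K]_m :=
  u + (z - u 0 k) *: evec k.

Lemma replaceE u z j : replace u z 0 j = if j == k then z else u 0 j.
Proof.
rewrite !mxE eqxx /=; case: eqVneq => [->|_].
  by rewrite mulr1 addrC subrK.
by rewrite mulr0 addr0.
Qed.

Lemma replace_same u z : replace u z 0 k = z.
Proof. by rewrite replaceE eqxx. Qed.

Lemma replace_replace u z w : replace (replace u z) w = replace u w.
Proof. by apply/rowP => j; rewrite !replaceE; case: eqP. Qed.

Lemma replace_id u : replace u (u 0 k) = u.
Proof. by apply/rowP => j; rewrite !replaceE; case: eqP => // ->. Qed.

End Replace.

Section Division.
Context {R : realType} {K : numFieldType} (X : complex_field R K).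

Local Notation rc := (of_real X).
Local Notation cint := (cint X).
Local Notation circle := (circle X).

(** The setting of Cauchy's formula in the coordinate k, on a polydisc of radius
    r centred on the hyperplane where that coordinate vanishes. The ball that S
    is asked to contain is larger, so that S also contains the points of the
    boundary circles. *)
Section Cauchy.
Context {m : nat} (k : 'I_m) (S : set 'rV[K]_m) (x : 'rV[K]_m) (r : R).
Hypotheses (oS : open S) (r0 : 0 < r) (xk : x 0 k = 0).
Hypothesis xS : ball x (rc (r + r)) `<=` S.

Local Notation V := (ball x (rc r)).
Local Notation z_ t := (rc r * circle t).

Let rc0 : 0 < rc r. Proof. by rewrite -(rmorph0 rc) ltr_of_real. Qed.

Let VS u z : V u -> `|z| <= rc r -> S (replace k u z).
Proof.
rewrite -ball_normE /= => Vu zr; apply: xS; rewrite -ball_normE /=.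
apply: (@le_lt_trans _ _ (rc r)); last by rewrite rmorphD ltrDr.
apply: rv_norm_le => [|j]; first exact: ltW.
have -> : (x - replace k u z) 0 j = x 0 j - replace k u z 0 j.
  by rewrite mxE mxE.
rewrite replaceE; case: eqP => [->|_]; first by rewrite xk sub0r normrN.
by have := coord_norm_le (x - u) j; rewrite !mxE => /le_trans; apply; exact: ltW.
Qed.

Let norm_z t : `|z_ t| = rc r.
Proof. by rewrite normrM norm_circle mulr1 norm_of_real gtr0_norm. Qed.

Let norm_coord u : V u -> `|u 0 k| < rc r.
Proof.
rewrite -ball_normE /= => Vu; apply: le_lt_trans Vu.
by have := coord_norm_le (x - u) k; rewrite !mxE xk sub0r normrN.
Qed.

Let z_neq u t : V u -> z_ t - u 0 k != 0.
Proof.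
move=> Vu; rewrite subr_eq0; apply/eqP => e.
by have := norm_coord Vu; rewrite -e norm_z ltxx.
Qed.

Let z_cont : cont01 (fun t => z_ t).
Proof. by apply: cont01M; [exact: cont01_cst|exact: circle_cont]. Qed.

Let cint_z : cint (fun t => z_ t) = 0.
Proof.
have cs : cont01 (fun t => circle_speed X * circle t).
  by apply: cont01M; [exact: cont01_cst|exact: circle_cont].
have := cint_FTC cs (@circle_velocity _ _ X).
rewrite circle_loop subrr (cintZ X _ (@circle_cont _ _ X)) => /eqP.
rewrite mulf_eq0 (negbTE (circle_speed_neq0 X)) /= => /eqP e.
by rewrite (cintZ X _ (@circle_cont _ _ X)) e mulr0.
Qed.

(* The closed disc is convex. *)
Let seg_in u (s t : R) : V u -> 0 <= s <= 1 ->
  S (u + (rc s * (z_ t - u 0 k)) *: evec k).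
Proof.
move=> Vu /andP[s0 s1].
rewrite -[rc s * _](addrK (u 0 k)) [rc s * _ + _]addrC.
apply: (@VS u (u 0 k + rc s * (z_ t - u 0 k))) => //.
rewrite (_ : _ + _ = (1 - rc s) * u 0 k + rc s * z_ t); last by ring.
rewrite (le_trans (ler_normD _ _))//.
rewrite (normrM (1 - _)) (normrM _ (z_ t)) norm_z.
rewrite -(rmorph1 rc) -rmorphB !norm_of_real (ger0_norm s0).
rewrite (@ger0_norm _ (1 - s)) ?subr_ge0//.
rewrite [leRHS](_ : _ = rc (1 - s) * rc r + rc s * rc r); last first.
  by rewrite -mulrDl -rmorphD subrK rmorph1 mul1r.
rewrite lerD// ler_wpM2l//; first by apply: ge0_of_real; rewrite subr_ge0.
exact: ltW (norm_coord Vu).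
Qed.

(** The integral of the derivative of g around the circle shrunk towards
    u 0 k by the factor s vanishes, as the circle is closed. *)
Let derivative_integral u g (s : R) : V u -> holo S g -> 0 <= s <= 1 ->
  cint (fun t =>
    'd g (u + (rc s * (z_ t - u 0 k)) *: evec k) (evec k) * z_ t) = 0.
Proof.
move=> Vu hg s01; set a := u 0 k.
have [->|s0] := eqVneq s 0.
  rewrite rmorph0; under [X in cint X]eq_fun do rewrite mul0r scale0r addr0.
  by rewrite cintZ// cint_z mulr0.
have vel := @line_velocity _ _ X _ u (evec k) (rc s * rc r) (rc s * a).
have cE t : u + (rc s * rc r * circle t - rc s * a) *: evec k =
    u + (rc s * (z_ t - a)) *: evec k.
  by congr (_ + _ *: _); ring.
have cc' : cont01 (fun t =>
    (rc s * rc r * (circle_speed X * circle t)) *: evec k : 'rV[K]_m).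
  move=> t t01; apply: cvgZr_tmp.
  apply: (cont01M _ _ t01); first exact: cont01_cst.
  by apply: cont01M; [exact: cont01_cst|exact: circle_cont].
have inS t : 0 <= t <= 1 ->
    S (u + (rc s * rc r * circle t - rc s * a) *: evec k).
  by move=> _; rewrite cE; exact: seg_in.
have [_] := cint_path hg vel cc' inS.
rewrite circle_loop subrr.
have -> : (fun t => 'd g (u + (rc s * rc r * circle t - rc s * a) *: evec k)
      ((rc s * rc r * (circle_speed X * circle t)) *: evec k)) =
    fun t => rc s * circle_speed X *
      ('d g (u + (rc s * (z_ t - a)) *: evec k) (evec k) * z_ t).
  by apply/funext => t; rewrite cE diff_scale; ring.
rewrite cintZ.
  move=> /eqP; rewrite mulf_eq0 mulf_eq0 fmorph_eq0 (negbTE s0).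
  by rewrite (negbTE (circle_speed_neq0 X)) /= => /eqP.
apply: cont01M => // t t01.
apply: (@continuous_comp _ _ _
  (fun t => u + (rc s * (z_ t - a)) *: evec k) (fun y => 'd g y (evec k))).
  have := velocity_continuous vel t01.
  by have -> : (fun t => u + (rc s * rc r * circle t - rc s * a) *: evec k) =
    (fun t => u + (rc s * (z_ t - a)) *: evec k) by apply/funext.
exact: ((hg _ (@seg_in u s t Vu s01)).2 (evec k)).
Qed.

Let ratio_cont u : V u -> cont01 (fun t => z_ t / (z_ t - u 0 k)).
Proof.
move=> Vu t t01; apply: cvgM; first exact: z_cont.
apply: cvgV; first exact: z_neq.
by apply: cvgB; [exact: z_cont|exact: cvg_cst].
Qed.

Let along_cont u g (s : R) : V u -> holo S g -> 0 <= s <= 1 ->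
  cont01 (fun t => g (u + (rc s * (z_ t - u 0 k)) *: evec k)).
Proof.
move=> Vu hg s01 t t01.
apply: (@continuous_comp _ _ _
  (fun t => u + (rc s * (z_ t - u 0 k)) *: evec k) g); last first.
  exact: (holo_continuous hg (@seg_in u s t Vu s01)).
have := velocity_continuous
  (@line_velocity _ _ X _ u (evec k) (rc s * rc r) (rc s * u 0 k)) t01.
have -> // : (fun t => u + (rc s * rc r * circle t - rc s * u 0 k) *: evec k) =
  (fun t => u + (rc s * (z_ t - u 0 k)) *: evec k).
by apply/funext => t'; congr (_ + _ *: _); ring.
Qed.

(** The circle being shrunk to the point u 0 k, the integral does not depend on
    the factor, and it vanishes when the factor is 0. *)
Let cauchy_difference u g : V u -> holo S g ->
  cint (fun t => (g (replace k u (z_ t)) - g u) * (z_ t / (z_ t - u 0 k))) = 0.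
Proof.
move=> Vu hg; set a := u 0 k.
pose w0 (w : 'rV[K]_(1 + 1)) := w 0 (lshift 1 0).
pose w1 (w : 'rV[K]_(1 + 1)) := w 0 (rshift 1 0).
pose P w := u + (w1 w * (w0 w - a)) *: evec k.
pose W := [set w | w0 w - a != 0] `&` P @^-1` S.
pose G w := (g (P w) - g u) * (w0 w / (w0 w - a)).
have pw0 : polyfun w0 by exact: polyfun_coord.
have pw1 : polyfun w1 by exact: polyfun_coord.
have pwa : polyfun (fun w => w0 w - a).
  by apply: (@polyfunB _ _ w0 (fun=> a)); [exact: pw0|exact: polyfun_cst].
have pP j : polyfun (fun w => P w 0 j).
  have -> : (fun w => P w 0 j) =
      fun w => u 0 j + (w1 w * (w0 w - a)) * (evec k : 'rV[K]_m) 0 j.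
    by apply/funext => w; rewrite mxE; congr (_ + _); rewrite mxE.
  apply: (@polyfunD _ _ (fun=> u 0 j)); first exact: polyfun_cst.
  apply: (@polyfunM _ _ (fun w => w1 w * (w0 w - a)) (fun=> _ 0 j)).
    exact: (polyfunM pw1 pwa).
  exact: polyfun_cst.
have oN : open [set w | w0 w - a != 0].
  apply: open_neq0 => w; apply: differentiable_continuous.
  exact: (polyfun_differentiable w pwa).
have oW : open W.
  by apply: open_preimage => // w _; exact: polymap_continuous.
have hG : holo W G.
  apply: (holoM oW).
    apply: (holoB oW); last exact: holo_cst.
    by apply: (holo_comp oW _ _ hg) => [w []//|j]; exact: (polyfun_holo oW (pP j)).
  by apply: (holo_div oW) => [||w []//]; exact: polyfun_holo.
pose one : 'rV[K]_1 := const_mx 1.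
have PE z y : P (join z y) = u + (y 0 0 * (z - a)) *: evec k.
  by rewrite /P /w0 /w1 join0 joinS.
pose y_ s := 0 + rc s *: one : 'rV[K]_1.
have yE s : y_ s 0 0 = rc s by rewrite !mxE add0r mulr1.
pose S' := [set y : 'rV[K]_1 | forall t : R, 0 <= t <= 1 -> W (join (z_ t) y)].
have oS' : open S' by exact: tube_open.
have S'y s : 0 <= s <= 1 -> S' (y_ s).
  move=> s01 t t01; split; first by rewrite /= /w0 join0; exact: z_neq.
  by rewrite /= PE yE; exact: seg_in.
have [hF dF] := cint_holo X hG z_cont oS' (fun t y t01 Sy => Sy t t01).
have dF0 s : 0 <= s <= 1 ->
    'd (fun y => cint (fun t => G (join (z_ t) y))) (y_ s) one = 0.
  move=> s01; rewrite (dF _ _ (S'y s s01)).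
  rewrite -[RHS](derivative_integral Vu hg s01); apply: cint_ext => t t01.
  pose q := z_ t / (z_ t - a).
  have dg := (hg _ (@seg_in u s t Vu s01)).1.
  have dq : differentiable (fun z => (g z - g u) * q)
      (u + (rc s * (z_ t - u 0 k)) *: evec k).
    apply: differentiableM; last exact: differentiable_cst.
    by apply: differentiableB; [exact: dg|exact: differentiable_cst].
  rewrite (@diff_line _ _ _ G (fun z => (g z - g u) * q) _ (join 0 one)
    (u + (rc s * (z_ t - u 0 k)) *: evec k) ((z_ t - u 0 k) *: evec k)) //.
  - rewrite (diff_subM _ _ _ dg) diff_scale /q /a.
    have alg (z b D : K) : z - b != 0 -> (z - b) * D * (z / (z - b)) = D * z.
      by move=> zb; field.
    exact: (alg _ _ _ (z_neq t Vu)).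
  - exact: (hG _ (S'y s s01 t t01)).1.
  - move=> h; rewrite -joinZ mulr0 -joinD add0r /G PE /w0 join0.
    have -> : (h *: one + y_ s) 0 0 = h + rc s.
      by rewrite mxE yE 2!mxE mulr1.
    rewrite /q /a; congr ((g _ - _) * _).
    by rewrite addrCA scalerA -scalerDl mulrDl.
have vy : has_velocity X y_ (fun=> one) by exact: segment_velocity.
have [_ ] := cint_path hF vy (@cont01_cst _ _ _) S'y.
rewrite (cint_ext X (G := fun=> 0)) ?cint_cst; last first.
  by move=> s s01; exact: dF0.
have F0 : cint (fun t => G (join (z_ t) (y_ 0))) = 0.
  rewrite -[RHS](cint_cst X); apply: cint_ext => t t01.
  by rewrite /G PE yE rmorph0 mul0r scale0r addr0 subrr mul0r.
rewrite F0 subr0 => F1; rewrite [RHS]F1; apply: cint_ext => t t01.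
by rewrite /G PE yE rmorph1 mul1r /w0 join0.
Qed.

(** Cauchy's integral of g(z) / z in the coordinate k, since
    dt = dz / (2 i pi z) along the circle. *)
Definition cauchy_transform (g : 'rV[K]_m -> K) (u : 'rV[K]_m) : K :=
  cint (fun t => g (replace k u (z_ t)) / (z_ t - u 0 k)).

(** The integrand is holomorphic in the point and the variable z jointly, where
    z differs from the k-th coordinate. *)
Lemma cauchy_transform_holo g : holo S g -> holo V (cauchy_transform g).
Proof.
move=> hg.
pose w0 (w : 'rV[K]_(1 + m)) := w 0 (lshift m 0).
pose P (w : 'rV[K]_(1 + m)) := replace k (rsubmx w) (w0 w).
pose W := [set w : 'rV[K]_(1 + m) | w0 w - w 0 (rshift 1 k) != 0] `&` P @^-1` S.
have pwk : polyfun (fun w : 'rV[K]_(1 + m) => w0 w - w 0 (rshift 1 k)).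
  exact: (polyfunB (polyfun_coord (lshift m 0)) (polyfun_coord (rshift 1 k))).
have pP j : polyfun (fun w => P w 0 j).
  under eq_fun do rewrite replaceE mxE.
  by case: eqP => _; exact: polyfun_coord.
have oN : open [set w : 'rV[K]_(1 + m) | w0 w - w 0 (rshift 1 k) != 0].
  apply: open_neq0 => w; apply: differentiable_continuous.
  exact: (polyfun_differentiable w pwk).
have oW : open W.
  by apply: open_preimage => // w _; exact: polymap_continuous.
have hG : holo W (fun w => g (P w) / (w0 w - w 0 (rshift 1 k))).
  apply: (holo_div oW) => [||w []//]; last exact: polyfun_holo.
  by apply: (holo_comp oW _ _ hg) => [w []//|j]; exact: (polyfun_holo oW (pP j)).
have PE z u : P (join z u) = replace k u z by rewrite /P row_mxKr /w0 join0.
have VW (t : R) u : 0 <= t <= 1 -> V u -> W (join (z_ t) u).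
  move=> _ Vu; split; first by rewrite /= /w0 join0 joinS; exact: z_neq.
  by rewrite /= PE; apply: VS => //; rewrite norm_z.
have oV : open V by exact: ball_open.
have [hF _] := cint_holo X hG z_cont oV VW.
apply: (holo_ext oV _ hF) => u Vu; apply: cint_ext => t t01.
by rewrite PE /w0 join0 joinS.
Qed.

Let transform_cont g u : V u -> holo S g ->
  cont01 (fun t => g (replace k u (z_ t))).
Proof.
move=> Vu hg; have h1 : 0 <= (1 : R) <= 1 by rewrite lexx ler01.
have := along_cont Vu hg h1; rewrite rmorph1.
by have -> : (fun t => g (u + (1 * (z_ t - u 0 k)) *: evec k)) =
  (fun t => g (replace k u (z_ t))) by apply/funext => t; rewrite mul1r.
Qed.

(** By [cauchy_difference], g u times the integral of z / (z - u_k) is that of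
    g(z) z / (z - u_k), that is, of g(z) + u_k g(z) / (z - u_k); and g(z) has
    mean value 0. *)
Lemma cauchy_transformE g u : V u -> holo S g ->
  (forall y, S y -> y 0 k = 0 -> g y = 0) ->
  g u * cauchy_transform (fun y => y 0 k) u = u 0 k * cauchy_transform g u.
Proof.
move=> Vu hg g0.
have V0 : V (replace k u 0).
  move: Vu; rewrite -!ball_normE /= => Vu; apply: le_lt_trans Vu.
  apply: rv_norm_le => // j.
  have -> : (x - replace k u 0) 0 j = x 0 j - replace k u 0 0 j.
    by rewrite mxE mxE.
  rewrite replaceE; case: eqP => [->|_]; first by rewrite xk subr0 normr0.
  by have := coord_norm_le (x - u) j; rewrite !mxE.
have S0 : S (replace k u 0) by apply: (VS Vu); rewrite normr0 ltW.
(* The mean value property at the point where the k-th coordinate vanishes. *)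
have mean : cint (fun t => g (replace k u (z_ t))) = 0.
  rewrite -[RHS](cauchy_difference V0 hg); apply: cint_ext => t t01.
  rewrite replace_replace replace_same subr0 (g0 _ S0) ?replace_same// subr0.
  have := z_neq t V0; rewrite replace_same subr0 => z0.
  by rewrite divff ?mulr1.
have cg := transform_cont Vu hg.
have cr := ratio_cont Vu.
have ci : cont01 (fun t => (z_ t - u 0 k)^-1).
  move=> t t01; apply: cvgV; first exact: z_neq.
  by apply: cvgB; [exact: z_cont|exact: cvg_cst].
have := cauchy_difference Vu hg.
have -> : (fun t => (g (replace k u (z_ t)) - g u) * (z_ t / (z_ t - u 0 k))) =
    fun t => (g (replace k u (z_ t)) +
      u 0 k * (g (replace k u (z_ t)) / (z_ t - u 0 k))) -
      g u * (replace k u (z_ t) 0 k / (z_ t - u 0 k)).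
  apply/funext => t; rewrite replace_same.
  have := z_neq t Vu; move: (z_ t) (g _) (g u) (u 0 k) => z b c a za.
  by field.
have c1 := cont01M cg ci.
have c2 := cont01M (@cont01_cst _ _ (u 0 k)) c1.
have c3 : cont01 (fun t => replace k u (z_ t) 0 k / (z_ t - u 0 k)).
  by under eq_fun do rewrite replace_same.
have c4 := cont01M (@cont01_cst _ _ (g u)) c3.
rewrite (cintB X (cont01D cg c2) c4) (cintD X cg c2) mean add0r.
rewrite (cintZ X _ c1) (cintZ X _ c3) => /eqP.
by rewrite subr_eq0 => /eqP.
Qed.

Lemma cauchy_transform_coord : cauchy_transform (fun y => y 0 k) x = 1.
Proof.
have Vx : V x by exact: ballxx.
rewrite -[RHS](cint_cst X); apply: cint_ext => t t01.
have := z_neq t Vx; rewrite replace_same xk subr0 => z0.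
by rewrite divff.
Qed.

End Cauchy.

(** The quotient is that of the Cauchy transforms of g and of the coordinate.
    The latter is constant, but it is enough to know that it is 1 at x: by
    continuity it does not vanish nearby. *)
Lemma holo_division m (k : 'I_m) (S : set 'rV[K]_m) (g : 'rV[K]_m -> K) x :
  open S -> holo S g -> (forall y, S y -> y 0 k = 0 -> g y = 0) ->
  S x -> x 0 k = 0 ->
  exists V h, [/\ open V, V x, V `<=` S, holo V h &
    forall y, V y -> g y = y 0 k * h y].
Proof.
move=> oS hg g0 Sx xk.
have [e /= e0 xeS] := iffLR (nbhs_ballP x S) (open_nbhs_nbhs (conj oS Sx)).
have [r r0 eE] := pos_of_real X e0.
have r2 : 0 < r / 2 by rewrite divr_gt0.
have xS : ball x (rc (r / 2 + r / 2)) `<=` S by rewrite -splitr -eE.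
set V := ball x (rc (r / 2)).
have oV : open V by exact: ball_open.
have Vx : V x by apply: ballxx; rewrite -(rmorph0 rc) ltr_of_real.
pose T := cauchy_transform k (r / 2).
have hc : holo S (fun y => y 0 k) by exact: holo_coord.
have hT := cauchy_transform_holo oS r2 xk xS hg.
have hTc := cauchy_transform_holo oS r2 xk xS hc.
have oV' : open (V `&` [set y | T (fun y => y 0 k) y != 0]).
  rewrite openE => y [Vy Ty].
  have nV := open_nbhs_nbhs (conj oV Vy).
  have oN : open [set z : K | z != 0] by exact: (open_neq0 (fun z => cvg_id)).
  have nT := holo_continuous hTc Vy (open_nbhs_nbhs (conj oN Ty)).
  exact: (@filterI _ (nbhs y) (nbhs_filter y) _ _ nV nT).
exists (V `&` [set y | T (fun y => y 0 k) y != 0]).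
exists (fun y => T g y / T (fun y => y 0 k) y); split=> //.
- by split=> //=; rewrite /T cauchy_transform_coord ?oner_neq0.
- move=> y [Vy _]; apply: xS; apply: le_ball Vy.
  by rewrite ler_of_real lerDl ltW.
- apply: (holo_div oV') => [||y []//].
    by apply: subholo hT => y [].
  by apply: subholo hTc => y [].
- move=> y [Vy Ty]; apply: (mulIf Ty); rewrite -[RHS]mulrA divfK//.
  exact: (cauchy_transformE oS r2 xk xS Vy hg g0).
Qed.

End Division.

(** * Charts, local coordinates and tangent fields *)

Section ManifoldCharts.
Context {K : numFieldType} {m : nat} (M : cmanifold K m).
Implicit Types (U V : set M) (c i j : chart M).

Lemma mopen_dom c : mopen (dom c : set M).
Proof. by move=> j; rewrite setIC; exact: crd_open. Qed.

Lemma mopen_setT : mopen (setT : set M).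
Proof.
move=> j; rewrite setTI; have := crd_open M j j.
by rewrite setIid.
Qed.

Lemma mopen_chart c (W : set 'rV[K]_m) : open W ->
  mopen [set y | dom c y /\ W (crd c y)].
Proof.
move=> oW j; rewrite (_ : _ @` _ =
    (crd j @` (dom j `&` dom c)) `&` (crd c \o par j) @^-1` W).
  apply: open_preimage => // [|w /set_mem Sw]; first exact: crd_open.
  exact: (holo_map_continuous (crd_holo M j c) Sw).
apply/seteqP; split=> [_ [y [[cy Wy] jy] <-]|_ [[y [jy cy] <-] /= Wy]].
  by split; [exists y|rewrite /= crdK].
by exists y => //; split=> //; split=> //; rewrite crdK in Wy.
Qed.

Lemma transition_holo c j V : V `<=` dom c ->
  holo_map (crd j @` (V `&` dom j)) (crd c \o par j).
Proof.
move=> Vc k; apply: subholo (crd_holo M j c k) => _ [y [Vy jy] <-].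
by exists y => //; split=> //; exact: Vc.
Qed.

Lemma transition_diff c j y : dom c y -> dom j y ->
  differentiable (crd c \o par j) (crd j y).
Proof.
move=> cy jy; apply: (holo_map_diff (crd_holo M j c) _).1.
by exists y.
Qed.

Lemma mholo_chart c V (phi : 'rV[K]_m -> K) : mopen V -> V `<=` dom c ->
  holo (crd c @` V) phi -> mholo V (fun y => phi (crd c y)).
Proof.
move=> oV Vc hphi j.
apply: (@holo_comp _ _ _ _ (crd c @` V) (crd c \o par j) phi (oV j)).
- by move=> _ [y [Vy jy] <-]; exists y => //; rewrite /= crdK.
- exact: transition_holo.
- exact: hphi.
Qed.

Lemma mholo_section c U V (v : vfield M) k : tangent U v -> mopen V ->
  V `<=` U -> V `<=` dom c -> mholo V (fun y => v c (par c (crd c y)) 0 k).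
Proof.
move=> [hv _] oV VU Vc.
apply: (@mholo_chart c V (fun w => v c (par c w) 0 k) oV Vc).
apply: subholo (hv c k) => _ [y Vy <-].
by exists y => //; split; [exact: VU|exact: Vc].
Qed.

(** A polynomial automorphism of the space of a chart gives local
    coordinates. *)
Lemma chart_local_coords c V x (Th Th' : 'rV[K]_m -> 'rV[K]_m) :
  mopen V -> V x -> V `<=` dom c ->
  (forall k, polyfun (fun w => Th w 0 k)) ->
  (forall k, polyfun (fun w => Th' w 0 k)) ->
  cancel Th Th' -> cancel Th' Th -> Th (crd c x) = 0 ->
  local_coords x V (fun y => Th (crd c y)).
Proof.
move=> oV Vx Vc pTh pTh' ThK Th'K Thx.
split=> // [k|].
  apply: (mholo_chart (phi := fun w => Th w 0 k) oV Vc).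
  by apply: subholo (polyfun_holo openT (pTh k)).
exists (par c \o Th') => [y Vy|j]; first by rewrite /= ThK crdK//; exact: Vc.
have oVj : mopen (V `&` dom j) by apply: mopenI => //; exact: mopen_dom.
have imE : (fun y => Th (crd c y)) @` (V `&` dom j) =
    setT `&` Th' @^-1` (crd c @` ((V `&` dom j) `&` dom c)).
  apply/seteqP; split=> [_ [y [Vy jy] <-]|u [_ /= [y [[Vy jy] cy] yu]]].
    by split=> //=; rewrite ThK; exists y => //; split=> //; exact: Vc.
  by exists y => //; rewrite yu Th'K.
have oI : open ((fun y => Th (crd c y)) @` (V `&` dom j)).
  rewrite imE; apply: (open_preimage openT (oVj c)) => u _.
  exact: polymap_continuous.
split=> // k.
apply: (@holo_comp _ _ _ _ (crd c @` (dom c `&` dom j)) Th'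
  (fun w => crd j (par c w) 0 k) oI).
- move=> _ [y [Vy jy] <-]; rewrite ThK; exists y => //.
  by split=> //; exact: Vc.
- by move=> l; exact: (polyfun_holo oI (pTh' l)).
- exact: crd_holo.
Qed.

(** The components of a tangent field change with the differential of the
    transition, which the chain rule absorbs. *)
Lemma tangent_push U (v : vfield M) c j y p (Th : 'rV[K]_m -> 'rV[K]_p) :
  tangent U v -> U y -> dom c y -> dom j y -> differentiable Th (crd c y) ->
  'd ((fun z => Th (crd c z)) \o par j) (crd j y) (v j y) =
  'd Th (crd c y) (v c y).
Proof.
move=> [_ tv] Uy cy jy dTh.
have cjy : (crd c \o par j) (crd j y) = crd c y by rewrite /= crdK.
have dC := transition_diff cy jy.
have dTh' : differentiable Th ((crd c \o par j) (crd j y)) by rewrite cjy.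
have dE := diff_comp dC dTh'; rewrite cjy in dE.
rewrite (tv j c y Uy jy cy).
exact: (congr1 (fun f => f (v j y)) dE).
Qed.

End ManifoldCharts.

(** * Vector fields on a product of projective spaces, from homogeneous ones *)

Section Cone.
Context {K : numFieldType} {p q : nat}.

Local Notation M := (prod_cmanifold (Pspace K p) (Pspace K q)).
Local Notation E := 'rV[K]_(p + q).
Local Notation A := 'rV[K]_(p.-1 + q.-1).
Implicit Types (c : chart M) (x : M) (e u : E) (w : A).

Definition homs x : E := row_mx (homog x.1) (homog x.2).

(** The j-th coordinate in the chart c is the quotient of the homogeneous
    coordinates of indices [num c j] and [den c j]. *)
Definition num c (j : 'I_(p.-1 + q.-1)) : 'I_(p + q) :=
  match fintype.split j with
  | inl a => lshift q (lift c.1 a)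
  | inr b => rshift p (lift c.2 b)
  end.

Definition den c (j : 'I_(p.-1 + q.-1)) : 'I_(p + q) :=
  match fintype.split j with
  | inl _ => lshift q c.1
  | inr _ => rshift p c.2
  end.

Definition dehom c e : A := \row_j (e 0 (num c j) / e 0 (den c j)).

Definition rehom c w : E :=
  row_mx (affine c.1 (lsubmx w)) (affine c.2 (rsubmx w)).

(** The two rescalings of the product of the cones, whose quotient is the
    product of the projective spaces. *)
Definition rescale (s t : K) e : E := row_mx (s *: lsubmx e) (t *: rsubmx e).

Definition factor (s t : K) (k : 'I_(p + q)) :=
  if fintype.split k is inl _ then s else t.

Lemma factor_lshift s t a : factor s t (lshift q a) = s.
Proof. by rewrite /factor (unsplitK (inl a)). Qed.

Lemma factor_rshift s t b : factor s t (rshift p b) = t.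
Proof. by rewrite /factor (unsplitK (inr b)). Qed.

Lemma rescaleE s t e k : rescale s t e 0 k = factor s t k * e 0 k.
Proof.
by case: (split_ordP k) => a ->;
  rewrite ?factor_lshift ?factor_rshift ?row_mxEl ?row_mxEr 2!mxE.
Qed.

Lemma factor_num s t c j : factor s t (num c j) = factor s t (den c j).
Proof.
by rewrite /num /den; case: (fintype.split j) => a;
  rewrite ?factor_lshift ?factor_rshift.
Qed.

Definition nz c e := e 0 (lshift q c.1) != 0 /\ e 0 (rshift p c.2) != 0.

Lemma nz_den c e j : nz c e -> e 0 (den c j) != 0.
Proof. by rewrite /den; case: (fintype.split j) => a []. Qed.

Lemma dom_nz c x : dom c x <-> nz c (homs x).
Proof. rewrite /nz /homs row_mxEl row_mxEr; exact: iff_refl. Qed.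

Lemma crd_dehom c x : crd c x = dehom c (homs x).
Proof.
apply/rowP => j; rewrite [RHS]mxE /num /den [LHS]mxE.
by case: (fintype.split j) => a; rewrite ?row_mxEl ?row_mxEr mxE.
Qed.

Lemma rehom_num c w j : rehom c w 0 (num c j) = w 0 j.
Proof.
rewrite /num -[in RHS](splitK j); case: (fintype.split j) => a.
  by rewrite row_mxEl mxE liftK mxE.
by rewrite row_mxEr mxE liftK mxE.
Qed.

Lemma rehom_chartl c w : rehom c w 0 (lshift q c.1) = 1.
Proof. by rewrite row_mxEl mxE unlift_none. Qed.

Lemma rehom_chartr c w : rehom c w 0 (rshift p c.2) = 1.
Proof. by rewrite row_mxEr mxE unlift_none. Qed.

Lemma rehom_den c w j : rehom c w 0 (den c j) = 1.
Proof.
rewrite /den; case: (fintype.split j) => a;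
  by rewrite ?rehom_chartl ?rehom_chartr.
Qed.

(* A homogeneous coordinate is one of the two that equal 1 in the chart c, or
   one of the coordinates of the chart. *)
Lemma num_cover c (P : 'I_(p + q) -> Prop) :
  P (lshift q c.1) -> P (rshift p c.2) -> (forall j, P (num c j)) ->
  forall k, P k.
Proof.
move=> Pl Pr Pn k; case: (split_ordP k) => a ->.
  case: (unliftP c.1 a) => [b ->|-> //].
  by have := Pn (lshift _ b); rewrite /num (unsplitK (inl b)).
case: (unliftP c.2 a) => [b ->|-> //].
by have := Pn (rshift _ b); rewrite /num (unsplitK (inr b)).
Qed.

Lemma polyfun_rehom c k : polyfun (fun w => rehom c w 0 k).
Proof.
elim/(num_cover (c := c)): k => [||j].
- by under eq_fun do rewrite rehom_chartl; exact: polyfun_cst.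
- by under eq_fun do rewrite rehom_chartr; exact: polyfun_cst.
- by under eq_fun do rewrite rehom_num; exact: polyfun_coord.
Qed.

Lemma dehomK c e : nz c e ->
  rehom c (dehom c e) =
  rescale (e 0 (lshift q c.1))^-1 (e 0 (rshift p c.2))^-1 e.
Proof.
move=> [nl nr]; apply/rowP; apply: (num_cover (c := c)) => [||j].
- by rewrite rehom_chartl rescaleE factor_lshift mulVf.
- by rewrite rehom_chartr rescaleE factor_rshift mulVf.
- rewrite rehom_num rescaleE mxE mulrC factor_num; congr (_ * _).
  by rewrite /den; case: (fintype.split j) => a;
    rewrite ?factor_lshift ?factor_rshift.
Qed.

Lemma rehomK c w : dehom c (rehom c w) = w.
Proof. by apply/rowP => j; rewrite mxE rehom_num rehom_den divr1. Qed.

Lemma factor_neq0 s t k : s != 0 -> t != 0 -> factor s t k != 0.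
Proof. by rewrite /factor; case: (fintype.split k). Qed.

Lemma dehom_rescale c s t e : s != 0 -> t != 0 ->
  dehom c (rescale s t e) = dehom c e.
Proof.
move=> s0 t0; apply/rowP => j; rewrite [LHS]mxE [RHS]mxE !rescaleE factor_num.
by rewrite -mulf_div divff ?mul1r// factor_neq0.
Qed.

Lemma homs_par c w : exists s t, [/\ s != 0, t != 0 &
  homs (par c w) = rescale s t (rehom c w)].
Proof.
have [s s0 es] := homog_par c.1 (lsubmx w).
have [t t0 et] := homog_par c.2 (rsubmx w).
by exists s, t; split=> //; rewrite /homs es et /rescale row_mxKl row_mxKr.
Qed.

Lemma crd_par c j w : crd j (par c w) = dehom j (rehom c w).
Proof.
have [s [t [s0 t0 e]]] := homs_par c w.
by rewrite crd_dehom e dehom_rescale.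
Qed.

(** The differential of [dehom c] at e, by the quotient rule. Having it
    explicitly, its behaviour under rescaling and linear combinations becomes
    algebra. *)
Definition dehomD c e u : A :=
  \row_j ((u 0 (num c j) * e 0 (den c j) - e 0 (num c j) * u 0 (den c j)) /
          e 0 (den c j) ^+ 2).

Lemma diff_quotient (m : nat) (a b : 'I_m) (e u : 'rV[K]_m) : e 0 b != 0 ->
  'd (fun y : 'rV[K]_m => y 0 a / y 0 b) e u =
  (u 0 a * e 0 b - e 0 a * u 0 b) / e 0 b ^+ 2.
Proof.
move=> b0.
have da : differentiable (fun y : 'rV[K]_m => y 0 a : K) e.
  exact: differentiable_coord.
have db : differentiable (fun y : 'rV[K]_m => y 0 b : K) e.
  exact: differentiable_coord.
have dV : differentiable (fun y : 'rV[K]_m => (y 0 b)^-1 : K) e.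
  exact: differentiableV.
have dVE : 'd (fun y : 'rV[K]_m => (y 0 b)^-1 : K) e u =
    - e 0 b ^- 2 * u 0 b.
  by rewrite (diffV db b0) -(diff_coord b e u).
rewrite (diff_fM u da dV) dVE diff_coord.
by field.
Qed.

Lemma dehom_diff c e : nz c e -> differentiable (dehom c) e /\
  forall u, 'd (dehom c) e u = dehomD c e u.
Proof.
move=> ce.
have dq k : differentiable (fun y => dehom c y 0 k) e.
  have -> : (fun y => dehom c y 0 k) =
      (fun y => y 0 (num c k)) * (fun y => (y 0 (den c k))^-1).
    by apply/funext => y; rewrite mxE.
  apply: differentiableM; first exact: differentiable_coord.
  by apply: differentiableV; [exact: differentiable_coord|exact: nz_den].
have [dd dE] := differentiable_row dq; split=> // u.
rewrite dE; apply/rowP => k; rewrite !mxE.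
rewrite -(diff_quotient _ _ (nz_den k ce)).
by congr ('d _ _ _); apply/funext => y; rewrite mxE.
Qed.

Lemma dehomD_rescale c s t e u : s != 0 -> t != 0 ->
  dehomD c (rescale s t e) (rescale s t u) = dehomD c e u.
Proof.
move=> s0 t0; apply/rowP => j; rewrite [LHS]mxE [RHS]mxE !rescaleE factor_num.
have alg (f u1 e1 u2 e2 : K) : f != 0 ->
    (f * u1 * (f * e2) - f * e1 * (f * u2)) / (f * e2) ^+ 2 =
    (u1 * e2 - e1 * u2) / e2 ^+ 2.
  move=> f0; rewrite (_ : _ - _ = f ^+ 2 * (u1 * e2 - e1 * u2)); last by ring.
  by rewrite exprMn -mulf_div divff ?mul1r// expf_neq0.
by apply: alg; exact: factor_neq0.
Qed.

Lemma dehomDZ c e a u : dehomD c e (a *: u) = a *: dehomD c e u.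
Proof. by apply/rowP => j; rewrite !mxE; ring. Qed.

Lemma dehomDD c e u v : dehomD c e (u + v) = dehomD c e u + dehomD c e v.
Proof. by apply/rowP => j; rewrite !mxE; ring. Qed.

Lemma dehomD_rehom c w u :
  dehomD c (rehom c w) u =
  \row_j (u 0 (num c j) - w 0 j * u 0 (den c j)).
Proof.
apply/rowP => j; rewrite [LHS]mxE [RHS]mxE rehom_num rehom_den.
by rewrite mulr1 expr1n divr1.
Qed.

Lemma nz_rehom c w : nz c (rehom c w).
Proof. by split; rewrite ?rehom_chartl ?rehom_chartr oner_neq0. Qed.

Lemma open_nz c : open (nz c).
Proof.
have cc k : continuous (fun e : E => e 0 k : K) by exact: coord_continuous.
exact: (openI (open_neq0 (cc _)) (open_neq0 (cc _))).
Qed.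

Lemma nz_rescale c s t e : s != 0 -> t != 0 -> nz c e -> nz c (rescale s t e).
Proof.
by move=> s0 t0 [n1 n2]; split;
  rewrite rescaleE ?factor_lshift ?factor_rshift mulf_neq0.
Qed.

(** The transition after [dehom c] is [dehom j], up to the rescaling that
    [rehom] introduces, so the chain rule applies. It says that projections of a
    field from the cone obey the transformation law of tangent fields. *)
Lemma dehom_transition c j e u : nz c e -> nz j e ->
  'd (fun w => dehom j (rehom c w)) (dehom c e) (dehomD c e u) =
  dehomD j e u.
Proof.
move=> ce je.
have nr : nz j (rehom c (dehom c e)).
  by rewrite dehomK//; case: (ce) => ? ?; apply: nz_rescale => //; rewrite invr_eq0.
have [dc dcE] := dehom_diff ce.
have dr : differentiable (rehom c) (dehom c e).
  by apply: (differentiable_row _).1 => k; exact: polyfun_differentiable (polyfun_rehom c k).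
have dj : differentiable (fun w => dehom j (rehom c w)) (dehom c e).
  by apply: (differentiable_comp dr); exact: (dehom_diff nr).1.
have comp := diff_comp dc dj.
have near_id : \forall y \near e,
    ((fun w => dehom j (rehom c w)) \o dehom c) y = dehom j y.
  have nzn : \forall y \near e, nz c y.
    exact: (open_nbhs_nbhs (conj (@open_nz c) ce)).
  apply: filterS nzn => y cy /=.
  by rewrite dehomK// dehom_rescale ?invr_eq0//; case: cy.
have [_ dE] := near_eq_diff near_id (differentiable_comp dc dj).
have e1 : 'd (dehom j) e u = dehomD j e u := (dehom_diff je).2 u.
have e2 := congr1 (fun f => f u) dE.
have e3 := congr1 (fun f => f u) comp.
exact: (etrans (congr1 _ (esym (dcE u))) (etrans (esym e3) (etrans (esym e2) e1))).
Qed.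

End Cone.

Section Hypersurface.
Context {K : numFieldType} {p q d : nat}.

Local Notation M := (prod_cmanifold (Pspace K p) (Pspace K q)).
Local Notation E := 'rV[K]_(p + q).
Local Notation A := 'rV[K]_(p.-1 + q.-1).
Local Notation L := (pullback_fst (Pspace K q) (O1 K p)).
Implicit Types (c : chart M) (x y : M) (e u : E) (w : A).

Variable F : E -> K.
Hypothesis pF : polyfun F.
Hypothesis F_rescale : forall s t e, F (rescale s t e) = s ^+ d * t * F e.

Definition zeros : set M := [set x | F (homs x) = 0].

(** The homogeneous vector fields that annihilate F; on the product they
    become sections of the logarithmic tangent bundle twisted by O(1,0). *)
Record cone_field (V : E -> E) := ConeField {
  cone_polyfun : forall k, polyfun (fun e => V e 0 k);
  cone_rescale : forall s t e, V (rescale s t e) = s *: rescale s t (V e);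
  cone_tangent : forall e, 'd F e (V e) = 0 }.

(** The choice of homogeneous coordinates does not matter: rescaling them
    multiplies the projection of V by s, by [cone_rescale], which the division
    by the coordinate k compensates; this division is what trivializes the
    twist. *)
Definition descend (V : E -> E) : twisted_vfield L :=
  fun k c x => (homog (x : pspace K p * pspace K q).1 0 k)^-1 *:
    dehomD c (homs x) (V (homs x)).

Definition Fc c w : K := F (rehom c w).

Lemma polyfun_Fc c : polyfun (Fc c).
Proof. exact: (polyfun_comp (G := rehom c) (polyfun_rehom c) pF). Qed.

Lemma F_dehom c e : nz c e ->
  F e = e 0 (lshift q c.1) ^+ d * e 0 (rshift p c.2) * Fc c (dehom c e).
Proof.
move=> ce; case: (ce) => n1 n2.
rewrite /Fc dehomK// F_rescale mulrA exprVn -mulrACA divff ?expf_neq0//.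
by rewrite divff// !mul1r.
Qed.

Lemma zeros_chart c y : dom c y -> zeros y <-> Fc c (crd c y) = 0.
Proof.
move=> /dom_nz cy; rewrite crd_dehom -[zeros y]/(F (homs y) = 0) (F_dehom cy).
case: (cy) => n1 n2; split=> [/eqP|->]; last by rewrite mulr0.
by rewrite !mulf_eq0 expf_eq0 (negbTE n1) (negbTE n2) andbF /= => /eqP.
Qed.

(* The factor between F and its dehomogenized form. *)
Let Q c e : K := e 0 (lshift q c.1) ^+ d * e 0 (rshift p c.2).

Let pQ c : polyfun (Q c).
Proof.
apply: (@polyfunM _ _ (fun e => e 0 (lshift q c.1) ^+ d)
  (fun e => e 0 (rshift p c.2))); last exact: polyfun_coord.
by apply: polyfunX; exact: polyfun_coord.
Qed.

(** The equation of the chart differs from F by the factor Q, and V annihilates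
    F, so it can only multiply the equation of the chart by minus the
    logarithmic derivative of Q. *)
Lemma diff_Fc c w u : 'd F (rehom c w) u = 0 ->
  'd (Fc c) w (dehomD c (rehom c w) u) = - 'd (Q c) (rehom c w) u * Fc c w.
Proof.
set e := rehom c w => dF0; have ce : nz c e by exact: nz_rehom.
have Qe : Q c e = 1 by rewrite /Q rehom_chartl rehom_chartr expr1n mulr1.
have [dd dE] := dehom_diff ce.
have dFc : differentiable (Fc c) (dehom c e).
  exact: (polyfun_differentiable _ (polyfun_Fc c)).
have dC : differentiable (fun y : E => Fc c (dehom c y)) e.
  exact: (differentiable_comp dd dFc).
have dQ : differentiable (Q c) e by exact: (polyfun_differentiable _ (pQ c)).
have nF : \forall y \near e, Q c (y : E) * Fc c (dehom c y) = F y.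
  have nzn : \forall y \near e, nz c (y : E).
    exact: (open_nbhs_nbhs (conj (@open_nz _ _ _ c) ce)).
  by apply: filterS nzn => y cy; rewrite (F_dehom cy).
have dQC : differentiable (fun y : E => Q c y * Fc c (dehom c y)) e.
  exact: (differentiableM dQ dC).
have [_ e1] := near_eq_diff nF dQC.
have e2 := congr1 (fun f => f u) e1.
have e3 := diff_fM u dQ dC.
have e4 := congr1 (fun f => f u) (diff_comp dd dFc).
have e5 : 'd (fun y : E => Fc c (dehom c y)) e u =
    'd (Fc c) w (dehomD c (rehom c w) u).
  by apply: (etrans e4); rewrite /= dE rehomK.
have : 0 = Q c e * 'd (Fc c) w (dehomD c (rehom c w) u) +
    Fc c (dehom c e) * 'd (Q c) e u.
  by rewrite -e5 -dF0 -[LHS]/('d F e u); apply: (etrans e2); exact: e3.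
rewrite Qe mul1r rehomK => /eqP; rewrite eq_sym addr_eq0 => /eqP ->.
by rewrite mulNr mulrC.
Qed.

Lemma descend_par V k c w : cone_field V ->
  descend V k c (par c w) = (rehom c w 0 (lshift q k))^-1 *:
    dehomD c (rehom c w) (V (rehom c w)).
Proof.
move=> hV; have [s [t [s0 t0 e]]] := homs_par c w.
rewrite /descend -(row_mxEl (homog (par c w).1) (homog (par c w).2)).
rewrite -/(homs _) e (cone_rescale hV) dehomDZ dehomD_rescale// scalerA.
by rewrite rescaleE factor_lshift invfM mulrAC mulVf ?mul1r.
Qed.

Lemma descend_compat V a b c x : ldom (l := L) a x -> ldom (l := L) b x ->
  descend V a c x = ltr (l := L) a b x *: descend V b c x.
Proof.
by move=> /= xa xb; rewrite /descend scalerA mulrAC divff ?mul1r.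
Qed.

(** In the chart c the components are quotients of polynomials by the coordinate
    k, and [dehom_transition] gives the transformation law. *)
Lemma descend_tangent V k : cone_field V ->
  tangent (setT `&` ldom (l := L) k) (descend V k).
Proof.
move=> hV; split=> [c j|c j x [_ xk] cx jx].
  have -> : (fun w => (descend V k c \o par c) w 0 j) = fun w =>
      (V (rehom c w) 0 (num c j) - w 0 j * V (rehom c w) 0 (den c j)) /
      rehom c w 0 (lshift q k).
    apply/funext => w; rewrite -[LHS]/(descend V k c (par c w) 0 j).
    by rewrite (descend_par _ _ _ hV) [LHS]mxE dehomD_rehom [X in _ * X]mxE mulrC.
  have pk : polyfun (fun w => rehom c w 0 (lshift q k)).
    exact: polyfun_rehom.
  have oN : open [set w | rehom c w 0 (lshift q k) != 0].
    apply: open_neq0 => w; apply: differentiable_continuous.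
    exact: (polyfun_differentiable w pk).
  apply: (@subholo _ _ _ [set w | rehom c w 0 (lshift q k) != 0]).
    move=> _ [x [[_ xk] cx] <-]; rewrite /mkset crd_dehom dehomK; last exact/dom_nz.
    rewrite rescaleE factor_lshift mulf_neq0 ?invr_eq0//.
      by rewrite row_mxEl; case: cx.
    by rewrite row_mxEl.
  have pV l : polyfun (fun w => V (rehom c w) 0 l).
    exact: (polyfun_comp (polyfun_rehom c) (cone_polyfun hV l)).
  apply: (holo_div oN) => [||w //]; apply: (polyfun_holo oN) => //.
  apply: (polyfunB (pV _)).
  apply: (@polyfunM _ _ (fun w => w 0 j)); [exact: polyfun_coord|exact: pV].
have cn := iffLR (dom_nz _ _) cx; have jn := iffLR (dom_nz _ _) jx.
have -> : crd j \o par c = fun w => dehom j (rehom c w).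
  by apply/funext => w; exact: crd_par.
rewrite crd_dehom /descend linearZ /=; congr (_ *: _).
exact: (esym (dehom_transition _ cn jn)).
Qed.

(** The chart c is good for the coordinate k0 when the equation of the
    hypersurface is affine in it, with leading coefficient 1: it may then be
    taken as a coordinate in place of k0. *)
Definition good_chart c k0 :=
  forall w, Fc c w = w 0 k0 + Fc c (replace k0 w 0).

(** The change of variables that makes the equation a coordinate, polynomial
    with polynomial inverse. *)
Definition straighten c k0 w : A := replace k0 w (Fc c w).

Definition unstraighten c k0 w : A :=
  replace k0 w (w 0 k0 - Fc c (replace k0 w 0)).

Lemma straightenK c k0 : good_chart c k0 ->
  cancel (straighten c k0) (unstraighten c k0).
Proof.
move=> gc w; rewrite /unstraighten replace_same !replace_replace.
by rewrite [X in X - _]gc addrK replace_id.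
Qed.

Lemma Fc_unstraighten c k0 w : good_chart c k0 ->
  Fc c (unstraighten c k0 w) = w 0 k0.
Proof. by move=> gc; rewrite gc replace_same replace_replace subrK. Qed.

Lemma unstraightenK c k0 : good_chart c k0 ->
  cancel (unstraighten c k0) (straighten c k0).
Proof.
move=> gc w; rewrite /straighten (Fc_unstraighten _ gc) replace_replace.
exact: replace_id.
Qed.

Let polyfun_replace (f : A -> K) k0 k :
  polyfun f -> polyfun (fun w => replace k0 w (f w) 0 k).
Proof.
move=> pf; under eq_fun do rewrite replaceE.
by case: eqP => _; [exact: pf|exact: polyfun_coord].
Qed.

Lemma polyfun_straighten c k0 k : polyfun (fun w => straighten c k0 w 0 k).
Proof. by apply: polyfun_replace; exact: polyfun_Fc. Qed.

Lemma polyfun_unstraighten c k0 k : polyfun (fun w => unstraighten c k0 w 0 k).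
Proof.
apply: polyfun_replace; apply: (polyfunB (polyfun_coord k0)).
apply: (polyfun_comp (G := fun w => replace k0 w 0)); last exact: polyfun_Fc.
by move=> l; apply: polyfun_replace; exact: polyfun_cst.
Qed.

Section LogCoordinates.
Variables (c : chart M) (k0 : 'I_(p.-1 + q.-1)) (x : M).
Hypotheses (gc : good_chart c k0) (cx : dom c x) (zx : zeros x).

Let o : 'I_(p.-1 + q.-1) := Ordinal (leq_ltn_trans (leq0n k0) (ltn_ord k0)).
Let swap (w : A) : A := \row_j w 0 (tperm o k0 j).
Let wx := straighten c k0 (crd c x).

(* The divisor is expected to be the zero set of the first coordinates, so the
   index k0 of the equation is exchanged with the first one, o. *)
Let coords w : A := swap (straighten c k0 w - wx).
Let coords_inv w : A := unstraighten c k0 (swap w + wx).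

Let swapK : involutive swap.
Proof. by move=> w; apply/rowP => j; rewrite !mxE tpermK. Qed.

Let coordsK : cancel coords coords_inv.
Proof. by move=> w; rewrite /coords_inv swapK subrK straightenK. Qed.

Let coords_invK : cancel coords_inv coords.
Proof. by move=> w; rewrite /coords unstraightenK// addrK swapK. Qed.

Let coordsE w j : coords w 0 j =
  straighten c k0 w 0 (tperm o k0 j) - wx 0 (tperm o k0 j).
Proof. by rewrite !mxE. Qed.

Let polyfun_coords j : polyfun (fun w => coords w 0 j).
Proof.
under eq_fun do rewrite coordsE.
apply: (@polyfunB _ _ (fun w => straighten c k0 w 0 (tperm o k0 j))
  (fun=> wx 0 (tperm o k0 j))); last exact: polyfun_cst.
exact: polyfun_straighten.
Qed.

Let polyfun_coords_inv j : polyfun (fun w => coords_inv w 0 j).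
Proof.
apply: (polyfun_comp (G := fun w => swap w + wx)
  (f := fun w => unstraighten c k0 w 0 j)); last exact: polyfun_unstraighten.
move=> l; have -> : (fun w => (swap w + wx) 0 l) =
    fun w => w 0 (tperm o k0 l) + wx 0 l by apply/funext => w; rewrite 2!mxE.
apply: (@polyfunD _ _ (fun w => w 0 (tperm o k0 l)) (fun=> wx 0 l)).
  exact: polyfun_coord.
exact: polyfun_cst.
Qed.

Let coords_first w : coords w 0 o = Fc c w.
Proof.
rewrite coordsE tpermL /wx /straighten !replace_same.
by rewrite (iffLR (zeros_chart cx) zx) subr0.
Qed.

Let coords_other w j : j != o ->
  coords w 0 j = w 0 (tperm o k0 j) - wx 0 (tperm o k0 j).
Proof.
move=> jo; rewrite coordsE /straighten replaceE; case: eqP => // e.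
by case/eqP: jo; apply: (@perm_inj _ (tperm o k0)); rewrite e tpermL.
Qed.

Let diff_coords_other w (u : A) j : j != o ->
  'd (fun w => coords w 0 j) w u = u 0 (tperm o k0 j).
Proof.
move=> jo; have -> : (fun w => coords w 0 j) =
    fun w : A => w 0 (tperm o k0 j) + - wx 0 (tperm o k0 j).
  by apply/funext => w'; rewrite coords_other.
have d1 : differentiable (fun w : A => w 0 (tperm o k0 j) : K) w.
  exact: differentiable_coord.
have d2 := differentiable_cst (- wx 0 (tperm o k0 j)) w.
by rewrite (diff_fD u d1 d2) diff_coord diff_fcst addr0.
Qed.

(** In coordinates one of which is the equation, the component of v along it is
    v applied to the equation, hence a multiple of the equation by assumption;
    nothing is asked of the other components. The conclusion is the local
    condition that defines logarithmic fields, with l = 1. *)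
Lemma log_coordinates U (v : vfield M) (g : A -> K) :
  tangent U v -> mopen U -> U x ->
  holo (crd c @` (U `&` dom c)) g ->
  (forall y, U y -> dom c y ->
    'd (Fc c) (crd c y) (v c y) = g (crd c y) * Fc c (crd c y)) ->
  exists V (z : M -> A) l,
    [/\ local_coords x V z, V `<=` U, (l <= p.-1 + q.-1)%N,
      forall y, V y ->
        (zeros y <-> \prod_(k < p.-1 + q.-1 | (k < l)%N) z y 0 k = 0) &
      exists2 f : 'I_(p.-1 + q.-1) -> M -> K, forall k, mholo V (f k) &
        forall i y, V y -> dom i y ->
          'd (z \o par i) (crd i y) (v i y) =
          \row_k (if (k < l)%N then f k y * z y 0 k else f k y)].
Proof.
move=> tv oU Ux hg vF; set V := U `&` dom c.
have oV : mopen V by apply: mopenI => //; exact: mopen_dom.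
have VU : V `<=` U by move=> y [].
have Vc : V `<=` dom c by move=> y [].
have lt1 (k : 'I_(p.-1 + q.-1)) : (k < 1)%N = (k == o).
  by rewrite ltnS leqn0.
exists V, (fun y => coords (crd c y)), 1%N; split => //.
- apply: (chart_local_coords oV _ Vc polyfun_coords polyfun_coords_inv
    coordsK coords_invK) => //.
  by rewrite /coords subrr; apply/rowP => j; rewrite !mxE.
- exact: leq_ltn_trans (leq0n k0) (ltn_ord k0).
- move=> y [_ cy]; rewrite (big_pred1 o) => [|k]; last exact: lt1.
  by rewrite coords_first; exact: zeros_chart.
exists (fun k y => if k == o then g (crd c y)
  else v c (par c (crd c y)) 0 (tperm o k0 k)) => [k|i y [Uy cy] iy].
  case: (k == o); first exact: (mholo_chart oV Vc hg).
  exact: (mholo_section _ tv oV VU Vc).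
have dT : differentiable coords (crd c y) /\ forall u : A,
    'd coords (crd c y) u = \row_k 'd (fun w => coords w 0 k) (crd c y) u.
  by apply: differentiable_row => k; exact: polyfun_differentiable (polyfun_coords k).
rewrite (tangent_push tv Uy cy iy dT.1) dT.2; apply/rowP => k.
rewrite mxE [RHS]mxE lt1; case: eqVneq => [->|ko].
  have -> : (fun w => coords w 0 o) = Fc c by apply/funext => w.
  by rewrite coords_first vF.
by rewrite diff_coords_other// crdK.
Qed.

End LogCoordinates.

Hypothesis good_charts : forall x, zeros x -> exists c k0,
  good_chart c k0 /\ dom c x.

(** [diff_Fc] provides the multiplier of the equation that [log_coordinates]
    asks for. *)
Lemma descend_section V : cone_field V ->
  twisted_log_tangent (L := L) zeros setT (descend V).
Proof.
move=> hV; split=> [k|a b c x _ xa xb _]; last exact: descend_compat.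
have tV := descend_tangent k hV; split=> // x [_ xk] zx.
have [c [k0 [gc cx]]] := good_charts zx.
have oU : mopen (setT `&` ldom (l := L) k).
  by apply: mopenI; [exact: mopen_setT|exact: ldom_open].
pose g w := - 'd (Q c) (rehom c w) (V (rehom c w)) / rehom c w 0 (lshift q k).
apply: (log_coordinates (g := g) gc cx zx tV oU) => // [|y [_ yk] cy].
  have pk : polyfun (fun w => rehom c w 0 (lshift q k)) by exact: polyfun_rehom.
  have oN : open [set w | rehom c w 0 (lshift q k) != 0].
    apply: open_neq0 => w; apply: differentiable_continuous.
    exact: (polyfun_differentiable w pk).
  apply: (@subholo _ _ _ [set w | rehom c w 0 (lshift q k) != 0]).
    move=> _ [y [[_ yk] cy] <-]; rewrite /mkset crd_dehom dehomK; last exact/dom_nz.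
    rewrite rescaleE factor_lshift mulf_neq0 ?invr_eq0//.
      by rewrite row_mxEl; case: cy.
    by rewrite row_mxEl.
  apply: (holo_div oN) => [||w //]; apply: (polyfun_holo oN) => //.
  apply: polyfunN.
  apply: (polyfun_comp (G := rehom c)
    (f := fun e => 'd (Q c) e (V e))); first exact: polyfun_rehom.
  have -> : (fun e => 'd (Q c) e (V e)) =
      fun e => \sum_l V e 0 l * 'd (Q c) e (evec l).
    by apply/funext => e; rewrite diff_sum_coord.
  apply: polyfun_sum => l.
  exact: (polyfunM (cone_polyfun hV l) (polyfun_diff _ (pQ c))).
have dE := descend_par k c (crd c y) hV; rewrite (crdK cy) in dE.
rewrite dE diff_scale.
by rewrite (diff_Fc (cone_tangent hV _)) mulrA [_^-1 * _]mulrC.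
Qed.

End Hypersurface.

(** * Sections of the logarithmic tangent sheaf *)

Lemma diff_near_cst (K : numFieldType) (V : normedModType K) (f : V -> K)
    (a v : V) (l : K) : differentiable f a -> f a = l ->
  (\forall h \near (0 : K), f (h *: v + a) = l) -> 'd f a v = 0.
Proof.
move=> df fa fl; rewrite -(deriveE v df) /derive.
apply: cvg_lim; first exact: norm_hausdorff.
apply: cvg_near_cst; apply: filterS (nbhs_dnbhs fl) => h /= ->.
by rewrite fa subrr scaler0.
Qed.

Lemma line_continuous (K : numFieldType) (V : normedModType K) (a v : V) :
  {for (0 : K), continuous (fun h : K => h *: v + a)}.
Proof.
have FF := nbhs_filter (0 : K).
have cZ := @cvgZr_tmp _ _ _ _ FF _ _ v (@cvg_id _ (nbhs (0 : K))).
have cC : (fun=> a) @ nbhs (0 : K) --> a by exact: cvg_cst.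
exact: (@cvgD _ _ _ _ FF _ _ _ _ cZ cC).
Qed.

Section Generation.
Context {R : realType} {K : numFieldType} (X : complex_field R K).
Context {p q d : nat}.

Local Notation M := (prod_cmanifold (Pspace K p) (Pspace K q)).
Local Notation E := 'rV[K]_(p + q).
Local Notation A := 'rV[K]_(p.-1 + q.-1).
Local Notation L := (pullback_fst (Pspace K q) (O1 K p)).
Implicit Types (c : chart M) (x y : M) (w : A).

Variable F : E -> K.
Hypothesis pF : polyfun F.
Hypothesis F_rescale : forall s t e, F (rescale s t e) = s ^+ d * t * F e.

Local Notation zeros := (zeros F).
Local Notation Fc := (Fc F).

(** In the local coordinates of the definition, some coordinate vanishes at y
    and is constant along the field, so that the line through z y directed by
    the field stays in the hypersurface. *)
Lemma log_field_kills_equation (v : vfield M) c x V (z : M -> A) l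
    (f : 'I_(p.-1 + q.-1) -> M -> K) y :
  local_coords x V z ->
  (forall y, V y ->
    (zeros y <-> \prod_(k < p.-1 + q.-1 | (k < l)%N) z y 0 k = 0)) ->
  (forall i y, V y -> dom i y ->
    'd (z \o par i) (crd i y) (v i y) =
    \row_k (if (k < l)%N then f k y * z y 0 k else f k y)) ->
  V y -> dom c y -> zeros y -> 'd (Fc c) (crd c y) (v c y) = 0.
Proof.
move=> [oV _ _ hz [P PK hP]] zE vE Vy cy zy.
have [oT hT] := hP c; set T := z @` (V `&` dom c) in oT hT.
have Tz y' : V y' -> dom c y' -> T (z y') by move=> Vy' cy'; exists y'.
have /eqP/prodf_eq0[k kl /eqP zk] := iffLR (zE y Vy) zy.
set xi := 'd (z \o par c) (crd c y) (v c y).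
have xik : xi 0 k = 0 by rewrite /xi vE// mxE kl zk mulr0.
have S1 : (crd c @` (V `&` dom c)) (crd c y) by exists y.
have hz1 : holo_map (crd c @` (V `&` dom c)) (z \o par c).
  by move=> j; exact: (hz j c).
have d1 : differentiable (z \o par c) (crd c y).
  exact: (holo_map_diff hz1 S1).1.
have zcy : (z \o par c) (crd c y) = z y := congr1 z (crdK cy).
have d2 : differentiable (crd c \o P) (z y).
  exact: (holo_map_diff hT (Tz y Vy cy)).1.
have d2' : differentiable (crd c \o P) ((z \o par c) (crd c y)) by rewrite zcy.
have nid : \forall w \near crd c y, w = ((crd c \o P) \o (z \o par c)) w.
  have oS1 : open (crd c @` (V `&` dom c)) by exact: oV.
  have nS1 : \forall w \near crd c y, (crd c @` (V `&` dom c)) w.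
    exact: (open_nbhs_nbhs (conj oS1 S1)).
  apply: filterS nS1 => w [y' [Vy' cy'] <-].
  by rewrite -[RHS]/(crd c (P (z (par c (crd c y'))))) crdK// PK.
have lin_id : linear (fun w : A => w) by [].
pose Lid : {linear A -> A} :=
  HB.pack (fun w : A => w) (GRing.isLinear.Build _ _ _ _ _ lin_id).
have cid : continuous Lid by move=> w; exact: cvg_id.
have did : differentiable Lid (crd c y) by exact: linear_differentiable.
have [_ e1] := near_eq_diff (f := Lid) nid did.
have e2 := congr1 (fun f => f (v c y)) e1.
have e3 := congr1 (fun f => f (v c y)) (diff_lin (crd c y) cid).
have e4 := diff_comp d1 d2'; rewrite zcy in e4.
have vxi : 'd (crd c \o P) (z y) xi = v c y.
  exact: (etrans (esym (congr1 (fun f => f (v c y)) e4)) (etrans e2 e3)).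
have dFc : differentiable (Fc c) ((crd c \o P) (z y)).
  exact: (polyfun_differentiable _ (polyfun_Fc pF c)).
have cPz y' : V y' -> (crd c \o P) (z y') = crd c y'.
  by move=> Vy'; exact: (congr1 (crd c) (PK y' Vy')).
have e5 := congr1 (fun f => f xi) (diff_comp d2 dFc).
have zeroT y' : V y' -> dom c y' -> z y' 0 k = 0 ->
    (Fc c \o (crd c \o P)) (z y') = 0.
  move=> Vy' cy' zk'; rewrite -[LHS]/(Fc c ((crd c \o P) (z y'))) (cPz y' Vy').
  apply/(zeros_chart F_rescale cy')/(zE y' Vy')/eqP/prodf_eq0.
  by exists k; [exact: kl|rewrite zk' eqxx].
have e6 : 'd (Fc c \o (crd c \o P)) (z y) xi = 0.
  apply: (diff_near_cst (differentiable_comp d2 dFc) (zeroT y Vy cy zk)).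
  have cl := @line_continuous _ _ (z y) xi.
  have nT : nbhs ((fun h : K => h *: xi + z y) 0) T.
    by rewrite /= scale0r add0r; exact: (open_nbhs_nbhs (conj oT (Tz y Vy cy))).
  have nTl : \forall h \near (0 : K), T (h *: xi + z y) by exact: (cl T nT).
  apply: filterS nTl => h [y' [Vy' cy'] zy'].
  rewrite -zy'; apply: (zeroT y' Vy' cy').
  by rewrite zy' 2!mxE xik mulr0 zk addr0.
by rewrite -vxi -(cPz y Vy); exact: (etrans (esym e5) e6).
Qed.

(** Away from the hypersurface one divides by the equation. At a point of it,
    the equation is made a coordinate by [straighten], and [holo_division]
    applies to the derivative of the equation, which vanishes with it. *)
Lemma log_division (v : vfield M) c x U :
  log_tangent zeros U v -> mopen U -> U x -> dom c x ->
  (zeros x -> exists k0, good_chart F c k0) ->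
  exists W h, [/\ open W, W (crd c x), W `<=` crd c @` (U `&` dom c),
    holo W h & forall w, W w -> 'd (Fc c) w (v c (par c w)) = h w * Fc c w].
Proof.
move=> [tv lv] oU Ux cx gc; set W1 := crd c @` (U `&` dom c).
have oW1 : open W1 by exact: oU.
pose g w := 'd (Fc c) w (v c (par c w)).
have hg : holo W1 g.
  by apply: (holo_lie oW1 (polyfun_Fc pF c)) => k; exact: (tv.1 c k).
have pFc := polyfun_Fc pF c.
have [zx|nzx] := pselect (zeros x); last first.
  have oN : open [set w | Fc c w != 0].
    apply: open_neq0 => w; apply: differentiable_continuous.
    exact: (polyfun_differentiable w pFc).
  have oW : open (W1 `&` [set w | Fc c w != 0]) by exact: openI.
  exists (W1 `&` [set w | Fc c w != 0]), (fun w => g w / Fc c w); split.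
  - exact: oW.
  - split; first by exists x.
    by apply/eqP => /(zeros_chart F_rescale cx).
  - by move=> w [].
  - apply: (holo_div oW) => [||w [] //]; first by apply: subholo hg => w [].
    exact: polyfun_holo.
  - by move=> w [_ Fw]; rewrite divfK.
have [k0 gk] := gc zx.
have [V [z [l [lc VU _ zE [f hf vE]]]]] := lv x Ux zx.
have [oV Vx _ _ _] := lc.
set W2 := crd c @` (V `&` dom c).
have oW2 : open W2 by exact: oV.
have W21 : W2 `<=` W1.
  by move=> _ [y [Vy cy] <-]; exists y => //; split=> //; exact: VU.
have g0 w : W2 w -> Fc c w = 0 -> g w = 0.
  move=> [y [Vy cy] <-] Fy; rewrite /g crdK//.
  apply: (log_field_kills_equation lc zE vE Vy cy).
  exact/(zeros_chart F_rescale cy).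
pose st := straighten F c k0; pose us := unstraighten F c k0.
pose S := setT `&` us @^-1` W2.
have cus : continuous us.
  by apply: polymap_continuous => k; exact: polyfun_unstraighten.
have cst' : continuous st.
  by apply: polymap_continuous => k; exact: polyfun_straighten.
have oS : open S by apply: (open_preimage openT oW2) => w _; exact: cus.
have hgu : holo S (fun u => g (us u)).
  apply: (holo_comp (T := W2) oS) => [u []//|k|].
    exact: (polyfun_holo oS (polyfun_unstraighten pF c k0 k)).
  exact: subholo W21 hg.
have gu0 u : S u -> u 0 k0 = 0 -> g (us u) = 0.
  by move=> [_ Wu] u0; apply: g0 => //; rewrite Fc_unstraighten.
have Sx : S (st (crd c x)).
  by split=> //=; rewrite /us straightenK//; exists x.
have x0 : st (crd c x) 0 k0 = 0.
  by rewrite replace_same; apply/(zeros_chart F_rescale cx).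
have [V' [h' [oV' V'x V'S hh gE]]] := holo_division X oS hgu gu0 Sx x0.
have oW : open (setT `&` st @^-1` V').
  by apply: (open_preimage openT oV') => w _; exact: cst'.
have WW2 w : (setT `&` st @^-1` V') w -> W2 w.
  by move=> [_ /V'S [_]]; rewrite /preimage /mkset /us straightenK.
exists (setT `&` st @^-1` V'), (fun w => h' (st w)); split.
- exact: oW.
- by split.
- by move=> w /WW2/W21.
- apply: (holo_comp (T := V') oW) => [w []//|k|//].
  exact: (polyfun_holo oW (polyfun_straighten pF c k0 k)).
- move=> w [_ Vw]; rewrite -/(g w) mulrC.
  have := gE _ Vw; rewrite /us straightenK// => ->.
  by rewrite replace_same.
Qed.

End Generation.

Section Spanned.
Context {K : numFieldType} {p q : nat}.

Local Notation M := (prod_cmanifold (Pspace K p) (Pspace K q)).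
Local Notation E := 'rV[K]_(p + q).
Local Notation A := 'rV[K]_(p.-1 + q.-1).
Variables (F : E -> K) (c : chart M) (W : set A).
Hypothesis oW : open W.

(** The fields along the chart c that are combinations, over the holomorphic
    functions on W, of homogeneous fields annihilating F. *)
Definition spanned (B : A -> E) := exists N (V : 'I_N -> E -> E)
    (f : 'I_N -> A -> K), (forall k, cone_field F (V k) /\ holo W (f k)) /\
  forall w, W w -> B w = \sum_k f k w *: V k (rehom c w).

Lemma spanned_ext B B' : (forall w, W w -> B w = B' w) ->
  spanned B -> spanned B'.
Proof.
by move=> e [N [V [f [h BE]]]]; exists N, V, f; split=> // w Ww; rewrite -e ?BE.
Qed.

Lemma spanned0 : spanned (fun=> 0).
Proof. by exists 0%N, (fun=> id), (fun _ => cst 0); split=> [[]//|w _]; rewrite big_ord0. Qed.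

Lemma spannedD B B' : spanned B -> spanned B' -> spanned (fun w => B w + B' w).
Proof.
move=> [N [V [f [h BE]]]] [N' [V' [f' [h' BE']]]].
exists (N + N')%N,
  (fun k => match fintype.split k with inl a => V a | inr b => V' b end),
  (fun k => match fintype.split k with inl a => f a | inr b => f' b end).
split=> [k|w Ww]; first by case: (fintype.split k).
rewrite BE// BE'// big_split_ord /=; congr (_ + _); apply: eq_bigr => k _.
  by rewrite (unsplitK (inl k)).
by rewrite (unsplitK (inr k)).
Qed.

Lemma spannedZ (a : A -> K) B : holo W a -> spanned B ->
  spanned (fun w => a w *: B w).
Proof.
move=> ha [N [V [f [h BE]]]]; exists N, V, (fun k w => a w * f k w).
split=> [k|w Ww]; last first.
  by rewrite BE// scaler_sumr; apply: eq_bigr => k _; rewrite scalerA.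
by split; [exact: (h k).1|exact: (holoM oW ha (h k).2)].
Qed.

Lemma spanned_cone V : cone_field F V -> spanned (fun w => V (rehom c w)).
Proof.
move=> hV; exists 1%N, (fun=> V), (fun=> cst 1); split=> [k|w _].
  by split=> //; exact: holo_cst.
by rewrite big_ord1 scale1r.
Qed.

Lemma spanned_sum (I : Type) (r : seq I) (P : pred I) (B : I -> A -> E) :
  (forall i, P i -> spanned (B i)) ->
  spanned (fun w => \sum_(i <- r | P i) B i w).
Proof.
move=> hB; elim: r => [|i r IH].
  by apply: spanned_ext spanned0 => w _; rewrite big_nil.
have [Pi|Pi] := boolP (P i); last first.
  by apply: spanned_ext IH => w _; rewrite big_cons (negbTE Pi).
by apply: spanned_ext (spannedD (hB i Pi) IH) => w _; rewrite big_cons Pi.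
Qed.

End Spanned.

Section GlobalGeneration.
Context {R : realType} {K : numFieldType} (X : complex_field R K).
Context {p q d : nat}.

Local Notation M := (prod_cmanifold (Pspace K p) (Pspace K q)).
Local Notation E := 'rV[K]_(p + q).
Local Notation A := 'rV[K]_(p.-1 + q.-1).
Local Notation L := (pullback_fst (Pspace K q) (O1 K p)).
Implicit Types (c : chart M) (x y : M) (w : A) (e : E).

Variable F : E -> K.
Hypothesis pF : polyfun F.
Hypothesis F_rescale : forall s t e, F (rescale s t e) = s ^+ d * t * F e.
Hypothesis good_charts : forall x, zeros F x -> exists c k0,
  good_chart F c k0 /\ dom c x.
Hypothesis F_spanned : forall c (W : set A) (B : A -> E), open W ->
  holo_map W B -> (forall w, W w -> B w 0 (lshift q c.1) = 0) ->
  (forall w, W w -> 'd F (rehom c w) (B w) = 0) -> spanned F c W B.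

Definition vertical e : E := row_mx 0 (rsubmx e).

Lemma vertical_lshift e a : vertical e 0 (lshift q a) = 0.
Proof. by rewrite row_mxEl mxE. Qed.

Lemma vertical_rshift e b : vertical e 0 (rshift p b) = e 0 (rshift p b).
Proof. by rewrite row_mxEr mxE. Qed.

(** Euler's relation in the coefficients, in which F is linear. *)
Lemma diff_vertical e : 'd F e (vertical e) = F e.
Proof.
pose f2 (y : 'rV[K]_1) : K := y 0 0 * F e.
have pf2 : polyfun f2.
  apply: (@polyfunM K 1 (fun z => z 0 0) (fun=> F e)).
    exact: polyfun_coord.
  exact: polyfun_cst.
pose o : 'rV[K]_1 := const_mx 1.
rewrite (@diff_line _ _ _ F f2 _ _ o o).
- have d1 : differentiable (fun z : 'rV[K]_1 => z 0 0 : K) o.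
    exact: differentiable_coord.
  have d2 := differentiable_cst (F e) o.
  by rewrite (diff_fM _ d1 d2) diff_coord diff_fcst mulr0 add0r mxE mulr1.
- exact: polyfun_differentiable.
- exact: polyfun_differentiable.
move=> h; rewrite /f2 2!mxE !mxE mulr1.
have -> : (h + 1) * F e = F (rescale 1 (h + 1) e).
  by rewrite F_rescale expr1n mul1r.
congr F.
apply/rowP => k; rewrite rescaleE [LHS]mxE [X in X + _]mxE.
case: (split_ordP k) => a ->.
  by rewrite factor_lshift vertical_lshift mulr0 add0r mul1r.
by rewrite factor_rshift vertical_rshift mulrDl mul1r.
Qed.

(** The lift of a tangent vector of the chart c to the affine slice of the cone
    where the two chart coordinates equal 1. *)
Definition lift_tangent c (u : A) : E := rehom c u - rehom c 0.

Lemma lift_tangentE c u k :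
  lift_tangent c u 0 k = rehom c u 0 k - rehom c 0 0 k.
Proof. by rewrite [LHS]mxE; congr (_ + _); rewrite [LHS]mxE. Qed.

Lemma lift_tangent_num c u j : lift_tangent c u 0 (num c j) = u 0 j.
Proof. by rewrite lift_tangentE !rehom_num mxE subr0. Qed.

Lemma lift_tangent_chartl c u : lift_tangent c u 0 (lshift q c.1) = 0.
Proof. by rewrite lift_tangentE !rehom_chartl subrr. Qed.

Lemma lift_tangent_chartr c u : lift_tangent c u 0 (rshift p c.2) = 0.
Proof. by rewrite lift_tangentE !rehom_chartr subrr. Qed.

Lemma rehom_line c h (u : A) w :
  rehom c (h *: u + w) = h *: lift_tangent c u + rehom c w.
Proof.
apply/rowP; apply: (num_cover (c := c)) => [||j].
- by rewrite rehom_chartl [RHS]mxE [X in X + _]mxE lift_tangent_chartl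
    mulr0 add0r rehom_chartl.
- by rewrite rehom_chartr [RHS]mxE [X in X + _]mxE lift_tangent_chartr
    mulr0 add0r rehom_chartr.
- rewrite rehom_num [RHS]mxE [LHS]mxE rehom_num; congr (_ + _).
  by rewrite [LHS]mxE [RHS]mxE lift_tangent_num.
Qed.

Lemma diff_Fc_lift c w u :
  'd (Fc F c) w u = 'd F (rehom c w) (lift_tangent c u).
Proof.
apply: diff_line => [||h]; last by rewrite /Fc rehom_line.
  exact: (polyfun_differentiable _ (polyfun_Fc pF c)).
exact: polyfun_differentiable.
Qed.

(* The projection to the tangent space is inverse to the lifting, up to a
   multiple of the radial field of the coefficients. *)
Lemma dehomD_lift c w u h :
  dehomD c (rehom c w) (lift_tangent c u - h *: vertical (rehom c w)) = u.
Proof.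
have subE (a b : E) k : (a - h *: b) 0 k = a 0 k - h * b 0 k.
  by rewrite mxE; congr (_ + _); rewrite 2!mxE.
rewrite dehomD_rehom; apply/rowP => j; rewrite mxE !subE lift_tangent_num.
have -> : lift_tangent c u 0 (den c j) = 0.
  by rewrite /den; case: (fintype.split j) => a;
    rewrite ?lift_tangent_chartl ?lift_tangent_chartr.
have [[-> ->]|[-> ->]] : vertical (rehom c w) 0 (num c j) = 0 /\
    vertical (rehom c w) 0 (den c j) = 0 \/
  vertical (rehom c w) 0 (num c j) = w 0 j /\
    vertical (rehom c w) 0 (den c j) = 1.
  rewrite -(rehom_num c w j) -(rehom_den c w j) /num /den.
  case: (fintype.split j) => a; rewrite ?vertical_lshift ?vertical_rshift.
    by left.
  by right.
- by ring.
- by ring.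
Qed.

Lemma dehomD_sum c e (N : nat) (f : 'I_N -> K) (V : 'I_N -> E) :
  dehomD c e (\sum_k f k *: V k) = \sum_k f k *: dehomD c e (V k).
Proof.
elim: N f V => [|N IH] f V.
  rewrite !big_ord0; apply/rowP => j; rewrite !mxE; ring.
by rewrite !big_ord_recr /= dehomDD dehomDZ IH.
Qed.

(** The lift of a section, corrected by the radial field, is a combination of
    fields of the cone; projecting back gives the section as a combination of
    descended fields, in the chart c and the trivialization given by its first
    index. The transformation laws, which are the same on both sides, extend the
    identity to all charts and trivializations. *)
Theorem log_tangent_globally_generated :
  globally_generated (twisted_log_tangent (L := L) (zeros F)).
Proof.
move=> x U s oU Ux [hs hcompat].
have [c [cx gc]] : exists c, dom c x /\
    (zeros F x -> exists k0, good_chart F c k0).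
  have [zx|nzx] := pselect (zeros F x).
    have [c [k0 [gk cx]]] := good_charts zx.
    by exists c; split=> // _; exists k0.
  by have [c cx] := dom_cover x; exists c.
pose i := c.1.
have ci y : dom c y -> ldom (l := L) i y by case.
have lUi := hs i; have tUi := lUi.1.
have oUi : mopen (U `&` ldom (l := L) i) by apply: mopenI => //; exact: ldom_open.
have Uix : (U `&` ldom (l := L) i) x by split=> //; exact: ci.
have [W [h [oW Wx WU hh hE]]] := log_division X pF F_rescale lUi oUi Uix cx gc.
pose v w := s i c (par c w).
pose B w := lift_tangent c (v w) - h w *: vertical (rehom c w).
have hv : holo_map W v.
  by move=> j; apply: subholo (tUi.1 c j) => w /WU.
have hB : holo_map W B.
  move=> k.
  have -> : (fun w => B w 0 k) = fun w =>
      lift_tangent c (v w) 0 k - h w * vertical (rehom c w) 0 k.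
    by apply/funext => w; rewrite mxE; congr (_ + _); rewrite 2!mxE.
  apply: (holoB oW).
    elim/(num_cover (c := c)): k => [||j].
    - by under eq_fun do rewrite lift_tangent_chartl; exact: holo_cst.
    - by under eq_fun do rewrite lift_tangent_chartr; exact: holo_cst.
    - by under eq_fun do rewrite lift_tangent_num; exact: hv.
  apply: (holoM oW hh); case: (split_ordP k) => a ->.
    by under eq_fun do rewrite vertical_lshift; exact: holo_cst.
  under eq_fun do rewrite vertical_rshift.
  exact: (polyfun_holo oW (polyfun_rehom c _)).
have B0 w : W w -> B w 0 (lshift q c.1) = 0.
  move=> _; rewrite mxE lift_tangent_chartl add0r 2!mxE vertical_lshift.
  by rewrite mulr0 oppr0.
have dB w : W w -> 'd F (rehom c w) (B w) = 0.
  move=> Ww; rewrite /B linearB /= diff_scale diff_vertical -diff_Fc_lift hE//.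
  by rewrite subrr.
have [N [V [f [hVf BE]]]] := F_spanned oW hB B0 dB.
pose V0 := (U `&` ldom (l := L) i) `&` [set y | dom c y /\ W (crd c y)].
have oV0 : mopen V0 by apply: mopenI => //; exact: mopen_chart.
have sE y : V0 y -> s i c y = \sum_k f k (crd c y) *: descend (V k) i c y.
  move=> [_ [cy Wy]].
  have -> : s i c y = v (crd c y) by rewrite /v crdK.
  rewrite -[LHS](dehomD_lift c (crd c y) _ (h (crd c y))) -/(B _) BE//.
  rewrite dehomD_sum; apply: eq_bigr => k _; congr (_ *: _).
  have := descend_par i c (crd c y) (hVf k).1.
  by rewrite (crdK cy) rehom_chartl invr1 scale1r => ->.
exists N, (fun k => descend (V k)), (fun k y => f k (crd c y)), V0.
split=> //.
- by move=> y [[]].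
- move=> k; split; first exact: (descend_section pF F_rescale good_charts (hVf k).1).
  apply: (mholo_chart oV0) => [y [_ []] //|].
  by apply: subholo (hVf k).2 => _ [y [_ [_ Wy]] <-].
move=> a j y Vy ya jy; have [[Uy yi] [cy Wy]] := Vy.
rewrite (hcompat a i j y Uy ya yi jy).
have tv := tUi.2 c j y (conj Uy yi) cy jy.
rewrite tv sE// linear_sum scaler_sumr; apply: eq_bigr => k _.
rewrite linearZ /= scalerA mulrC -scalerA; congr (_ *: _).
have tD := (descend_tangent i (hVf k).1).2 c j y (conj I yi) cy jy.
rewrite (descend_compat _ j ya yi) tD.
by [].
Qed.

End GlobalGeneration.

Lemma diff_sum_polyfun (K : numFieldType) (I : Type) (r : seq I) m
    (f : I -> 'rV[K]_m -> K) (a v : 'rV[K]_m) :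
  (forall i, polyfun (f i)) ->
  'd (fun z => \sum_(i <- r) f i z) a v = \sum_(i <- r) 'd (f i) a v.
Proof.
move=> pf; elim: r => [|i r IH].
  by under eq_fun do rewrite big_nil; rewrite diff_fcst big_nil.
under eq_fun do rewrite big_cons.
have d1 := polyfun_differentiable a (pf i).
have d2 := polyfun_differentiable a (polyfun_sum r xpredT pf).
by rewrite (diff_fD v d1 d2) IH big_cons.
Qed.

(** * Monomials and the universal hypersurface *)

Section Monomials.
Context {n d : nat}.
Implicit Types (al be : monom n d) (i j k : 'I_n.+1).

Lemma monom_sum al : (\sum_k val al k)%N = d.
Proof. exact/eqP/(valP al). Qed.

Lemma monom_of_subproof (b : 'I_n.+1 -> nat) : (\sum_k b k)%N = d ->
  exists al, forall k, val al k = b k :> nat.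
Proof.
move=> bd; pose a : {ffun 'I_n.+1 -> 'I_d.+1} := [ffun k => inord (b k)].
have aE k : a k = b k :> nat.
  rewrite ffunE inordK// ltnS -bd (bigD1 k)//=; exact: leq_addr.
have ad : (\sum_k a k)%N == d by rewrite (eq_bigr _ (fun k _ => aE k)) bd.
by exists (exist _ a ad) => k; exact: aE.
Qed.

Lemma pure_exists i : exists al, forall k, val al k = (if k == i then d else 0)%N :> nat.
Proof.
apply: monom_of_subproof; rewrite (bigD1 i)//= eqxx big1 ?addn0// => k ki.
by rewrite (negbTE ki).
Qed.

Definition pure i : monom n d := sval (cid (pure_exists i)).

Lemma pureE i k : val (pure i) k = (if k == i then d else 0)%N :> nat.
Proof. exact: (svalP (cid (pure_exists i))). Qed.

Lemma shift_exists j i al : exists be : monom n d,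
  (0 < val al j)%N -> forall k, val be k = (val al k - (k == j) + (k == i))%N :> nat.
Proof.
have [al0|_] := boolP (0 < val al j)%N; last by exists al.
have [|be beE] := @monom_of_subproof (fun k => val al k - (k == j) + (k == i))%N.
  have one k : (\sum_l (l == k : nat))%N = 1%N.
    rewrite (bigD1 k)//= eqxx big1// => l lk; by rewrite (negbTE lk).
  rewrite big_split /= one -[X in (_ + X)%N](one j) -big_split /=.
  rewrite -[RHS](monom_sum al); apply: eq_bigr => k _.
  by rewrite subnK//; case: eqP => // ->.
by exists be.
Qed.

(** Z_i Z^al / Z_j, when Z_j divides Z^al. *)
Definition shift j i al : monom n d := sval (cid (shift_exists j i al)).

Lemma shiftE j i al k : (0 < val al j)%N ->
  val (shift j i al) k = (val al k - (k == j) + (k == i))%N :> nat.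
Proof. by move=> al0; exact: (svalP (cid (shift_exists j i al)) al0). Qed.

Lemma monom_eq al be : (forall k, val al k = val be k :> nat) -> al = be.
Proof.
by move=> e; apply/val_inj/ffunP => k; apply/val_inj; exact: e.
Qed.

Lemma monom_other i al : al != pure i -> exists2 j, j != i & (0 < val al j)%N.
Proof.
move=> ali; apply: contrapT => no; case/eqP: ali; apply: monom_eq => k.
have al0 j : j != i -> val al j = 0%N :> nat.
  by move=> ji; apply/eqP; rewrite -leqn0 leqNgt; apply/negP => alj; apply: no; exists j.
rewrite pureE; case: eqVneq => [->|ki]; last exact: al0.
by rewrite -[RHS](monom_sum al) (bigD1 i)//= big1 ?addn0// => j ji; exact: al0.
Qed.

End Monomials.

Section UniversalEquation.
Context {K : numFieldType} {n d : nat}.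

Local Notation q := #|{: monom n d}|.
Local Notation E := 'rV[K]_(n.+1 + q).
Local Notation A := 'rV[K]_(n.+1.-1 + q.-1).
Local Notation M := (prod_cmanifold (Pspace K n.+1) (Pspace K q)).
Implicit Types (al be : monom n d) (i j k : 'I_n.+1) (e u : E).

Local Notation Zi i := (lshift q i).
Local Notation Ai al := (rshift n.+1 (enum_rank al)).

Definition mono al e : K := \prod_j e 0 (Zi j) ^+ val al j.

Definition equation e : K := \sum_al e 0 (Ai al) * mono al e.

(** Z^al / Z_j, when Z_j divides Z^al; in general the expression for which
    al_j Z^al / Z_j is the derivative of Z^al. *)
Definition mono_quo j al e : K :=
  e 0 (Zi j) ^+ (val al j).-1 * \prod_(k | k != j) e 0 (Zi k) ^+ val al k.

Lemma polyfun_mono al : polyfun (mono al).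
Proof. by apply: polyfun_prod => j; apply: polyfunX; exact: polyfun_coord. Qed.

Lemma polyfun_equation : polyfun equation.
Proof.
apply: polyfun_sum => al.
apply: (@polyfunM _ _ (fun e => e 0 (Ai al))); first exact: polyfun_coord.
exact: polyfun_mono.
Qed.

Lemma mono_rescale al s t e : mono al (rescale s t e) = s ^+ d * mono al e.
Proof.
rewrite -[in s ^+ d](monom_sum al) expr_sum -big_split; apply: eq_bigr => j _ /=.
by rewrite rescaleE factor_lshift exprMn.
Qed.

Lemma equation_rescale s t e :
  equation (rescale s t e) = s ^+ d * t * equation e.
Proof.
rewrite mulr_sumr; apply: eq_bigr => al _.
by rewrite rescaleE factor_rshift mono_rescale; ring.
Qed.

Lemma mono_quoE j al e : (0 < val al j)%N ->
  mono al e = e 0 (Zi j) * mono_quo j al e.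
Proof.
move=> al0; rewrite /mono_quo mulrA -exprS prednK//.
by rewrite /mono (bigD1 j).
Qed.

Lemma mono_shift j i al e : (0 < val al j)%N ->
  mono (shift j i al) e = e 0 (Zi i) * mono_quo j al e.
Proof.
move=> al0; rewrite /mono.
under eq_bigr => k _ do rewrite shiftE// exprD.
rewrite big_split /= mulrC; congr (_ * _).
  rewrite (bigD1 i)//= eqxx expr1 big1 ?mulr1// => k ki.
  by rewrite (negbTE ki) expr0.
rewrite (bigD1 j)//= eqxx subn1; congr (_ * _); apply: eq_bigr => k kj.
by rewrite (negbTE kj) subn0.
Qed.

Lemma mono_pure i e : mono (pure i) e = e 0 (Zi i) ^+ d.
Proof.
rewrite /mono (bigD1 i)//= pureE eqxx big1 ?mulr1// => k ki.
by rewrite pureE (negbTE ki) expr0.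
Qed.

Lemma diff_expr (a v : 'rV[K]_1) m :
  'd (fun z : 'rV[K]_1 => z 0 0 ^+ m : K) a v = m%:R * a 0 0 ^+ m.-1 * v 0 0.
Proof.
have dz : differentiable (fun z : 'rV[K]_1 => z 0 0 : K) a.
  exact: differentiable_coord.
elim: m => [|m IH].
  by under eq_fun do rewrite expr0; rewrite diff_fcst !mul0r.
have dX : differentiable (fun z : 'rV[K]_1 => z 0 0 ^+ m : K) a.
  by apply: polyfun_differentiable; apply: polyfunX; exact: polyfun_coord.
under eq_fun do rewrite exprS.
rewrite (diff_fM v dz dX) IH diff_coord.
case: m {IH dX} => [|m] /=; first by rewrite expr0; ring.
by rewrite -[m.+2%:R]natr1 exprS; ring.
Qed.

Lemma diff_mono al e j :
  'd (mono al) e (evec (Zi j)) = (val al j)%:R * mono_quo j al e.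
Proof.
pose C := \prod_(k | k != j) e 0 (Zi k) ^+ val al k.
pose f2 (z : 'rV[K]_1) := z 0 0 ^+ val al j * C.
pose a2 : 'rV[K]_1 := const_mx (e 0 (Zi j)).
pose o : 'rV[K]_1 := const_mx 1.
have dX : differentiable (fun z : 'rV[K]_1 => z 0 0 ^+ val al j : K) a2.
  by apply: polyfun_differentiable; apply: polyfunX; exact: polyfun_coord.
have dC := differentiable_cst C a2.
rewrite (@diff_line _ _ _ (mono al) f2 _ _ a2 o).
- rewrite (diff_fM _ dX dC) diff_fcst mulr0 add0r diff_expr !mxE mulr1.
  by rewrite /mono_quo -/C mulrC mulrA.
- exact: (polyfun_differentiable _ (polyfun_mono al)).
- exact: (differentiableM dX dC).
move=> h; rewrite /f2 /mono (bigD1 j)//=; congr (_ ^+ _ * _).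
  by rewrite !mxE !eqxx.
apply: eq_bigr => k kj; congr (_ ^+ _).
by rewrite !mxE eqxx /= (inj_eq (@lshift_inj _ _)) (negbTE kj) mulr0 add0r.
Qed.

Lemma diff_equation_Z e j : 'd equation e (evec (Zi j)) =
  \sum_al e 0 (Ai al) * ((val al j)%:R * mono_quo j al e).
Proof.
have pc al : polyfun (fun e : E => e 0 (Ai al)) by exact: polyfun_coord.
rewrite (diff_sum_polyfun _ _ _ (fun al => polyfunM (pc al) (polyfun_mono al))).
apply: eq_bigr => al _.
have d1 := polyfun_differentiable e (pc al).
have d2 := polyfun_differentiable e (polyfun_mono al).
rewrite (diff_fM _ d1 d2) diff_mono diff_coord mxE eq_rlshift andbF mulr0 addr0.
by [].
Qed.

Lemma equation_vertical e u (h : K) : (forall k, u 0 (Zi k) = 0) ->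
  equation (h *: u + e) = equation e + h * \sum_al u 0 (Ai al) * mono al e.
Proof.
move=> u0; rewrite mulr_sumr -big_split; apply: eq_bigr => al _ /=.
have -> : mono al (h *: u + e) = mono al e.
  by apply: eq_bigr => k _; rewrite 2!mxE u0 mulr0 add0r.
by rewrite 2!mxE; ring.
Qed.

Lemma diff_equation_A e u : (forall k, u 0 (Zi k) = 0) ->
  'd equation e u = \sum_al u 0 (Ai al) * mono al e.
Proof.
move=> u0; set S := \sum_al _.
pose f2 (z : 'rV[K]_1) := equation e + z 0 0 * S.
pose o : 'rV[K]_1 := const_mx 1.
have d1 := differentiable_cst (equation e) (0 : 'rV[K]_1).
have d2 : differentiable (fun z : 'rV[K]_1 => z 0 0 : K) 0.
  exact: differentiable_coord.
have d3 := differentiable_cst S (0 : 'rV[K]_1).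
have d4 : differentiable (fun z : 'rV[K]_1 => z 0 0 * S) 0.
  exact: (differentiableM d2 d3).
rewrite (@diff_line _ _ _ equation f2 _ _ 0 o).
- rewrite (diff_fD _ d1 d4) diff_fcst add0r (diff_fM _ d2 d3) diff_fcst.
  by rewrite mulr0 add0r diff_coord mxE mulr1.
- exact: (polyfun_differentiable _ polyfun_equation).
- exact: (differentiableD d1 d4).
by move=> h; rewrite /f2 equation_vertical// addr0 !mxE mulr1.
Qed.

End UniversalEquation.

Section UniversalFields.
Context {K : numFieldType} {n d : nat}.

Local Notation q := #|{: monom n d}|.
Local Notation E := 'rV[K]_(n.+1 + q).
Local Notation A := 'rV[K]_(n.+1.-1 + q.-1).
Local Notation M := (prod_cmanifold (Pspace K n.+1) (Pspace K q)).
Local Notation F := (@equation K n d).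
Implicit Types (al be : monom n d) (i j k : 'I_n.+1) (e u : E).

Local Notation Zi i := (lshift q i).
Local Notation Ai al := (rshift n.+1 (enum_rank al)).

(** The action of an elementary matrix on the variables, compensated in the
    coefficients so as to leave the equation invariant. One factor Z_i belongs
    to the vector field Z_i d/dZ_j, the other one is the twist. *)
Definition derivation i j e : E := row_mx
  (e 0 (Zi i) ^+ 2 *: delta_mx 0 j)
  (- \sum_(al : monom n d) (e 0 (Zi i) * (val al j)%:R * e 0 (Ai al)) *:
     delta_mx 0 (enum_rank (shift j i al))).

(** The relation between the monomial al and its shift, as a field in the
    coefficients. The factor of index g, which equals 1 in the chart where the
    field is used, gives it the weight of a vector field. *)
Definition exchange g i j al e : E := row_mx 0
  (e 0 (rshift n.+1 g) *: (e 0 (Zi i) *: delta_mx 0 (enum_rank al) -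
    e 0 (Zi j) *: delta_mx 0 (enum_rank (shift j i al)))).

Lemma derivationZ i j e k :
  derivation i j e 0 (Zi k) = e 0 (Zi i) ^+ 2 * (k == j)%:R.
Proof. by rewrite row_mxEl !mxE. Qed.

Lemma derivationA i j e b : derivation i j e 0 (rshift n.+1 b) =
  - \sum_(al : monom n d) e 0 (Zi i) * (val al j)%:R * e 0 (Ai al) *
    (b == enum_rank (shift j i al))%:R.
Proof.
rewrite row_mxEr mxE summxE; congr (- _); apply: eq_bigr => al _.
by rewrite 2!mxE.
Qed.

Lemma exchangeZ g i j al e k : exchange g i j al e 0 (Zi k) = 0.
Proof. by rewrite row_mxEl mxE. Qed.

Lemma exchangeA g i j al e b : exchange g i j al e 0 (rshift n.+1 b) =
  e 0 (rshift n.+1 g) * (e 0 (Zi i) * (b == enum_rank al)%:R -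
    e 0 (Zi j) * (b == enum_rank (shift j i al))%:R).
Proof. by rewrite row_mxEr !mxE. Qed.

Let delta_sum (al0 : monom n d) e :
  \sum_(al : monom n d) (enum_rank al == enum_rank al0)%:R * mono al e = mono al0 e :> K.
Proof.
rewrite (bigD1 al0)//= eqxx mul1r big1 ?addr0// => al ne.
by rewrite (inj_eq enum_rank_inj) (negbTE ne) mul0r.
Qed.

Lemma derivation_cone i j : cone_field F (derivation i j).
Proof.
split=> [k|s t e|e].
- case: (split_ordP k) => a ->.
    have -> : (fun e => derivation i j e 0 (Zi a)) =
        fun e => e 0 (Zi i) ^+ 2 * (a == j)%:R.
      by apply/funext => e; exact: derivationZ.
    apply: (@polyfunM _ _ (fun e => e 0 (Zi i) ^+ 2) (fun=> (a == j)%:R)).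
      by apply: polyfunX; exact: polyfun_coord.
    exact: polyfun_cst.
  have -> : (fun e => derivation i j e 0 (rshift n.+1 a)) = fun e =>
      - \sum_(al : monom n d) e 0 (Zi i) * (val al j)%:R * e 0 (Ai al) *
        (a == enum_rank (shift j i al))%:R.
    by apply/funext => e; exact: derivationA.
  apply: polyfunN; apply: polyfun_sum => al.
  apply: (@polyfunM _ _
    (fun e => e 0 (Zi i) * (val al j)%:R * e 0 (Ai al)) (fun=> _%:R)).
    apply: (@polyfunM _ _ (fun e => e 0 (Zi i) * (val al j)%:R)
      (fun e => e 0 (Ai al))); last exact: polyfun_coord.
    apply: (@polyfunM _ _ (fun e => e 0 (Zi i)) (fun=> (val al j)%:R)).
      exact: polyfun_coord.
    exact: polyfun_cst.
  exact: polyfun_cst.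
- apply/rowP => k; rewrite [RHS]mxE rescaleE; case: (split_ordP k) => a ->.
    by rewrite !derivationZ rescaleE !factor_lshift; ring.
  rewrite !derivationA factor_rshift !mulrN !mulr_sumr; congr (- _).
  by apply: eq_bigr => al _; rewrite !rescaleE !factor_lshift !factor_rshift; ring.
pose u : E := row_mx 0 (- \sum_(al : monom n d) (e 0 (Zi i) * (val al j)%:R * e 0 (Ai al)) *:
     delta_mx 0 (enum_rank (shift j i al))).
have uZ k : u 0 (Zi k) = 0 by rewrite row_mxEl mxE.
have uA b : u 0 (rshift n.+1 b) = derivation i j e 0 (rshift n.+1 b).
  by rewrite !row_mxEr.
have -> : derivation i j e = e 0 (Zi i) ^+ 2 *: evec (Zi j) + u.
  apply/rowP => k; rewrite [RHS]mxE [X in X + _]mxE.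
  case: (split_ordP k) => a ->.
    by rewrite derivationZ uZ addr0 mxE eqxx /= (inj_eq (@lshift_inj _ _)).
  by rewrite uA [X in _ * X + _]mxE eq_rlshift andbF mulr0 add0r.
rewrite linearD /= diff_scale diff_equation_Z diff_equation_A//.
under [X in _ + X]eq_bigr do rewrite uA derivationA mulNr mulr_suml.
rewrite sumrN exchange_big /= mulr_sumr -sumrB big1// => al _.
rewrite -[X in _ - X](_ : \sum_(be : monom n d)
  e 0 (Zi i) * (val al j)%:R * e 0 (Ai al) *
    ((enum_rank be == enum_rank (shift j i al))%:R * mono be e) = _); last first.
  by apply: eq_bigr => be _; rewrite mulrA.
rewrite -mulr_sumr delta_sum.
case: (posnP (val al j)) => [->|al0]; first by rewrite !(mul0r, mulr0) subrr.
by rewrite mono_shift//; ring.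
Qed.

Lemma exchange_cone g i j al : (0 < val al j)%N ->
  cone_field F (exchange g i j al).
Proof.
move=> al0; split=> [k|s t e|e].
- case: (split_ordP k) => a ->.
    have -> : (fun e => exchange g i j al e 0 (Zi a)) = fun=> 0.
      by apply/funext => e; exact: exchangeZ.
    exact: polyfun_cst.
  have -> : (fun e => exchange g i j al e 0 (rshift n.+1 a)) = fun e =>
      e 0 (rshift n.+1 g) * (e 0 (Zi i) * (a == enum_rank al)%:R -
        e 0 (Zi j) * (a == enum_rank (shift j i al))%:R).
    by apply/funext => e; exact: exchangeA.
  have pZ l (b : bool) : polyfun (fun e : E => e 0 (Zi l) * b%:R).
    apply: (@polyfunM _ _ (fun e => e 0 (Zi l)) (fun=> b%:R)).
      exact: polyfun_coord.
    exact: polyfun_cst.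
  apply: (@polyfunM _ _ (fun e => e 0 (rshift n.+1 g))).
    exact: polyfun_coord.
  by apply: polyfunB; exact: pZ.
- apply/rowP => k; rewrite [RHS]mxE rescaleE; case: (split_ordP k) => a ->.
    by rewrite !exchangeZ !mulr0.
  by rewrite !exchangeA !rescaleE !factor_rshift !factor_lshift; ring.
rewrite diff_equation_A => [|k]; last exact: exchangeZ.
under eq_bigr do rewrite exchangeA.
rewrite (eq_bigr (fun be => e 0 (rshift n.+1 g) *
  (e 0 (Zi i) * ((enum_rank be == enum_rank al)%:R * mono be e) -
   e 0 (Zi j) * ((enum_rank be == enum_rank (shift j i al))%:R * mono be e))));
  last by move=> be _; ring.
rewrite -mulr_sumr sumrB -!mulr_sumr !delta_sum mono_shift// (mono_quoE e al0).
by ring.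
Qed.

Section Span.
Variables (c : chart M) (W : set A).
Hypothesis oW : open W.

Local Notation i := c.1.
Local Notation span := (spanned F c W).

Let relation al (w : A) : E :=
  evec (Ai al) - mono al (rehom c w) *: evec (Ai (pure i)).

(** Every relation follows from exchanges, that turn the monomial al into
    Z_i ^ d one factor at a time. *)
Lemma relation_spanned al : span (relation al).
Proof.
have [m] := ubnP (d - val al i)%N; elim: m al => // m IH al alm.
have [->|ali] := eqVneq al (pure i).
  apply: spanned_ext (spanned0 F c W) => w _.
  by rewrite /relation mono_pure rehom_chartl expr1n scale1r subrr.
have [j ji al0] := monom_other ali.
have lt : (val (shift j i al) i = (val al i).+1 :> nat)%N.
  by rewrite shiftE// eqxx eq_sym (negbTE ji) subn0 addn1.
have altd : (val al i < d)%N.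
  rewrite -[X in (_ < X)%N](monom_sum al) (bigD1 i)//= -[X in (X < _)%N]addn0.
  by rewrite ltn_add2l (bigD1 j)//= ltn_addr.
have shl : span (relation (shift j i al)).
  by apply: IH; rewrite lt; move: alm altd; lia.
have pj : holo W (fun w => rehom c w 0 (Zi j)).
  exact: (polyfun_holo oW (polyfun_rehom c (Zi j))).
have sE := spanned_cone c W (exchange_cone c.2 i al0).
have sZ := spannedZ oW pj shl.
apply: (spanned_ext _ (spannedD sE sZ)) => w _.
rewrite /relation (mono_quoE _ al0) mono_shift// rehom_chartl mul1r.
have relE (m' : K) (x y k : 'I_(n.+1 + q)) :
    (evec x - m' *: evec y) 0 k = (k == x)%:R - m' * (k == y)%:R.
  by rewrite !mxE eqxx.
move: (mono_quo j al _) => m'; apply/rowP => k.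
rewrite [LHS]mxE [X in _ + X]mxE !relE; case: (split_ordP k) => a ->.
  rewrite exchangeZ !eq_lrshift !mulr0n; ring.
rewrite exchangeA rehom_chartr rehom_chartl !(inj_eq (@rshift_inj _ _)).
by ring.
Qed.

(** The components of B along the Z_j are removed with [derivation], up to the
    one along Z_i, which vanishes by assumption. The rest is a field in the
    coefficients whose components form a relation between the values of the
    monomials; it is therefore the combination of the elementary relations with
    the same components. *)
Lemma equation_spanned (B : A -> E) : holo_map W B ->
  (forall w, W w -> B w 0 (Zi i) = 0) ->
  (forall w, W w -> 'd F (rehom c w) (B w) = 0) -> span B.
Proof.
move=> hB B0 dB.
pose B' (w : A) : E := B w - \sum_(j | j != i) B w 0 (Zi j) *: derivation i j (rehom c w).
have BE w (k : 'I_(n.+1 + q)) : B' w 0 k = B w 0 k -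
    \sum_(j | j != i) B w 0 (Zi j) * derivation i j (rehom c w) 0 k.
  rewrite mxE; congr (_ + _); rewrite mxE summxE; congr (- _).
  by apply: eq_bigr => j _; rewrite mxE.
have B'Z w k : W w -> B' w 0 (Zi k) = 0.
  move=> Ww; rewrite BE.
  under eq_bigr do rewrite derivationZ rehom_chartl expr1n mul1r.
  have [->|ki] := eqVneq k i.
    rewrite B0// big1 ?subrr// => j ji.
    by rewrite eq_sym (negbTE ji) mulr0.
  rewrite (bigD1 k)//= eqxx mulr1 big1 ?addr0 ?subrr// => j /andP[_ jk].
  by rewrite eq_sym (negbTE jk) mulr0.
have dB' w : W w -> \sum_(al : monom n d) B' w 0 (Ai al) * mono al (rehom c w) = 0.
  move=> Ww; rewrite -diff_equation_A => [|k]; last exact: B'Z.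
  rewrite /B' linearB linear_sum /= dB// sub0r big1 ?oppr0// => j _.
  by rewrite diff_scale (cone_tangent (derivation_cone i j)) mulr0.
have hB' (k : 'I_(n.+1 + q)) : holo W (fun w => B' w 0 k).
  have -> : (fun w => B' w 0 k) = fun w => B w 0 k -
      \sum_(j | j != i) B w 0 (Zi j) * derivation i j (rehom c w) 0 k.
    by apply/funext => w; exact: BE.
  apply: (holoB oW (hB k)); apply: (holo_sum _ _ oW) => j.
  apply: (holoM oW (hB _)); apply: (polyfun_holo oW).
  exact: (polyfun_comp (polyfun_rehom c)
    (cone_polyfun (derivation_cone i j) k)).
have s1 : span (fun w =>
    \sum_(j | j != i) B w 0 (Zi j) *: derivation i j (rehom c w)).
  apply: spanned_sum => j _.
  by apply: (spannedZ oW (hB _)); apply: spanned_cone; exact: derivation_cone.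
have s2 : span (fun w => \sum_(al : monom n d) B' w 0 (Ai al) *: relation al w).
  by apply: spanned_sum => al _; exact: (spannedZ oW (hB' _) (relation_spanned al)).
apply: spanned_ext (spannedD s1 s2) => w Ww.
have -> : \sum_(al : monom n d) B' w 0 (Ai al) *: relation al w = B' w.
  rewrite (eq_bigr (fun al => B' w 0 (Ai al) *: evec (Ai al) -
    (B' w 0 (Ai al) * mono al (rehom c w)) *: evec (Ai (pure i)))); last first.
    by move=> al _; rewrite scalerBr scalerA.
  rewrite sumrB -scaler_suml dB'// scale0r subr0.
  have ZE (m' : K) (y k : 'I_(n.+1 + q)) :
    (m' *: evec y) 0 k = m' * (k == y)%:R by rewrite !mxE eqxx.
  apply/rowP => k; rewrite summxE; under eq_bigr do rewrite ZE.
  case: (split_ordP k) => a ->.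
    by rewrite B'Z// big1// => al _; rewrite eq_lrshift mulr0.
  rewrite (bigD1 (enum_val a))//= enum_valK eqxx mulr1 big1 ?addr0//.
  move=> al ala; rewrite (inj_eq (@rshift_inj _ _)).
  case: eqVneq => [e|_]; last by rewrite mulr0.
  by case/eqP: ala; rewrite e enum_rankK.
by rewrite addrC subrK.
Qed.

End Span.

Let num_inj (c : chart M) : injective (num c).
Proof.
move=> a b; rewrite /num; case: (split_ordP a) => a' ->;
  case: (split_ordP b) => b' ->.
- by move/lshift_inj/lift_inj ->.
- by move/eqP; rewrite eq_lrshift.
- by move/eqP; rewrite eq_rlshift.
- by move/rshift_inj/lift_inj ->.
Qed.

(** Some Z_i does not vanish, and then neither does some coefficient other than
    that of Z_i ^ d: in such a chart the equation is monic of degree 1 in the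
    coefficient of Z_i ^ d. *)
Lemma universal_good_charts (x : M) : zeros F x ->
  exists c (k0 : 'I_(n.+1.-1 + q.-1)), good_chart F c k0 /\ dom c x.
Proof.
move=> zx; have [i xi] := pspace_dom_cover x.1.
have [al [ali xal]] : exists al,
    al != pure i /\ homog x.2 0 (enum_rank al) != 0.
  apply: contrapT => no.
  have x0 al : al != pure i -> homog x.2 0 (enum_rank al) = 0.
    by move=> ali; apply/eqP; apply: contrapT => /negP xal; apply: no; exists al.
  have := homog_neq0 x.2; case/eqP; apply/rowP => a; rewrite mxE.
  rewrite -(enum_valK a); have [->|ne] := eqVneq (enum_val a) (pure i); last exact: x0.
  have : F (homs x) = 0 by exact: zx.
  rewrite /equation (bigD1 (pure i))//= mono_pure row_mxEr row_mxEl.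
  rewrite big1 => [|be bei]; last by rewrite row_mxEr x0// mul0r.
  by move=> /eqP; rewrite addr0 mulf_eq0 expf_eq0 (negbTE xi) andbF orbF => /eqP.
pose c : chart M := (i, enum_rank al).
have ne : enum_rank al != enum_rank (pure i).
  by rewrite (inj_eq enum_rank_inj).
have [b bE _] := unlift_some ne.
pose k0 : 'I_(n.+1.-1 + q.-1) := rshift n.+1.-1 b.
have nk0 : num c k0 = Ai (pure i).
  by rewrite /num (unsplitK (inr b)) /= -bE.
exists c, k0; split; last by split.
move=> w; rewrite /Fc.
have uZ k : (evec (Ai (pure i)) : E) 0 (Zi k) = 0.
  by rewrite mxE eq_lrshift andbF.
have -> : rehom c w = w 0 k0 *: evec (Ai (pure i)) + rehom c (replace k0 w 0).
  apply/rowP; apply: (num_cover (c := c)) => [||j].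
  - by rewrite rehom_chartl [RHS]mxE [X in X + _]mxE uZ mulr0 add0r rehom_chartl.
  - rewrite rehom_chartr [RHS]mxE [X in X + _]mxE rehom_chartr mxE eqxx /=.
    by rewrite (inj_eq (@rshift_inj _ _)) (negbTE ne) mulr0 add0r.
  - rewrite rehom_num [RHS]mxE [X in X + _]mxE rehom_num replaceE -nk0 mxE eqxx /=.
    rewrite (inj_eq (@num_inj c)); case: eqP => [->|_].
      by rewrite mulr1 addr0.
    by rewrite mulr0 add0r.
rewrite (equation_vertical _ _ uZ) addrC; congr (_ + _).
rewrite (bigD1 (pure i))//= mxE !eqxx mul1r big1 ?addr0.
  by rewrite mono_pure (rehom_chartl c) expr1n mulr1.
move=> be bei; rewrite mxE eqxx /= (inj_eq (@rshift_inj _ _)).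
by rewrite (inj_eq enum_rank_inj) (negbTE bei) mul0r.
Qed.

End UniversalFields.

(** * The field of complex numbers *)

Lemma complex_numbers (R : realType) : complex_field R (R[i] : numFieldType).
Proof.
pose rc : {rmorphism R -> (R[i] : numFieldType)} := real_complex R.
apply: (@ComplexField R (R[i] : numFieldType) rc (@complex.Re R) (@complex.Im R) 'i%C).
- exact: complexE.
- by move=> a b; rewrite /rc /=; simpc.
- by move=> a b; rewrite /rc /=; simpc.
- by rewrite -expr2 sqr_i.
- move=> a b; rewrite -add_Re2_Im2 /rc /=; by simpc.
- exact: lecR.
- case=> a b; rewrite ltcE /= => /andP[/eqP -> a0].
  by exists a.
Qed.

(** * Global generation for the universal hypersurface *)

Lemma universal_hypersurface_zeros (K : numFieldType) (n d : nat) :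
  universal_hypersurface K n d = zeros (@equation K n d).
Proof.
apply/funext => x; rewrite /universal_hypersurface /zeros /mkset; congr (_ = 0).
apply: eq_bigr => al _; rewrite /homs row_mxEr; congr (_ * _).
by apply: eq_bigr => j _; rewrite row_mxEl.
Qed.

Unset Implicit Arguments.

Theorem proposition11 (R : realType) (n d : nat) (hn : (0 < n)%N)
    (hd : (0 < d)%N) :
  globally_generated (twisted_log_tangent_bundle R[i] n d).
Proof.
rewrite /twisted_log_tangent_bundle universal_hypersurface_zeros.
apply: (log_tangent_globally_generated (complex_numbers R)
  polyfun_equation equation_rescale universal_good_charts).
by move=> c W B oW hB B0 dB; exact: (equation_spanned oW hB B0 dB).
Qed.
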